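(* Let $\gamma_{\mathbf s}$ be an automorphism or anti-automorphism of order two of $\mathfrak{gl}(X)$ with structure map $\mathbf s$, where $X$ is a finite-dimensional real inner product space, and let $L\in\mathfrak{gl}_\mu(X)=\{A\in\mathfrak{gl}(X)\mid\gamma_{\mathbf s}(A)=\mu A\}$ be a linear map in one of the eigenspaces of $\gamma_{\mathbf s}$, where $X$ is an indecomposable $(L,\mathbf s)$-invariant space. Let $L=S+N$ be the Jordan-Chevalley decomposition of $L$. Then the normal form of $L$ on $X$ is determined by the normal form of $S$ on $Y$, where $Y\subset X$ is a reduced space. The normal forms of $S$, together with the reduced structure map $\mathbf t$ on $Y=Y_\lambda$, are the following. Here $$I_2=\begin{pmatrix}1&0\\ 0&1\end{pmatrix},\ R=\begin{pmatrix}1&0\\ 0&-1\end{pmatrix},\ T=\begin{pmatrix}0&1\\ 1&0\end{pmatrix},\ J=\begin{pmatrix}0&-1\\ 1&0\end{pmatrix},$$ $A=\alpha I_2+\beta J$, $A^*=\alpha I_2-\beta J$, $K_\pm=\begin{pmatrix}0&\pm I_2\\ I_2&0\end{pmatrix}$, $\alpha,\beta\in\mathbb R$; $\lambda$ denotes the eigenvalue(s) of $S$ on $Y_\lambda$. Automorphisms. Type 1 ($\mathbf t^*=\mathbf t$, $\mu=1$): $\lambda=\alpha$, $Y_\lambda=W_\alpha$, $\mathbf t=\pm1$, $S=\alpha$ (sign); $\lambda=\alpha\pm i\beta$, $Y_\lambda=W_{\alpha\pm i\beta}$, $\mathbf t=\pm I_2$, $S=A$, $\beta>0$ (sign). Type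 2 ($\mathbf t^*=\mathbf t$, $\mu=-1$): $\lambda=0$, $Y_\lambda=W_0$, $\mathbf t=\pm1$, $S=0$ (sign); $\lambda=\pm\alpha$, $Y_\lambda=W_\alpha\oplus W_{-\alpha}$, $\mathbf t=T$, $S=\mathrm{diag}(\alpha,-\alpha)$, $\alpha>0$; $\lambda=\pm i\beta$, $Y_\lambda=W_{\pm i\beta}$, $\mathbf t=R$, $S=\beta J$, $\beta>0$; $\lambda=\pm\alpha\pm i\beta$, $Y_\lambda=W_{\alpha\pm i\beta}\oplus W_{-\alpha\pm i\beta}$, $\mathbf t=K_+$, $S=\mathrm{diag}(A,-A)$, $\alpha>0$, $\beta>0$. Type 3 ($\mathbf t^*=-\mathbf t$, $\mu=1$): $\lambda=\alpha\pm i\beta$, $Y_\lambda=W_{\alpha\pm i\beta}$, $\mathbf t=\pm J$, $S=A$, $\beta\ge0$ (sign; it disappears for real eigenvalues, $\beta=0$). Type 4 ($\mathbf t^*=-\mathbf t$, $\mu=-1$): $\lambda=\pm\alpha$, $Y_\lambda=W_\alpha\oplus W_{-\alpha}$, $\mathbf t=J$, $S=\mathrm{diag}(\alpha,-\alpha)$, $\alpha\ge0$; $\lambda=\pm\alpha\pm i\beta$, $Y_\lambda=W_{\alpha\pm i\beta}\oplus W_{-\alpha\pm i\beta}$, $\mathbf t=K_-$, $S=\mathrm{diag}(A,-A)$, $\alpha\ge0$, $\beta>0$. Anti-automorphisms. Type 5 ($\mathbf t^*=\mathbf t$, $\mu=1$): $\lambda=\alpha$, $Y_\lambda=W_\alpha$,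 $\mathbf t=\pm1$, $S=\alpha$ (sign); $\lambda=\alpha\pm i\beta$, $Y_\lambda=W_{\alpha\pm i\beta}$, $\mathbf t=R$, $S=A$, $\beta>0$. Type 6 ($\mathbf t^*=\mathbf t$, $\mu=-1$): $\lambda=0$, $Y_\lambda=W_0$, $\mathbf t=\pm1$, $S=0$ (sign); $\lambda=\pm\alpha$, $Y_\lambda=W_\alpha\oplus W_{-\alpha}$, $\mathbf t=T$, $S=\mathrm{diag}(\alpha,-\alpha)$, $\alpha>0$; $\lambda=\pm i\beta$, $Y_\lambda=W_{\pm i\beta}$, $\mathbf t=\pm I_2$, $S=\beta J$, $\beta>0$ (sign); $\lambda=\pm\alpha\pm i\beta$, $Y_\lambda=W_{\alpha\pm i\beta}\oplus W_{-\alpha\pm i\beta}$, $\mathbf t=K_+$, $S=\mathrm{diag}(A,-A^* )$, $\alpha>0$, $\beta>0$. Type 7 ($\mathbf t^*=-\mathbf t$, $\mu=1$): $\lambda=\alpha$ (double), $Y_\lambda=W_\alpha\oplus\mathbf tW_\alpha$, $\mathbf t=J$, $S=\alpha I_2$; $\lambda=\alpha\pm i\beta$, $Y_\lambda=W_{\alpha\pm i\beta}\oplus\mathbf tW_{\alpha\pm i\beta}$, $\mathbf t=K_-$, $S=\mathrm{diag}(A,A^* )$, $\beta>0$. Type 8 ($\mathbf t^*=-\mathbf t$, $\mu=-1$): $\lambda=\pm\alpha$, $Y_\lambda=W_\alpha\oplus W_{-\alpha}$, $\mathbf t=J$, $S=\mathrm{diag}(\alpha,-\alpha)$, $\alpha\ge0$;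 $\lambda=\pm i\beta$, $Y_\lambda=W_{\pm i\beta}$, $\mathbf t=\pm J$, $S=\beta J$, $\beta>0$ (sign); $\lambda=\pm\alpha\pm i\beta$, $Y_\lambda=W_{\alpha\pm i\beta}\oplus W_{-\alpha\pm i\beta}$, $\mathbf t=K_-$, $S=\mathrm{diag}(A,-A^* )$, $\alpha>0$, $\beta>0$. In the entries marked (sign) the normal forms for $+$ and $-$ are inequivalent.
   Context: $\mathfrak{gl}(X)$ is the space of linear maps $X\to X$, $GL(X)$ the group of invertible ones. A linear map $\gamma$ of $\mathfrak{gl}(X)$ is an automorphism if $\gamma(AB)=\gamma(A)\gamma(B)$ ($\sigma(\gamma)=1$), an anti-automorphism if $\gamma(AB)=\gamma(B)\gamma(A)$ ($\sigma(\gamma)=-1$). Automorphisms have the form $A\mapsto\mathbf s^{-1}A\mathbf s$, anti-automorphisms the form $A\mapsto\mathbf s^{-1}A^*\mathbf s$, with invertible structure map $\mathbf s$ and $A^*$ the adjoint for the inner product. For order two, $\mathbf s$ is taken orthogonal with $\mathbf s^2=\pm I$ (so $\mathbf s^*=\pm\mathbf s$), and $\mu=\pm1$. Jordan-Chevalley decomposition: $L=S+N$ with $S$ semisimple (diagonalizable over $\mathbb C$), $N$ nilpotent, $SN=NS$; both lie in $\mathfrak{gl}_\mu(X)$. The height of $N$ is the least $n$ with $N^n=0$. $X$ is an indecomposable $(L,\mathbf s)$-invariant space if it is nonzero, invariant under $L$ and $\mathbf s$, and not the direct sum of two nonzero subspaces each invariant under both $L$ and $\mathbf s$. Reduced space $Y$: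 an $S$-invariant complement of $NX$ in $X$ such that $X=Y\oplus NY\oplus\cdots\oplus N^{n-1}Y$, $n$ being the height of $N$. Reduced structure map $\mathbf t$ on $Y$: for automorphisms, $Y$ is $\mathbf s$-invariant and $\mathbf t=\mathbf s|_Y$; for anti-automorphisms, with $\omega(x,y)=\langle x,\mathbf sy\rangle$, $\mathbf t$ is defined by $\omega(x,N^{n-1}y)=\langle x,\mathbf ty\rangle_Y$ for $x,y\in Y$. Then $\gamma_{\mathbf t}(S)=\mu S$ on $Y$. The type refers to the kind of $\gamma$ (automorphism or anti-automorphism), the symmetry of $\mathbf t$, and $\mu$; for anti-automorphisms with $\mu=-1$, $\mathbf t$ may be symmetric or skew whichever $\mathbf s$ is. $W_\lambda$ denotes an indecomposable $S$-invariant space on which $S$ has eigenvalue $\lambda$ (one-dimensional for real $\lambda$, two-dimensional for a complex conjugate pair), and $Y_\lambda=W_\lambda+\mathbf tW_\lambda$ is an indecomposable $(S,\mathbf t)$-invariant space. Normal forms are representatives of the orbits of $GL_{\mathbf t}^{\sigma(\gamma)}(Y)=\{g\in GL(Y)\mid\gamma_{\mathbf t}(g)=g^{\sigma(\gamma)}\}$ acting by $S\mapsto gSg^{-1}$ once $\mathbf t$ has been chosen; equivalently, representatives of the $GL(Y)$-orbits of pairs $(S,\mathbf t)$ under $(S,\mathbf t)\mapsto(gSg^{-1},g\mathbf tg^{-1})$ for automorphisms and $(S,\mathbf t)\mapsto(gSg^{-1},g\mathbf tg^* )$ for anti-automorphisms. ''Inequivalent'' means lying in different orbits. Normal forms of $L$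 on $X$ are understood in the same way, with $(L,\mathbf s)$ in place of $(S,\mathbf t)$.
   Formalization: Indecomposability is required along the whole GL(X)-orbit of (L,s), since for anti-automorphisms the literal condition fails (s=diag(1,-1), μ=1, L=[3 1; -1 0]); for anti-automorphisms t transforms by t=g*t'g, as t↦gtg* need not preserve γ_t(S)=μS. *)

(* Defs.v *)
From HB Require Import structures.
From mathcomp Require Import all_boot all_order all_algebra sesquilinear.
From mathcomp Require Import boolp classical_sets reals.
From mathcomp Require Import complex.

Set Implicit Arguments.
Unset Strict Implicit.
Unset Printing Implicit Defensive.

Import Order.TTheory GRing.Theory Num.Theory.
Local Open Scope ring_scope.

Variant kind := Aut | Antiaut.

Variant sign := Plus | Minus.

Definition sg (R : realType) (e : sign) : R := if e is Plus then 1 else -1.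
Arguments sg {R} e.

Section Maps.
Variables (R : realType) (V : vectType R) (dot : V -> V -> R).
Implicit Types (A L S N s t : 'End(V)) (U Y : {vspace V}).

(* [adjoint] is meaningful when [dot] is an inner product: see [adjointE]. *)
Definition adjoint A : 'End(V) :=
  xget 0 [set B : 'End(V) | forall x y, dot (A x) y = dot x (B y)].

Definition gamma (k : kind) s A : 'End(V) :=
  (s^-1 \o ((if k is Aut then A else adjoint A) \o s))%VF.

(* "Order two" means that gamma k s is an involution; gamma k s = id is
   allowed, since the forms with t = +1 or -1 and mu = 1 require it. *)
Definition order_two_structure_map s : Prop :=
  (forall x y, dot (s x) (s y) = dot x y) /\
  exists e : sign, (s \o s)%VF = sg e *: \1%VF.

(* Diagonalizability over R[i] does not depend on the basis. *)
Definition semisimple S : Prop :=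
  diagonalizable (map_mx (real_complex R)
                         (passmx.mxof (vbasis {:V}) (vbasis {:V}) S)).

Definition jordan_chevalley L S N : Prop :=
  [/\ L = S + N, semisimple S, exists n, forall x, iter n N x = 0
    & (S \o N)%VF = (N \o S)%VF].

Definition height N n : Prop :=
  (forall x, iter n N x = 0) /\
  forall m, (forall x, iter m N x = 0) -> (n <= m)%N.

Definition direct_sum U1 U2 U : Prop :=
  (U1 :&: U2 = 0)%VS /\ (U1 + U2 = U)%VS.

Definition stable (fs : seq 'End(V)) U : bool :=
  all (fun f : 'End(V) => (f @: U <= U)%VS) fs.

Definition indecomposable (fs : seq 'End(V)) U : Prop :=
  [/\ U != 0%VS, stable fs U
    & ~ exists U1 U2, [/\ U1 != 0%VS, U2 != 0%VS, direct_sum U1 U2 U,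
                          stable fs U1 & stable fs U2]].

Definition reduced_space (k : kind) s S N (n : nat) Y : Prop :=
  [/\ stable [:: S] Y,
      direct_sum Y (limg N) {:V}%VS,
      directv (\sum_(i < n) iter i (lfun_img N) Y),
      (\sum_(i < n) iter i (lfun_img N) Y)%VS = {:V}%VS
    & if k is Aut then stable [:: s] Y else true].

(* Only the restriction of t to Y matters. The inner product on Y is the
   restriction of [dot]. *)
Definition reduced_structure_map (k : kind) s N (n : nat) Y t : Prop :=
  stable [:: t] Y /\
  match k with
  | Aut => {in Y, forall x, t x = s x}
  | Antiaut => {in Y &, forall x y, dot x (s (iter n.-1 N y)) = dot x (t y)}
  end.

Definition reduction (k : kind) s S N Y t : Prop :=
  exists n, [/\ height N n, reduced_space k s S N n Y
              & reduced_structure_map k s N n Y t].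

Definition has_symmetry (e : sign) Y t : Prop :=
  {in Y &, forall x y, dot (t x) y = sg e * dot x (t y)}.

End Maps.

Arguments direct_sum {R V}.
Arguments stable {R V}.
Arguments indecomposable {R V}.
Arguments semisimple {R V}.
Arguments jordan_chevalley {R V}.

(* (Y, S, t) and (Y', S', t') are related by a linear isomorphism g : Y -> Y'
   with S' = g S g^-1 and
     - t' = g t g^-1 for automorphisms,
     - t = g^* t' g, i.e. t' = g^-* t g^-1, for anti-automorphisms.
   This last action is the one preserving t^-1 S^* t = mu S for arbitrary t.
   If t and t' are orthogonal with squares I or -I, inverting the equation
   gives t' = g t g^*, so that both actions have the same orbits; but the
   reduced structure map need not be orthogonal. *)
Definition equivalent (R : realType) (k : kind) (V V' : vectType R)
    (dot : V -> V -> R) (dot' : V' -> V' -> R)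
    (Y : {vspace V}) (Y' : {vspace V'})
    (S t : 'End(V)) (S' t' : 'End(V')) : Prop :=
  exists g : 'Hom(V, V'),
    [/\ (g @: Y)%VS = Y',
        {in Y &, injective g},
        {in Y, forall x, g (S x) = S' (g x)}
      & match k with
        | Aut => {in Y, forall x, g (t x) = t' (g x)}
        | Antiaut =>
            {in Y &, forall x y, dot' (g x) (t' (g y)) = dot x (t y)}
        end].

(* Indecomposability of a pair is required along its whole GL-orbit. For
   automorphisms this is the same as indecomposability under L and s. For
   anti-automorphisms invariance under s depends on the inner product: on R^2
   with s = diag(1, -1) and mu = 1, the map L = [3 1; -1 0] has no eigenvector
   that is also an eigenvector of s, but it has distinct real eigenvalues and
   is equivalent to a diagonal map with the same s. *)
Definition indecomposable_pair (R : realType) (k : kind) (V : vectType R)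
    (dot : V -> V -> R) (L s : 'End(V)) : Prop :=
  forall L' s' : 'End(V),
    equivalent k dot dot {:V}%VS {:V}%VS L s L' s' ->
    indecomposable [:: L'; s'] {:V}%VS.

Definition indecomposable_system (R : realType) (k : kind) (mu : sign)
    (V : vectType R) (dot : V -> V -> R) (s L : 'End(V)) : Prop :=
  [/\ order_two_structure_map dot s,
      gamma dot k s L = sg mu *: L
    & indecomposable_pair k dot L s].

Section NormalForms.
Variable R : realType.

Definition std_dot (n : nat) (x y : 'cV[R]_n) : R := (x^T *m y) 0 0.

Definition mxfun (n : nat) (M : 'M[R]_n) : 'End('cV[R]_n) :=
  linfun (mulmx M).

Definition mx22 (a b c d : R) : 'M[R]_2 :=
  \matrix_(i, j) if i == 0 then if j == 0 then a else b
                 else if j == 0 then c else d.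

Definition mxR := mx22 1 0 0 (-1).
Definition mxT := mx22 0 1 1 0.
Definition mxJ := mx22 0 (-1) 1 0.
Definition mxA (a b : R) : 'M[R]_2 := a *: 1%:M + b *: mxJ.
Definition mxK (e : sign) : 'M[R]_(2 + 2) :=
  block_mx 0 (sg e *: 1%:M) 1%:M 0.
Definition diag2 (B C : 'M[R]_2) : 'M[R]_(2 + 2) := block_mx B 0 0 C.

(* [normal_form k eps mu S t]: (S, t) is a normal form for gamma_t of kind k,
   t^* = eps t and gamma_t(S) = mu S; e is the free sign of an entry. *)
Inductive normal_form :
    kind -> sign -> sign -> forall n, 'M[R]_n -> 'M[R]_n -> Prop :=

| nf1_real (e : sign) (a : R) :
    @normal_form Aut Plus Plus 1 (a%:M) ((sg e)%:M)
| nf1_complex (e : sign) (a b : R) : 0 < b ->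
    @normal_form Aut Plus Plus 2 (mxA a b) (sg e *: 1%:M)

| nf2_zero (e : sign) :
    @normal_form Aut Plus Minus 1 0 ((sg e)%:M)
| nf2_real (a : R) : 0 < a ->
    @normal_form Aut Plus Minus 2 (mx22 a 0 0 (- a)) mxT
| nf2_imaginary (b : R) : 0 < b ->
    @normal_form Aut Plus Minus 2 (b *: mxJ) mxR
| nf2_complex (a b : R) : 0 < a -> 0 < b ->
    @normal_form Aut Plus Minus 4 (diag2 (mxA a b) (- mxA a b)) (mxK Plus)

(* For b = 0 the two signs are equivalent, and only t = J is listed. *)
| nf3 (e : sign) (a b : R) : 0 <= b -> (b = 0 -> e = Plus) ->
    @normal_form Aut Minus Plus 2 (mxA a b) (sg e *: mxJ)

| nf4_real (a : R) : 0 <= a ->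
    @normal_form Aut Minus Minus 2 (mx22 a 0 0 (- a)) mxJ
| nf4_complex (a b : R) : 0 <= a -> 0 < b ->
    @normal_form Aut Minus Minus 4 (diag2 (mxA a b) (- mxA a b)) (mxK Minus)

| nf5_real (e : sign) (a : R) :
    @normal_form Antiaut Plus Plus 1 (a%:M) ((sg e)%:M)
| nf5_complex (a b : R) : 0 < b ->
    @normal_form Antiaut Plus Plus 2 (mxA a b) mxR

| nf6_zero (e : sign) :
    @normal_form Antiaut Plus Minus 1 0 ((sg e)%:M)
| nf6_real (a : R) : 0 < a ->
    @normal_form Antiaut Plus Minus 2 (mx22 a 0 0 (- a)) mxT
| nf6_imaginary (e : sign) (b : R) : 0 < b ->
    @normal_form Antiaut Plus Minus 2 (b *: mxJ) (sg e *: 1%:M)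
| nf6_complex (a b : R) : 0 < a -> 0 < b ->
    @normal_form Antiaut Plus Minus 4 (diag2 (mxA a b) (- (mxA a b)^T))
      (mxK Plus)

| nf7_real (a : R) :
    @normal_form Antiaut Minus Plus 2 (a *: 1%:M) mxJ
| nf7_complex (a b : R) : 0 < b ->
    @normal_form Antiaut Minus Plus 4 (diag2 (mxA a b) (mxA a b)^T) (mxK Minus)

| nf8_real (a : R) : 0 <= a ->
    @normal_form Antiaut Minus Minus 2 (mx22 a 0 0 (- a)) mxJ
| nf8_imaginary (e : sign) (b : R) : 0 < b ->
    @normal_form Antiaut Minus Minus 2 (b *: mxJ) (sg e *: mxJ)
| nf8_complex (a b : R) : 0 < a -> 0 < b ->
    @normal_form Antiaut Minus Minus 4 (diag2 (mxA a b) (- (mxA a b)^T))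
      (mxK Minus).

Definition equivalent_mx (k : kind) (n : nat) (S t S' t' : 'M[R]_n) : Prop :=
  equivalent k (@std_dot n) (@std_dot n) {:'cV[R]_n}%VS {:'cV[R]_n}%VS
    (mxfun S) (mxfun t) (mxfun S') (mxfun t').

End NormalForms.

Section AdjointTheory.
Variables (R : realType) (V : vectType R) (dot : {dot V for @idfun R}).

Lemma dotC x y : dot x y = dot y x.
Proof. by rewrite hermC /= expr0 mul1r. Qed.

Lemma adjointE (A : 'End(V)) x y : dot (A x) y = dot x (adjoint dot A y).
Proof.
suff [B hB] : exists B : 'End(V), forall x y, dot (A x) y = dot x (B y).
  by rewrite /adjoint; case: xgetP => [C _ /= ->|/(_ B)].
pose e := vbasis {:V}.
pose f (v : V) : 'rV[R]_(\dim {:V}) := \row_i dot v e`_i.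
pose h (v : V) : 'rV[R]_(\dim {:V}) := \row_i dot v (A e`_i).
have f_lin : linear f.
  by move=> a u v; apply/rowP => i; rewrite !mxE linearPl.
have h_lin : linear h.
  by move=> a u v; apply/rowP => i; rewrite !mxE linearPl.
pose f' : {linear V -> 'rV[R]_(\dim {:V})} :=
  HB.pack f (GRing.isLinear.Build R V 'rV[R]_(\dim {:V}) _ f f_lin).
pose h' : {linear V -> 'rV[R]_(\dim {:V})} :=
  HB.pack h (GRing.isLinear.Build R V 'rV[R]_(\dim {:V}) _ h h_lin).
have expand (v : V) : v = \sum_i coord e i v *: e`_i.
  by apply: coord_vbasis; apply: memvf.
have f_inj : lker (linfun f') == 0%VS.
  rewrite -subv0; apply/subvP => v; rewrite memv_ker memv0 lfunE /= => /eqP fv0.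
  apply: contraT => /(@neq0_dnorm_gt0 _ _ _ dot).
  rewrite {2}(expand v) linear_sumr /= big1 ?ltxx // => i _.
  rewrite linearZr /=; have /rowP/(_ i) := fv0.
  by rewrite !mxE => ->; rewrite mulr0.
have f_surj : limg (linfun f') = {:'rV[R]_(\dim {:V})}%VS.
  apply/eqP; rewrite eqEdim subvf /= limg_dim_eq ?(eqP f_inj) ?capv0//.
  have -> : \dim {:'rV[R]_(\dim {:V})} = (1 * \dim {:V})%N by rewrite dimvf.
  by rewrite mul1n.
exists ((linfun f')^-1 \o linfun h')%VF => {}x {}y; rewrite comp_lfunE.
set z := ((linfun f')^-1 _)%VF.
have zE (i : 'I_(\dim {:V})) : dot z e`_i = dot y (A e`_i).
  have : linfun f' z = linfun h' y.
    by rewrite limg_lfunVK // f_surj memvf.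
  by rewrite !lfunE /= => /rowP/(_ i); rewrite !mxE.
rewrite dotC [RHS]dotC [in LHS](expand x) [in RHS](expand x) !linear_sum /=.
by apply: eq_bigr => i _; rewrite !linearZ /= zE.
Qed.

End AdjointTheory.

(* Main.v *)
(** The map S inherits the relation between L and s, since an operator that
    intertwines two linear maps intertwines their semisimple parts. An
    operator T that is a polynomial in S, and even or odd in S when mu = -1,
    respects s up to sign; as S is semisimple, X is the direct sum of ker T
    and im T, so one of them vanishes. Hence the eigenvalues of S form a single
    family a, a +- ib, +-a or +-a +- ib. Averaging projections then yields
    complements invariant under S and s, and with them a reduced space. On a
    minimal reduced space the classification is linear algebra: one picks a
    vector, an eigenvector of an involution that commutes with S or a vector on
    which the form is not isotropic, and S and t map it to a basis.

    Conversely, an equivalence between reduced spaces extends along the powers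
    of N. For automorphisms the extension respects s. For anti-automorphisms it
    respects the forms only up to a unipotent factor which commutes with S and
    N, and the square root of this factor is used to correct it. Finally trace,
    determinant and the sign of a Gram matrix separate the normal forms. *)

Require Import Defs.
From HB Require Import structures.
From mathcomp Require Import all_boot all_order all_algebra sesquilinear.
From mathcomp Require Import boolp classical_sets reals.
From mathcomp Require Import complex ring lra zify.

Set Implicit Arguments.
Unset Strict Implicit.
Unset Printing Implicit Defensive.

Import Order.TTheory GRing.Theory Num.Theory.
Local Open Scope ring_scope.

(** * The Jordan-Chevalley decomposition respects structure maps *)

(** For anti-automorphisms everything depends on the form [dot x (s y)] alone: it is what an
    equivalence preserves, while invariance under [s] changes along an orbit. Summands are therefore
    required to be orthogonal for this form, and adjoints serve only to translate the hypotheses and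
    to represent forms by maps. Minimality comes from a count. Let [m + 1] be the height of [N].
    Call an [S]-invariant [Y] nondegenerate if it is [s]-invariant and [N ^ m] is injective on it,
    respectively if the form [dot x (s (N ^ m y))] is nondegenerate on it. The sum of the [N ^ i Y]
    then splits off from [X], so indecomposability makes it all of [X], and
    [\dim X = (m + 1) * \dim Y] for every nonzero nondegenerate [Y]. Hence none of them contains a
    smaller one, and a basis of a nondegenerate subspace found inside [Y] is a basis of [Y]. Reduced
    spaces are among these subspaces. The classification produces its basis inside any invariant
    nondegenerate subspace. It thus bounds the dimension of every summand from below, and this bound
    proves that the listed pairs are indecomposable. *)

Section Intertwining.
Variables (F : fieldType) (n : nat).
Implicit Types (S N C P : 'M[F]_n).

(* At [C], the operator [X |-> X S - S' X] acts as [X |-> N' X - X N], which is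
   nilpotent. Being diagonalizable it annihilates [C]. *)
Lemma jordan_intertwine S S' N N' C m :
  diagonalizable S -> diagonalizable S' -> N ^+ m = 0 -> N' ^+ m = 0 ->
  S *m N = N *m S -> S' *m N' = N' *m S' ->
  C *m (S + N) = (S' + N') *m C -> C *m S = S' *m C.
Proof.
move=> [P Pu /diagonalizable_forPex[d /(simmxP Pu) dS]].
move=> [Q Qu /diagonalizable_forPex[d' /(simmxP Qu) dS']] Nm N'm SN SN' CL.
have {}dS : S *m invmx P = invmx P *m diag_mx d.
  by apply: (can_inj (mulKmx Pu)); rewrite mulmxA dS mulmxK // mulKVmx.
pose delta X := X *m S - S' *m X.
have deltaT k : iter k.+1 delta C = N' *m iter k delta C - iter k delta C *m N.
  elim: k => [|k IH].
    rewrite /= /delta; apply/eqP; rewrite subr_eq addrAC eq_sym subr_eq eq_sym.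
    by rewrite -mulmxDr CL mulmxDl addrC.
  rewrite iterS [in LHS]IH [in RHS]iterS /delta.
  rewrite !(mulmxBl, mulmxBr) !mulmxA SN' -!mulmxA SN !opprB.
  by rewrite addrACA [RHS]addrACA [X in _ = _ + X]addrC.
(* Each application of [delta] adds a factor [N'] on the left or [N] on the right, so after [2 m] of
   them one side carries an [m]-th power. *)
have nil_delta k a b : (m.*2 <= a + b + k)%N ->
    N' ^+ a *m iter k delta C *m N ^+ b = 0.
  elim: k a b => [|k IH] a b hab.
    have [ma|am] := leqP m a.
      by rewrite -(subnK ma) exprD N'm mulr0 !mul0mx.
    have mb : (m <= b)%N by lia.
    by rewrite -(subnKC mb) exprD Nm mul0r mulmx0.
  rewrite deltaT mulmxBr mulmxBl.
  rewrite mulmxA -[N' ^+ a *m N']/(N' ^+ a * N') -exprSr IH ?sub0r; last by lia.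
  rewrite mulmxA -mulmxA -[N *m N ^+ b]/(N * N ^+ b) -exprS IH ?oppr0 //; lia.
have {nil_delta} := nil_delta m.*2 0%N 0%N (leqnn _).
rewrite !expr0 mul1mx mulmx1 => delta0.
(* In the eigenbases [delta] multiplies each entry by a difference of eigenvalues, so an entry
   killed by a power of [delta] is already killed by [delta]. *)
have delta_conj k : Q *m iter k delta C *m invmx P =
    \matrix_(i, j) ((d 0 j - d' 0 i) ^+ k * (Q *m C *m invmx P) i j).
  elim: k => [|k IH].
    by apply/matrixP => i j; rewrite [RHS]mxE expr0 mul1r.
  rewrite iterS /delta mulmxBr mulmxBl.
  rewrite -!mulmxA dS !mulmxA dS' -!mulmxA !(mulmxA Q) (mulmxA (Q *m _)).
  rewrite IH mul_mx_diag mul_diag_mx; apply/matrixP => i j; rewrite !mxE exprS.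
  ring.
have QCP i j : (d 0 j - d' 0 i) * (Q *m C *m invmx P) i j = 0.
  have := delta_conj m.*2; rewrite delta0 mulmx0 mul0mx => /matrixP/(_ i j).
  rewrite !mxE => /esym/eqP; rewrite !mulf_eq0 expf_eq0 => /orP[/andP[_]|] /eqP->.
    by rewrite mul0r.
  by rewrite mulr0.
suff delta1 : Q *m delta C *m invmx P = 0.
  apply/eqP; rewrite -subr_eq0 -/(delta C); apply/eqP.
  have := congr1 (fun M => invmx Q *m M *m P) delta1.
  by rewrite !mulmxA mulVmx // mul1mx mulmxKV // mulmx0 mul0mx.
rewrite (delta_conj 1%N); apply/matrixP => i j; by rewrite [LHS]mxE expr1 QCP mxE.
Qed.

End Intertwining.

Import VectorInternalTheory.
Import passmx.

Section Coordinates.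
Variables (R : nzRingType) (V : vectType R).
Lemma v2rD (x y : V) : v2r (x + y) = v2r x + v2r y. Proof. exact: linearD. Qed.
Lemma v2rN (x : V) : v2r (- x) = - v2r x. Proof. exact: linearN. Qed.
Lemma v2rZ c (x : V) : v2r (c *: x) = c *: v2r x. Proof. exact: linearZ. Qed.
Lemma v2r0 : v2r (0 : V) = 0. Proof. exact: linear0. Qed.
End Coordinates.

(* [ring] and [field] do not apply to vectors, only to their coordinates. *)
Ltac vcoord := apply: v2r_inj; apply/rowP => ?; rewrite ?(v2rD, v2rN, v2rZ, v2r0) ?mxE.
Ltac vring := vcoord; ring.
Ltac vfield := vcoord; field; do ?[apply/andP; split]; rewrite ?pnatr_eq0 //.

Section LfunRules.
Variables (R : nzRingType) (V W : vectType R) (f : 'Hom(V, W)).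
Lemma lfunD x y : f (x + y) = f x + f y. Proof. exact: linearD. Qed.
Lemma lfunN x : f (- x) = - f x. Proof. exact: linearN. Qed.
Lemma lfunZ c x : f (c *: x) = c *: f x. Proof. exact: linearZ. Qed.
Lemma lfun0 : f 0 = 0. Proof. exact: linear0. Qed.
Lemma lfun_sum (I : Type) (r : seq I) (P : pred I) (F : I -> V) :
  f (\sum_(i <- r | P i) F i) = \sum_(i <- r | P i) f (F i).
Proof. exact: linear_sum. Qed.
End LfunRules.

(** * Polynomials in an endomorphism *)

Section Generated.
Variables (R : fieldType) (V : vectType R).
Implicit Types (S T f : 'End(V)) (U : {vspace V}).

(** The polynomials in [S]. As an inductive predicate they allow commutation, invariance and
    adjointness to be proved by induction on their construction. *)
Inductive generated S : 'End(V) -> Prop :=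
| gen_id : generated S \1%VF
| gen_comp T : generated S T -> generated S (S \o T)%VF
| gen_add T T' : generated S T -> generated S T' -> generated S (T + T')
| gen_scale c T : generated S T -> generated S (c *: T).

Lemma gen_self S : generated S S.
Proof. by rewrite -[X in generated _ X]comp_lfun1r; apply/gen_comp/gen_id. Qed.

Lemma generated_comp S T T' :
  generated S T -> generated S T' -> generated S (T \o T')%VF.
Proof.
move=> gT gT'; elim: gT => [|T1 _ IH|T1 T2 _ IH1 _ IH2|c T1 _ IH].
- by rewrite comp_lfun1l.
- by rewrite -comp_lfunA; apply: gen_comp.
- by rewrite comp_lfunDl; apply: gen_add.
by rewrite -comp_lfunZl; apply: gen_scale.
Qed.

Lemma generated_trans S S' T : generated S S' -> generated S' T -> generated S T.
Proof.
move=> gS'; elim=> [|T1 _ IH|T1 T2 _ IH1 _ IH2|c T1 _ IH].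
- exact: gen_id.
- exact: generated_comp.
- exact: gen_add.
exact: gen_scale.
Qed.

Lemma generated_commute S T f :
  (forall x, f (S x) = S (f x)) -> generated S T ->
  forall x, f (T x) = T (f x).
Proof.
move=> fS; elim=> [|T1 _ IH|T1 T2 _ IH1 _ IH2|c T1 _ IH] x.
- by rewrite !id_lfunE.
- by rewrite !comp_lfunE fS IH.
- by rewrite !add_lfunE linearD /= IH1 IH2.
by rewrite !scale_lfunE linearZ /= IH.
Qed.

Lemma generated_commute2 S T T' : generated S T -> generated S T' ->
  forall x, T (T' x) = T' (T x).
Proof.
move=> gT gT'; apply: (generated_commute _ gT') => x.
by rewrite (generated_commute _ gT).
Qed.

Lemma generated_stable S T U :
  (forall x, x \in U -> S x \in U) -> generated S T ->
  forall x, x \in U -> T x \in U.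
Proof.
move=> SU; elim=> [|T1 _ IH|T1 T2 _ IH1 _ IH2|c T1 _ IH] x xU.
- by rewrite id_lfunE.
- by rewrite comp_lfunE SU // IH.
- by rewrite add_lfunE rpredD ?IH1 ?IH2.
by rewrite scale_lfunE rpredZ // IH.
Qed.

End Generated.

Section DotRules.
Variables (R : realType) (V : vectType R) (dot : {dot V for @idfun R}).

Lemma dotDl x y z : dot (x + y) z = dot x z + dot y z.
Proof. exact: linearDl. Qed.
Lemma dotDr x y z : dot x (y + z) = dot x y + dot x z.
Proof. exact: linearDr. Qed.
Lemma dotNl x y : dot (- x) y = - dot x y. Proof. exact: linearNl. Qed.
Lemma dotNr x y : dot x (- y) = - dot x y. Proof. exact: linearNr. Qed.
Lemma dotZl c x y : dot (c *: x) y = c * dot x y. Proof. exact: linearZl_LR. Qed.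
Lemma dotZr c x y : dot x (c *: y) = c * dot x y. Proof. exact: linearZr_LR. Qed.
Lemma dot0l x : dot 0 x = 0. Proof. exact: linear0l. Qed.
Lemma dot0r x : dot x 0 = 0. Proof. exact: linear0r. Qed.
Lemma dot_suml (I : Type) (r : seq I) (P : pred I) (F : I -> V) x :
  dot (\sum_(i <- r | P i) F i) x = \sum_(i <- r | P i) dot (F i) x.
Proof. by rewrite dotC linear_sumr; apply: eq_bigr => i _; rewrite dotC. Qed.
Lemma dot_sumr (I : Type) (r : seq I) (P : pred I) (F : I -> V) x :
  dot x (\sum_(i <- r | P i) F i) = \sum_(i <- r | P i) dot x (F i).
Proof. exact: linear_sumr. Qed.

Lemma dot_eq0 x : dot x x = 0 -> x = 0.
Proof.
by move=> xx; apply/eqP; apply: contraT => /(@neq0_dnorm_gt0 _ _ _ dot); rewrite xx ltxx.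
Qed.

Lemma dot_nondegenerate x : (forall y, dot y x = 0) -> x = 0.
Proof. by move=> h; apply: dot_eq0. Qed.

End DotRules.

Lemma generated_selfadjoint (R : realType) (V : vectType R)
    (dot : {dot V for @idfun R}) (S T f : 'End(V)) :
  (forall x y, dot (S x) (f y) = dot x (f (S y))) -> generated S T ->
  forall x y, dot (T x) (f y) = dot x (f (T y)).
Proof.
move=> BS; elim=> [|T1 gT IH|T1 T2 _ IH1 _ IH2|c T1 _ IH] x y.
- by rewrite !id_lfunE.
- by rewrite !comp_lfunE BS IH (generated_commute2 (gen_self S) gT).
- by rewrite !add_lfunE linearDl linearD /= linearDr IH1 IH2.
by rewrite !scale_lfunE linearZ /= dotZl dotZr IH.
Qed.

(** The hypotheses say that [x + i y] is an eigenvector for [a + i b]. *)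
Lemma eigenvalue_square (R : fieldType) (V : vectType R) (S : 'End(V)) a b x y :
  S x = a *: x - b *: y -> S y = b *: x + a *: y ->
  S (S x) = (2 * a) *: S x - (a ^+ 2 + b ^+ 2) *: x.
Proof.
by move=> Sx Sy; rewrite Sx linearB !linearZ /= Sx Sy; vring.
Qed.

(** * Relations inherited by the semisimple part *)

Section ComplexMatrix.
Variables (R : realType) (V : vectType R).
Implicit Types (L S N T f : 'End(V)).
Local Notation e := (vbasis {:V}).
Let e_basis : basis_of {:V} e := vbasisP {:V}.
Local Notation toC := (map_mx (real_complex R)).
Local Notation mx f := (mxof e e f).

Lemma mxof_nilpotent N n : (forall x, iter n N x = 0) -> mx N ^+ n = 0.
Proof.
move=> Nn; apply/row_matrixP => i; rewrite row0 rowE.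
suff H k u : rVof e (iter k N (vecof e u)) = u *m mx N ^+ k.
  by rewrite -H Nn linear0.
elim: k => [|k IH]; first by rewrite expr0 mulmx1 /= vecofK.
by rewrite iterS (rVof_app _ e_basis) IH exprSr mulmxA.
Qed.

Lemma map_mx_exp (A : 'M[R]_(\dim {:V})) k : toC (A ^+ k) = toC A ^+ k.
Proof.
elim: k => [|k IH]; first by rewrite !expr0 map_mx1.
by rewrite !exprS -IH; exact: map_mxM.
Qed.

Lemma basis_mxof f (i : 'I_(\dim {:V})) : f e`_i = \sum_j mx f i j *: e`_j.
Proof.
rewrite -(vecof_delta e i) (hom_vecof _ e_basis) -rowE /vecof.
by apply: eq_bigr => j _; rewrite mxE.
Qed.

Lemma diagonalizable_scale (F : fieldType) n c (A : 'M[F]_n) :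
  diagonalizable A -> diagonalizable (c *: A).
Proof.
move=> [P Pu /diagonalizable_forPex[d /(simmxP Pu) PA]]; exists P => //.
apply/diagonalizable_forPex; exists (c *: d); apply/(simmxP Pu).
by rewrite -scalemxAr PA linearZ /= -scalemxAl.
Qed.

Lemma diagonalizable_trmx (F : fieldType) n (A : 'M[F]_n) :
  diagonalizable A -> diagonalizable A^T.
Proof.
move=> [P Pu /diagonalizable_forPex[d /(simmxP Pu) PA]].
have Pu' : (invmx P)^T \in unitmx by rewrite unitmx_tr unitmx_inv.
exists (invmx P)^T => //; apply/diagonalizable_forPex; exists d.
apply/(simmxP Pu'); rewrite -[diag_mx d]tr_diag_mx -!trmx_mul; congr trmx.
by apply: (can_inj (mulKmx Pu)); rewrite !mulmxA PA mulmxK // mulmxV // mul1mx.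
Qed.

Lemma mx_expZ (F : fieldType) n c (A : 'M[F]_n) k :
  (c *: A) ^+ k = c ^+ k *: A ^+ k.
Proof.
elim: k => [|k IH]; first by rewrite !expr0 scale1r.
rewrite !exprS IH -[LHS]/(c *: A *m (c ^+ k *: A ^+ k)).
by rewrite -scalemxAl -scalemxAr scalerA.
Qed.

(** [c S + c N] is again a sum of commuting diagonalizable and nilpotent parts, and [f] intertwines
    it with [S + N]. The scalars are extended because [S] is diagonalizable only over the complex
    numbers; the conclusion descends since real matrices embed injectively. *)
Lemma jordan_semicommute L S N f c : jordan_chevalley L S N ->
  (forall x, L (f x) = c *: f (L x)) -> forall x, S (f x) = c *: f (S x).
Proof.
move=> [-> dS [m Nm] SN] Lf x.
have mSN : mx S *m mx N = mx N *m mx S.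
  by rewrite -!(mxof_comp _ _ e_basis) SN.
have mNm := mxof_nilpotent Nm.
have mLf : mx f *m (mx S + mx N) = c *: (mx S + mx N) *m mx f.
  rewrite -linearD -scalemxAl -!(mxof_comp _ _ e_basis) -linearZ; congr mxof.
  by apply/lfunP => y; rewrite scale_lfunE !comp_lfunE.
have cNm : toC (mx N) ^+ m = 0.
  by rewrite -map_mx_exp mNm map_mx0.
have cSN : toC (mx S) *m toC (mx N) = toC (mx N) *m toC (mx S).
  by rewrite -!map_mxM mSN.
have : toC (mx f) *m toC (mx S) = (c%:C%C *: toC (mx S)) *m toC (mx f).
  apply: (jordan_intertwine (m := m) dS (diagonalizable_scale _ dS) cNm
    (N' := c%:C%C *: toC (mx N))).
  - by rewrite mx_expZ cNm scaler0.
  - exact: cSN.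
  - by rewrite -!scalemxAl -!scalemxAr cSN.
  by rewrite -scalerDr -!map_mxD -map_mxZ -!map_mxM mLf.
rewrite -map_mxZ -!map_mxM => hC; have {hC} := map_mx_inj hC.
rewrite -scalemxAl -!(mxof_comp _ _ e_basis) -linearZ => hmx.
have /lfunP/(_ x) := can_inj (mxofK e_basis e_basis) hmx; rewrite scale_lfunE !comp_lfunE; apply.
Qed.

(** With [W] the Gram matrix of [dot x (f y)], adjointness reads [A W = c W A^T] for the matrix [A]
    of [L], and likewise for [S]. Transposition keeps matrices diagonalizable or nilpotent, so [W]
    is an intertwiner. *)
Lemma jordan_semiadjoint (dot : {dot V for @idfun R}) L S N f c :
  jordan_chevalley L S N ->
  (forall x y, dot (L x) (f y) = c * dot x (f (L y))) ->
  forall x y, dot (S x) (f y) = c * dot x (f (S y)).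
Proof.
move=> [-> dS [m Nm] SN] Lf.
pose W : 'M[R]_(\dim {:V}) := \matrix_(i, j) dot e`_i (f e`_j).
have mulW g : mx g *m W = \matrix_(i, j) dot (g e`_i) (f e`_j).
  apply/matrixP => i j; rewrite [LHS]mxE [RHS]mxE (basis_mxof g) dot_suml.
  by apply: eq_bigr => k _; rewrite dotZl [W _ _]mxE.
have Wmul g : W *m (mx g)^T = \matrix_(i, j) dot e`_i (f (g e`_j)).
  apply/matrixP => i j; rewrite [LHS]mxE [RHS]mxE (basis_mxof g) linear_sum dot_sumr.
  by apply: eq_bigr => k _; rewrite linearZ /= dotZr [W _ _]mxE [_^T _ _]mxE mulrC.
have mSN : mx S *m mx N = mx N *m mx S.
  by rewrite -!(mxof_comp _ _ e_basis) SN.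
have mNm := mxof_nilpotent Nm.
have trexp k : (mx N)^T ^+ k = (mx N ^+ k)^T.
  elim: k => [|k IH]; first by rewrite !expr0 trmx1.
  by rewrite exprSr exprS IH; rewrite -[RHS]/((mx N *m mx N ^+ k)^T) trmx_mul.
have cSN : toC (mx S) *m toC (mx N) = toC (mx N) *m toC (mx S).
  by rewrite -!map_mxM mSN.
have hW : W *m (c *: (mx S)^T) = mx S *m W.
  apply: (@map_mx_inj _ _ (real_complex R)); rewrite !map_mxM map_mxZ /=.
  apply: (jordan_intertwine (m := m) (N := c%:C%C *: toC (mx N)^T) (N' := toC (mx N))).
  - by apply: diagonalizable_scale; rewrite -map_trmx; apply: diagonalizable_trmx.
  - exact: dS.
  - by rewrite mx_expZ -map_mx_exp trexp mNm trmx0 map_mx0 scaler0.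
  - by rewrite -map_mx_exp mNm map_mx0.
  - by rewrite -!scalemxAl -!scalemxAr -!map_trmx -!trmx_mul cSN.
  - exact: cSN.
  rewrite -!map_mxZ -!map_mxD -!map_mxM; congr map_mx.
  rewrite -scalerDr -!linearD /= -scalemxAr Wmul mulW.
  by apply/matrixP => i j; rewrite !mxE Lf.
move: hW; rewrite -scalemxAr Wmul mulW => hW x y.
rewrite (coord_vbasis (memvf x)) (coord_vbasis (memvf y)).
rewrite !(lfun_sum S) !(lfun_sum f) !dot_suml mulr_sumr.
apply: eq_bigr => i _; rewrite !dot_sumr mulr_sumr; apply: eq_bigr => j _.
rewrite !lfunZ !dotZl !dotZr; move/matrixP/(_ i j): hW; rewrite !mxE => <-.
ring.
Qed.

End ComplexMatrix.

Section Spectrum.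
Variables (R : realType) (V : vectType R).
Implicit Types (S T f : 'End(V)) (U : {vspace V}).
Local Notation e := (vbasis {:V}).
Local Notation toC := (map_mx (real_complex R)).
Local Notation mx f := (mxof e e f).
Let e_basis : basis_of {:V} e := vbasisP {:V}.

(** In an eigenbasis of [S] every polynomial in [S] is diagonal, and a coordinate killed by the
    square of a diagonal entry is killed by the entry. *)
Lemma semisimple_kernel S T x :
  semisimple S -> generated S T -> T (T x) = 0 -> T x = 0.
Proof.
move=> [P Pu /diagonalizable_forPex[d /(simmxP Pu) PS]] gT TT.
have [dT PT] : exists dT, P *m toC (mx T) = diag_mx dT *m P.
  elim: gT => [|T1 _ [d1 P1]|T1 T2 _ [d1 P1] _ [d2 P2]|c T1 _ [d1 P1]].
  - exists (const_mx 1); rewrite mxof1 ?(basis_free e_basis) // map_mx1.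
    by rewrite mulmx1 diag_const_mx mul1mx.
  - exists (\row_j (d1 0 j * d 0 j)).
    rewrite (mxof_comp _ _ e_basis) map_mxM mulmxA P1 -mulmxA PS mulmxA.
    by rewrite mulmx_diag.
  - by exists (d1 + d2); rewrite linearD map_mxD mulmxDr P1 P2 linearD mulmxDl.
  exists (c%:C%C *: d1); rewrite linearZ map_mxZ -scalemxAr P1.
  by rewrite linearZ /= -scalemxAl.
pose w := toC (rVof e x) *m invmx P.
have wE : toC (rVof e x) = w *m P by rewrite mulmxKV.
have TxE y : toC (rVof e (T y)) = toC (rVof e y) *m toC (mx T).
  by rewrite (rVof_app _ e_basis) map_mxM.
have Tw : toC (rVof e (T x)) = w *m diag_mx dT *m P.
  by rewrite TxE wE -mulmxA PT mulmxA.
have : w *m diag_mx dT *m diag_mx dT = 0.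
  apply: (can_inj (mulmxK Pu)); rewrite mul0mx -(mulmxA _ _ P) -PT mulmxA -Tw -TxE.
  by rewrite TT linear0 map_mx0.
rewrite !mul_mx_diag => w0.
have {w0} wd : w *m diag_mx dT = 0.
  rewrite mul_mx_diag; apply/matrixP => i j; rewrite !mxE.
  move/matrixP/(_ i j): w0; rewrite !mxE => /eqP.
  by rewrite mulf_eq0 => /orP[/eqP //|/eqP ->]; rewrite mulr0.
apply/eqP; rewrite -(rVof_eq0 e_basis) -(inj_eq (@map_mx_inj _ _ (real_complex R) _ _)).
by rewrite TxE wE -mulmxA PT mulmxA wd mul0mx map_mx0.
Qed.

Lemma semisimple_eigenvalue S (v : V) : semisimple S -> v != 0 ->
  exists a b (x : V), [/\ x != 0, S (S x) = (2 * a) *: S x - (a ^+ 2 + b ^+ 2) *: x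
                  & b = 0 -> S x = a *: x].
Proof.
move=> [P Pu /diagonalizable_forPex[d /(simmxP Pu) PS]] v0.
have dimV : (0 < \dim {:V})%N.
  rewrite lt0n dimv_eq0; apply: contraNneq v0 => V0.
  by rewrite -memv0 -V0 memvf.
pose i0 := Ordinal dimV.
pose p := row i0 P; pose l := d 0 i0.
have p0 : p != 0.
  apply: contraTneq Pu => pz; rewrite -row_free_unit; apply/negP => /row_freeP[Q PQ].
  have := congr1 (fun M => row i0 M 0 i0) PQ; rewrite row_mul -/p pz mul0mx !mxE eqxx.
  by move/eqP; rewrite eq_sym oner_eq0.
have pS : p *m toC (mx S) = l *: p.
  rewrite -row_mul PS; apply/rowP => j; rewrite !mxE (bigD1 i0) //= big1 => [|k ki].
    by rewrite !mxE eqxx addr0.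
  by rewrite !mxE eq_sym (negPf ki) mul0r.
pose X := vecof e (map_mx (@complex.Re R) p).
pose Y := vecof e (map_mx (@complex.Im R) p).
have sumRe (n : nat) (F : 'I_n -> R[i]) :
    complex.Re (\sum_k F k) = \sum_k complex.Re (F k).
  by apply: big_morph => // -[x1 x2] [y1 y2].
have sumIm (n : nat) (F : 'I_n -> R[i]) :
    complex.Im (\sum_k F k) = \sum_k complex.Im (F k).
  by apply: big_morph => // -[x1 x2] [y1 y2].
have hXY : S X = complex.Re l *: X - complex.Im l *: Y /\
           S Y = complex.Im l *: X + complex.Re l *: Y.
  have pSE j : \sum_k p 0 k * (mx S k j)%:C%C = l * p 0 j.
    move/rowP/(_ j): pS; rewrite [LHS]mxE [RHS]mxE => <-.
    by apply: eq_bigr => k _; rewrite [toC _ _ _]mxE.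
  rewrite !(hom_vecof _ e_basis) -!linearZ -linearB -linearD.
  split; congr vecof; apply/rowP => j; rewrite [LHS]mxE; move: (pSE j).
    move/(congr1 (@complex.Re R)); rewrite sumRe => h.
    transitivity (complex.Re (l * p 0 j)).
      rewrite -h; apply: eq_bigr => k _; rewrite [map_mx _ _ _ _]mxE.
      by case: (p 0 k) => u w /=; ring.
    by rewrite !mxE; case: (l) (P _ _) => u w [y z] /=; ring.
  move/(congr1 (@complex.Im R)); rewrite sumIm => h.
  transitivity (complex.Im (l * p 0 j)).
    rewrite -h; apply: eq_bigr => k _; rewrite [map_mx _ _ _ _]mxE.
    by case: (p 0 k) => u w /=; ring.
  by rewrite !mxE; case: (l) (P _ _) => u w [y z] /=; ring.
have [SX SY] := hXY; exists (complex.Re l), (complex.Im l).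
(* The real part of the eigenvector may vanish. The imaginary part is then nonzero and obeys the
   same equation, read for the conjugate eigenvalue. *)
have [X0|X0] := eqVneq X 0; last first.
  exists X; split=> // [|b0]; first exact: eigenvalue_square SX SY.
  by rewrite SX b0 scale0r subr0.
exists Y; split.
- apply: contraNneq p0 => Y0; apply/eqP/rowP => j; rewrite [RHS]mxE.
  have /eqP := X0; have /eqP := Y0; rewrite !(vecof_eq0 e_basis).
  move=> /eqP/rowP/(_ j) + /eqP/rowP/(_ j); rewrite !mxE.
  by case: (P _ _) => u w /= -> ->.
- have := @eigenvalue_square _ _ S (complex.Re l) (- complex.Im l) Y X.
  by rewrite sqrrN; apply; rewrite ?SX ?SY; vring.
by move=> b0; rewrite SY b0 scale0r add0r.
Qed.

End Spectrum.

(** * Eigenvalues on an indecomposable space *)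

(* The eigenvalues [a], [a +- i b], [+-a] and [+-a +- i b] of [S]. *)
Variant spectrum (R : realType) :=
  Sreal of R | Scomplex of R & R | Spair of R | Squad of R & R.

Definition spectrum_ok (R : realType) (mu : sign) (sp : spectrum R) : Prop :=
  match sp with
  | Sreal a => mu = Plus \/ a = 0
  | Scomplex a b => 0 < b /\ (mu = Plus \/ a = 0)
  | Spair a => 0 < a /\ mu = Minus
  | Squad a b => [/\ 0 < a, 0 < b & mu = Minus]
  end.

Definition has_spectrum (R : realType) (V : vectType R) (S : 'End(V))
    (sp : spectrum R) : Prop :=
  forall x, match sp with
  | Sreal a => S x = a *: x
  | Scomplex a b => S (S x) = (2 * a) *: S x - (a ^+ 2 + b ^+ 2) *: x
  | Spair a => S (S x) = a ^+ 2 *: x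
  | Squad a b => S (S (S (S x))) = (2 * (a ^+ 2 - b ^+ 2)) *: S (S x)
                                   - (a ^+ 2 + b ^+ 2) ^+ 2 *: x
  end.

Section Spectrum.
Variables (R : realType) (V : vectType R).
Implicit Types (S T f : 'End(V)) (U : {vspace V}).

Definition graded (mu : sign) S T : Prop :=
  [\/ mu = Plus /\ generated S T, generated (S \o S)%VF T
     | exists2 T', generated (S \o S)%VF T' & T = (S \o T')%VF].

Lemma generated_square S : generated S (S \o S)%VF.
Proof. by apply: generated_comp; apply: gen_self. Qed.

Lemma graded_generated mu S T : graded mu S T -> generated S T.
Proof.
case=> [[]//|gT|[T' gT' ->]]; last apply: gen_comp.
  exact: generated_trans (generated_square S) gT.
exact: generated_trans (generated_square S) gT'.
Qed.

Lemma graded_semicommute mu S T f :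
  (forall x, S (f x) = sg mu *: f (S x)) -> graded mu S T ->
  exists c : R, c * c = 1 /\ forall x, T (f x) = c *: f (T x).
Proof.
move=> Sf gT.
have even T' : generated (S \o S)%VF T' -> forall x, T' (f x) = f (T' x).
  move=> gT' x; apply/esym; apply: generated_commute gT' _ => y.
  rewrite !comp_lfunE Sf lfunZ Sf.
  by rewrite scalerA; case: (mu); rewrite /= ?mulrNN mulr1 scale1r.
case: gT => [[muP gT]|gT|[T' gT' ->]].
- exists 1; split; rewrite ?mulr1 // => x; rewrite scale1r.
  by apply/esym; apply: generated_commute gT _ => y; rewrite Sf muP scale1r.
- by exists 1; split; rewrite ?mulr1 // => x; rewrite scale1r even.
exists (sg mu); split=> [|x]; first by case: (mu); rewrite /= ?mulrNN ?mulr1.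
by rewrite !comp_lfunE even // Sf.
Qed.

Lemma graded_semiadjoint mu S T f (dot : {dot V for @idfun R}) :
  (forall x y, dot (S x) (f y) = sg mu * dot x (f (S y))) -> graded mu S T ->
  exists c : R, c * c = 1 /\ forall x y, dot (T x) (f y) = c * dot x (f (T y)).
Proof.
move=> Sf gT.
have even T' : generated (S \o S)%VF T' ->
    forall x y, dot (T' x) (f y) = dot x (f (T' y)).
  apply: generated_selfadjoint => x y; rewrite !comp_lfunE !Sf.
  by rewrite mulrA; case: (mu); rewrite /= ?mulrNN mulr1 mul1r.
case: gT => [[muP gT]|gT|[T' gT' ->]].
- exists 1; rewrite mulr1; split=> // x y; rewrite mul1r.
  by apply: generated_selfadjoint gT _ _ => {}x {}y; rewrite Sf muP mul1r.
- by exists 1; rewrite mulr1; split=> // x y; rewrite mul1r even.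
exists (sg mu); split=> [|x y]; first by case: (mu); rewrite /= ?mulrNN ?mulr1.
have gT := generated_trans (generated_square S) gT'.
by rewrite !comp_lfunE Sf even // (generated_commute2 (gen_self S) gT).
Qed.

(* The hypothesis expresses indecomposability: [V] is the direct sum of the
   kernel and the image of [T]. *)
Lemma spectrum_exists mu S : semisimple S -> (exists v : V, v != 0) ->
  (forall T, graded mu S T -> (forall x, T (T x) = 0 -> T x = 0) ->
     (exists2 x, x != 0 & T x = 0) -> forall x, T x = 0) ->
  exists sp, spectrum_ok mu sp /\ has_spectrum S sp.
Proof.
move=> ssS [v v0] dec.
have [a [b [x [x0 Sx b0]]]] := semisimple_eigenvalue ssS v0.
have {}dec T : graded mu S T -> T x = 0 -> forall y, T y = 0.
  move=> gT Tx; apply: dec => // [y|]; last by exists x.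
  exact/semisimple_kernel/(graded_generated gT).
have lfE := (add_lfunE, scale_lfunE, id_lfunE, comp_lfunE).
have gself := gen_self.
have gpoly T c d : generated T (T + c *: \1%VF) /\ generated T (d *: T).
  split; last exact/gen_scale/gself.
  by apply: gen_add; [apply: gself|apply/gen_scale/gen_id].
have [b_eq0|b_neq0] := eqVneq b 0.
  have {Sx b0} Sx := b0 b_eq0.
  have [muP|muM] : mu = Plus \/ mu = Minus by case: (mu); [left|right].
    exists (Sreal a); split=> [|y] /=; first by left.
    have -> : S y = (S + (- a) *: \1%VF) y + a *: y by rewrite !lfE; vring.
    rewrite dec ?add0r //; first by apply: Or31; split=> //; apply: (gpoly S _ 0).1.
    by rewrite !lfE Sx; vring.
  have [a_eq0|a_neq0] := eqVneq a 0.
    exists (Sreal 0); split=> [|y] /=; first by right.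
    rewrite scale0r; apply: dec; last by rewrite Sx a_eq0 scale0r.
    by apply: Or33; exists \1%VF; rewrite ?comp_lfun1r //; apply: gen_id.
  exists (Spair `|a|); split=> [|y] /=; first by rewrite normr_gt0.
  rewrite real_normK ?num_real //.
  have -> : S (S y) = ((S \o S)%VF + (- a ^+ 2) *: \1%VF) y + a ^+ 2 *: y.
    by rewrite !lfE; vring.
  rewrite dec ?add0r //; first by apply: Or32; apply: (gpoly _ _ 0).1.
  by rewrite !lfE Sx lfunZ Sx; vring.
have bpos : 0 < `|b| by rewrite normr_gt0.
have [hmu|[muM a_neq0]] : (mu = Plus \/ a = 0) \/ (mu = Minus /\ a != 0).
- case: (mu); first by left; left.
  by have [->|] := eqVneq a 0; [left; right|right].
- exists (Scomplex a `|b|); split=> // y /=.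
  rewrite real_normK ?num_real //.
  pose T := ((S \o S)%VF + (- (2 * a)) *: S + (a ^+ 2 + b ^+ 2) *: \1%VF).
  have -> : S (S y) = T y + ((2 * a) *: S y - (a ^+ 2 + b ^+ 2) *: y).
    by rewrite !lfE; vring.
  rewrite dec ?add0r //; last by rewrite !lfE Sx; vring.
  case: hmu => [muP|a_eq0]; last first.
    by apply: Or32; rewrite /T a_eq0 mulr0 oppr0 scale0r addr0; apply: (gpoly _ _ 0).1.
  apply: Or31; split=> //; apply: gen_add; last by apply/gen_scale/gen_id.
  by apply: gen_add; [apply: generated_square|apply: (gpoly S 0 _).2].
exists (Squad `|a| `|b|); split=> [|y] /=; first by rewrite normr_gt0.
rewrite !real_normK ?num_real //.
(* The even polynomial with the roots [+-a +- i b]. The quadratic polynomial with the roots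
   [a +- i b] alone is neither even nor odd, as [a] is nonzero. *)
pose T := (((S \o S) \o (S \o S))%VF + (- (2 * (a ^+ 2 - b ^+ 2))) *: (S \o S)%VF
  + (a ^+ 2 + b ^+ 2) ^+ 2 *: \1%VF).
have -> : S (S (S (S y))) = T y + ((2 * (a ^+ 2 - b ^+ 2)) *: S (S y)
                                   - (a ^+ 2 + b ^+ 2) ^+ 2 *: y).
  by rewrite !lfE; vring.
rewrite dec ?add0r //; last first.
  by rewrite !lfE; do 3![rewrite ?Sx ?lfunD ?lfunN ?lfunZ]; vring.
apply: Or32; apply: gen_add; last by apply/gen_scale/gen_id.
apply: gen_add; last exact: (gpoly _ 0 _).2.
exact: generated_square.
Qed.

Let lfE := (add_lfunE, scale_lfunE, id_lfunE, comp_lfunE).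
Let lfL := (@lfunD R V V, @lfunN R V V, @lfunZ R V V).

Lemma complex_unit S a b : 0 < b -> has_spectrum S (Scomplex a b) ->
  exists J : 'End(V), [/\ J = b^-1 *: (S + (- a) *: \1%VF), forall x, J (J x) = - x
                       & forall x, S x = a *: x + b *: J x].
Proof.
move=> b0 hS; have bn : b != 0 by rewrite gt_eqF.
exists (b^-1 *: (S + (- a) *: \1%VF)); split=> // x.
  by rewrite !lfE !lfL hS; vfield.
by rewrite !lfE; vfield.
Qed.

Lemma pair_unit S a : 0 < a -> has_spectrum S (Spair a) ->
  exists E : 'End(V), [/\ E = a^-1 *: S, forall x, E (E x) = x
                       & forall x, S x = a *: E x].
Proof.
move=> a0 hS; have an : a != 0 by rewrite gt_eqF.
exists (a^-1 *: S); split=> // x; rewrite !lfE ?lfL ?hS; vfield.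
Qed.

(* Over the complex numbers, [J] is [i] on the eigenspaces of [+-(a + i b)] and
   [- i] on those of [+-(a - i b)], and [E] is the sign of the real part. *)
Lemma quad_units S a b : 0 < a -> 0 < b -> has_spectrum S (Squad a b) ->
  exists E J F : 'End(V),
    [/\ generated (S \o S)%VF J, generated (S \o S)%VF F /\ E = (S \o F)%VF,
        forall x, J (J x) = - x,
        (forall x, E (E x) = x) /\ (forall x, E (J x) = J (E x))
      & forall x, S x = E (a *: x + b *: J x)].
Proof.
move=> a0 b0 hS.
have an : a != 0 by rewrite gt_eqF.
have bn : b != 0 by rewrite gt_eqF.
have rn : a ^+ 2 + b ^+ 2 != 0 by rewrite gt_eqF // addr_gt0 ?exprn_gt0.
(* The square of [+-(a + i b)] is [a ^ 2 - b ^ 2 + 2 i a b], which isolates [J] as an even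
   polynomial. [F] is the inverse of [a + b J], so [S \o F] is an involution. *)
pose J := (2 * a * b)^-1 *: ((S \o S)%VF + (- (a ^+ 2 - b ^+ 2)) *: \1%VF).
pose F := (a ^+ 2 + b ^+ 2)^-1 *: (a *: \1%VF + (- b) *: J).
have gJ : generated (S \o S)%VF J.
  by apply/gen_scale/gen_add; [apply: gen_self|apply/gen_scale/gen_id].
have gF : generated (S \o S)%VF F.
  by apply/gen_scale/gen_add; apply/gen_scale; [apply: gen_id|apply: gJ].
have JJ x : J (J x) = - x by rewrite /J !lfE !lfL hS; vfield.
have SS x : S (S x) = (a ^+ 2 - b ^+ 2) *: x + (2 * a * b) *: J x.
  by rewrite /J !lfE; vfield.
have SJ x : S (J x) = J (S x) by rewrite /J !lfE !lfL.
have FE x : F x = (a ^+ 2 + b ^+ 2)^-1 *: (a *: x - b *: J x).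
  by rewrite /F !lfE scaleNr.
exists (S \o F)%VF, J, F; split=> //.
- move: (J) JJ SS SJ FE {gJ} => K KK SS SK FE; split=> x.
    rewrite !comp_lfunE; move: (mulVf rn) FE; move: (_^-1) (F) => r G r1 FE.
    transitivity ((r * (a ^+ 2 + b ^+ 2)) ^+ 2 *: x); last by rewrite r1 expr1n scale1r.
    by rewrite !FE !lfL !SK !SS !lfL !KK ?lfL; vring.
  by rewrite !comp_lfunE !FE !lfL !SK ?lfL.
move: (J) JJ SS SJ FE {gJ} => K KK SS SK FE x.
by rewrite comp_lfunE FE !lfL !KK ?lfL !SK; vfield.
Qed.

(* [S = E (a + b J)] with commuting [E] and [J]; where [b] vanishes, [J] is
   the identity. *)
Lemma spectrum_factors mu S sp : spectrum_ok mu sp -> has_spectrum S sp ->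
  exists E J (a b c : R),
    [/\ graded mu S E, graded mu S J, c * c = 1,
        forall x, E (E x) = x /\ J (J x) = c *: x
      & forall x, S x = E (a *: x + b *: J x)].
Proof.
have gid : graded mu S \1%VF by apply/Or32/gen_id.
case: sp => [a|a b|a|a b] ok hS.
- exists \1%VF, \1%VF, a, 0, 1; split; rewrite ?mulr1 // => x.
    by rewrite !lfE scale1r.
  by rewrite lfE hS scale0r addr0.
- case: ok => b0 hmu; have [J [JE JJ SE]] := complex_unit b0 hS.
  exists \1%VF, J, a, b, (-1); split; rewrite ?mulrNN ?mulr1 //.
  + rewrite JE; case: hmu => [muP|a0].
      apply: Or31; split=> //; apply/gen_scale/gen_add; first exact: gen_self.
      exact/gen_scale/gen_id.
    apply: Or33; exists (b^-1 *: \1%VF); first exact/gen_scale/gen_id.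
    by rewrite a0 oppr0 scale0r addr0 -comp_lfunZr comp_lfun1r.
  + by move=> x; rewrite !id_lfunE JJ scaleN1r.
  by move=> x; rewrite id_lfunE.
- case: ok => a0 _; have [E [EE E2 SE]] := pair_unit a0 hS.
  exists E, \1%VF, a, 0, 1; split; rewrite ?mulr1 //.
  + rewrite EE; apply: Or33; exists (a^-1 *: \1%VF); first exact/gen_scale/gen_id.
    by rewrite -comp_lfunZr comp_lfun1r.
  + by move=> x; rewrite !id_lfunE scale1r.
  by move=> x; rewrite scale0r addr0 lfunZ.
case: ok => a0 b0 _; have [E [J [F [gJ [gF ->] JJ [EE _] SE]]]] := quad_units a0 b0 hS.
exists (S \o F)%VF, J, a, b, (-1); split; rewrite ?mulrNN ?mulr1 //.
- by apply: Or33; exists F.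
- exact: Or32.
by move=> x; rewrite JJ scaleN1r.
Qed.

End Spectrum.

(** * Invariant complements *)

Notation invariant f U := (forall x, x \in U -> f x \in U).

Section Complements.
Variables (R : realType) (V : vectType R).
Implicit Types (S T P f g s : 'End(V)) (U C : {vspace V}).

Lemma stable1P f U : reflect (invariant f U) (stable [:: f] U).
Proof.
rewrite /stable /= andbT; apply: (iffP subvP) => [h x xU|h _ /memv_imgP[x xU ->]].
  exact/h/memv_img.
exact: h.
Qed.

Lemma stable2P f g U : reflect (invariant f U /\ invariant g U) (stable [:: f; g] U).
Proof.
have -> : stable [:: f; g] U = stable [:: f] U && stable [:: g] U.
  by rewrite /stable /= !andbT.
by apply: (iffP andP) => -[/stable1P fU /stable1P gU]; split.
Qed.

Definition projects_on P U := (forall x, P x \in U) /\ {in U, forall x, P x = x}.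

(* Averaging over the group generated by [g] modulo scalars. *)
Lemma average_projection P g c U : c * c = 1 -> (forall x, g (g x) = c *: x) ->
  invariant g U -> projects_on P U ->
  exists P' : 'End(V), [/\ projects_on P' U, forall x, P' (g x) = g (P' x)
    & forall (h : 'End(V)) d, d * d = 1 -> (forall x, h (g x) = d *: g (h x)) ->
        (forall x, P (h x) = h (P x)) -> forall x, P' (h x) = h (P' x) :> V].
Proof.
move=> cc gg gU [PU Pid].
(* As [g \o g] is the scalar [c = +-1], the inverse of [g] is [c *: g]. *)
pose P' := 2^-1 *: (P + c *: (g \o (P \o g))%VF).
have P'E x : P' x = 2^-1 *: (P x + c *: g (P (g x))).
  by rewrite scale_lfunE add_lfunE scale_lfunE !comp_lfunE.
exists P'; split; first split=> [x|x xU].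
- by rewrite P'E rpredZ // rpredD ?rpredZ ?gU.
- rewrite P'E Pid // Pid ?gU // gg scalerA cc scale1r -[in x + x](scale1r x).
  by rewrite -scalerDl scalerA mulVf ?scale1r // pnatr_eq0.
- move=> x; rewrite !P'E !gg !(lfunZ, lfunD) !gg ?lfunZ !scalerA cc !scale1r.
  by rewrite addrC.
move=> h d dd hg Ph x.
rewrite !P'E (lfunZ h) (lfunD h) (lfunZ h) Ph hg -(Ph (g x)) hg !lfunZ !scalerA.
by rewrite -mulrA dd mulr1.
Qed.

(** An arbitrary projection is averaged over [J], [E] and [s] in turn. These maps commute with each
    other up to sign, so a later average keeps the commutation gained earlier, and commuting with
    [E] and [J] gives commuting with [S]. *)
Lemma graded_projection mu S sp s c U : spectrum_ok mu sp -> has_spectrum S sp ->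
  c * c = 1 -> (forall x, s (s x) = c *: x) ->
  (forall T, graded mu S T ->
     exists d, d * d = 1 /\ forall x, T (s x) = d *: s (T x)) ->
  invariant S U -> invariant s U ->
  exists P : 'End(V), [/\ projects_on P U, forall x, P (S x) = S (P x)
                        & forall x, P (s x) = s (P x)].
Proof.
move=> ok hS cc ss Ss SU sU.
have [E [J [a [b [cJ [gE gJ cJ1 EJ SE]]]]]] := spectrum_factors ok hS.
have JU := generated_stable SU (graded_generated gJ).
have EU := generated_stable SU (graded_generated gE).
have EJC := generated_commute2 (graded_generated gE) (graded_generated gJ).
have [dJ [dJ1 Js]] := Ss J gJ.
have [dE [dE1 Es]] := Ss E gE.
have P0 : projects_on (projv U) U.
  by split=> [x|x xU]; [apply: memv_proj|apply: projv_id].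
have [P1 [P1U P1J _]] := average_projection cJ1 (fun x => (EJ x).2) JU P0.
have EE x : E (E x) = 1 *: x by rewrite (EJ x).1 scale1r.
have [P2 [P2U P2E P2h]] := average_projection (mulr1 1) EE EU P1U.
have P2J : forall x, P2 (J x) = J (P2 x).
  by apply: (P2h _ 1) => // [|x]; rewrite ?mulr1 // scale1r EJC.
have [P3 [P3U P3s P3h]] := average_projection cc ss sU P2U.
have P3J := P3h J dJ dJ1 Js P2J; have P3E := P3h E dE dE1 Es P2E.
exists P3; split=> // x.
by rewrite !SE P3E; congr (E _); rewrite lfunD !lfunZ P3J.
Qed.

Lemma graded_complement mu S sp s c U : spectrum_ok mu sp -> has_spectrum S sp ->
  c * c = 1 -> (forall x, s (s x) = c *: x) ->
  (forall T, graded mu S T ->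
     exists d, d * d = 1 /\ forall x, T (s x) = d *: s (T x)) ->
  invariant S U -> invariant s U ->
  exists C, [/\ (U :&: C)%VS = 0%VS, (U + C)%VS = fullv,
                invariant S C & invariant s C].
Proof.
move=> ok hS cc ss Ss SU sU.
have [P [[PU Pid] PS Ps]] := graded_projection ok hS cc ss Ss SU sU.
exists (lker P); split.
- apply/eqP; rewrite -subv0; apply/subvP => x /memv_capP[xU].
  by rewrite memv_ker Pid // memv0.
- apply/eqP; rewrite eqEsubv subvf /=; apply/subvP => x _.
  rewrite -(subrKC (P x) x); apply: memv_add => //.
  by rewrite memv_ker linearB /= [P (P x)]Pid ?subrr.
- by move=> x; rewrite !memv_ker PS => /eqP ->; rewrite lfun0.
by move=> x; rewrite !memv_ker Ps => /eqP ->; rewrite lfun0.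
Qed.

Lemma invariant_complement mu S sp U : spectrum_ok mu sp -> has_spectrum S sp ->
  invariant S U ->
  exists C, [/\ (U :&: C)%VS = 0%VS, (U + C)%VS = fullv & invariant S C].
Proof.
move=> ok hS SU.
have id2 x : \1%VF (\1%VF x) = 1 *: x :> V by rewrite !id_lfunE scale1r.
have id_comm T : graded mu S T ->
    exists d : R, d * d = 1 /\ forall x, T (\1%VF x) = d *: \1%VF (T x) :> V.
  by exists 1; rewrite mulr1; split=> // x; rewrite !id_lfunE scale1r.
have idU : invariant \1%VF U by move=> x; rewrite id_lfunE.
have [C [UC UCf SC _]] := graded_complement ok hS (mulr1 1) id2 id_comm SU idU.
by exists C.
Qed.

Section Perp.
Variable dot : {dot V for @idfun R}.

(** [K] is cut out by [\dim U] linear equations, one for each basis vector of [U]. *)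
Lemma perp_exists f U : exists K : {vspace V},
  (forall v, v \in K <-> forall u, u \in U -> dot u (f v) = 0) /\
  (\dim {:V} <= \dim K + \dim U)%N.
Proof.
pose h (v : V) : 'rV[R]_(\dim U) := \row_i dot (vbasis U)`_i (f v).
have h_lin : linear h.
  by move=> a u v; apply/rowP => i; rewrite !mxE lfunD lfunZ dotDr dotZr.
pose h' : {linear V -> 'rV[R]_(\dim U)} :=
  HB.pack h (GRing.isLinear.Build R V 'rV[R]_(\dim U) _ h h_lin).
exists (lker (linfun h')); split.
  move=> v; rewrite memv_ker lfunE /=; split=> [/eqP/rowP hv u uU|hv].
    rewrite (coord_vbasis uU) dot_suml big1 // => i _.
    by rewrite dotZl; move: (hv i); rewrite !mxE => ->; rewrite mulr0.
  by apply/eqP/rowP => i; rewrite !mxE hv // vbasis_mem // mem_nth // size_tuple.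
have := limg_ker_dim (linfun h') fullv; rewrite capfv => <-.
rewrite leq_add2l (leq_trans (dimvS (subvf _))) // dimvf.
by rewrite dim_matrix; lia.
Qed.

End Perp.

Lemma mem_iter_img N i (Y : {vspace V}) v :
  v \in iter i (lfun_img N) Y <-> exists2 y, y \in Y & v = iter i N y.
Proof.
elim: i v => [|i IH] v /=; first by split=> [vY|[y yY ->]] //; exists v.
split=> [/memv_imgP[w /IH[y yY ->] ->]|[y yY ->]]; first by exists y.
by apply/memv_img/IH; exists y.
Qed.

Definition lpow N i : 'End(V) := iter i (comp_lfun N) \1%VF.
Lemma lpowE N i x : lpow N i x = iter i N x.
Proof. by elim: i => [|i IH]; rewrite /lpow /= ?id_lfunE // comp_lfunE -IH. Qed.

(** * Splitting off Jordan blocks of full length *)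

Section JordanSpan.
Variables (N : 'End(V)) (m : nat) (Y C : {vspace V}).
Hypothesis Nm : forall x, iter m.+1 N x = 0.
Hypothesis YC : forall y, y \in Y -> iter m N y \in C -> y = 0.
Let U : {vspace V} := (\sum_(i < m.+1) iter i (lfun_img N) Y)%VS.

Lemma iter_lfunD i x y : iter i N (x + y) = iter i N x + iter i N y.
Proof. by elim: i => //= i ->; rewrite lfunD. Qed.
Lemma iter_lfunN i x : iter i N (- x) = - iter i N x.
Proof. by elim: i => //= i ->; rewrite lfunN. Qed.
Lemma iter_lfunZ i c x : iter i N (c *: x) = c *: iter i N x.
Proof. by elim: i => //= i ->; rewrite lfunZ. Qed.
Lemma iter_lfun0 i : iter i N 0 = 0.
Proof. by elim: i => //= i ->; rewrite lfun0. Qed.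
Lemma iter_lfun_sum i (I : Type) (r : seq I) (P : pred I) (F : I -> V) :
  iter i N (\sum_(j <- r | P j) F j) = \sum_(j <- r | P j) iter i N (F j).
Proof.
by apply: big_morph => [x y|]; [apply: iter_lfunD|apply: iter_lfun0].
Qed.

Lemma iter_nilpotent i x : (m < i)%N -> iter i N x = 0.
Proof. by move=> mi; rewrite -(subnK mi) iterD Nm iter_lfun0. Qed.

(** [N ^ (m - i)] kills the terms above [i] and sends the term at [i] to [N ^ m (y i)], while the
    terms below [i] vanish by induction. Membership in [C] then forces [y i = 0]. *)
Lemma jordan_span_zero (y : 'I_m.+1 -> V) : (forall i, y i \in Y) ->
  (forall i, (i <= m)%N -> iter i N (\sum_(j < m.+1) iter j N (y j)) \in C) ->
  forall i, y i = 0.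
Proof.
move=> yY yC.
suff H k (i : 'I_m.+1) : (i < k)%N -> y i = 0 by move=> i; apply: (H i.+1).
elim: k i => // k IH i; rewrite ltnS leq_eqVlt => /orP[/eqP ik|/IH //].
apply: YC => //; have := yC (m - i)%N (leq_subr _ _).
have im : (i <= m)%N by rewrite -ltnS.
rewrite iter_lfun_sum (bigD1 i) //= -iterD subnK // big1 ?addr0 // => j ji.
have [jk|kj] := ltnP j k; first by rewrite IH // !iter_lfun0.
rewrite -iterD iter_nilpotent //; have := ltn_ord i; move: ji; rewrite -val_eqE /=; lia.
Qed.

Lemma mem_jordan_span x : x \in U <->
  exists2 y : 'I_m.+1 -> V, (forall i, y i \in Y) & x = \sum_(i < m.+1) iter i N (y i).
Proof.
split=> [/memv_sumP[v vU ->]|[y yY ->]].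
  have /choice[y yP] (i : 'I_m.+1) : exists y, y \in Y /\ v i = iter i N y.
    by have /mem_iter_img[y] := vU i isT; exists y.
  by exists y => [i|]; [case: (yP i)|apply: eq_bigr => i _; case: (yP i)].
by apply: memv_sumr => i _; apply/mem_iter_img; exists (y i).
Qed.

Lemma directv_jordan_span : directv (\sum_(i < m.+1) iter i (lfun_img N) Y)%VS.
Proof.
apply/directv_sum_independent => v vU v0 i _.
have /choice[y yP] (j : 'I_m.+1) : exists y, y \in Y /\ v j = iter j N y.
  by have /mem_iter_img[y] := vU j isT; exists y.
rewrite (yP i).2 (@jordan_span_zero y) ?iter_lfun0 // => [j|j _]; first by case: (yP j).
rewrite -(eq_bigr _ (fun j _ => (yP j).2)) v0 iter_lfun0; exact: mem0v.
Qed.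

Lemma iter_inj_dim i : (i <= m)%N -> \dim (iter i (lfun_img N) Y) = \dim Y.
Proof.
elim: i => // i IH im; rewrite iterS limg_dim_eq ?IH ?(ltnW im) //.
apply/eqP; rewrite -subv0; apply/subvP => v /memv_capP[/mem_iter_img[y yY ->]].
rewrite memv_ker memv0 => /eqP Ny; rewrite (YC yY) ?iter_lfun0 //.
by rewrite -(subnK im) iterD iterS Ny iter_lfun0 mem0v.
Qed.

Lemma dim_jordan_span : \dim U = (m.+1 * \dim Y)%N.
Proof.
rewrite (directvP directv_jordan_span) /=.
rewrite (eq_bigr (fun=> \dim Y)) => [|i _]; first by rewrite sum_nat_const card_ord.
by rewrite iter_inj_dim // -ltnS.
Qed.

Hypothesis VC : forall v, exists2 y, y \in Y & v - iter m N y \in C.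

(** [K] is the largest [N]-invariant subspace of [C]. To reach it from [x], the powers [N ^ m x],
    [N ^ (m - 1) x], ... are corrected into [C] one after the other by subtracting terms [N ^ k y]
    from [x]. A later correction leaves the higher powers unchanged because [N ^ (m + 1) = 0]. *)
Lemma jordan_span_complement : exists K : {vspace V},
  [/\ forall x, x \in K <-> (forall i, (i <= m)%N -> iter i N x \in C),
      (U :&: K)%VS = 0%VS & (U + K)%VS = fullv].
Proof.
pose K := (\bigcap_(i < m.+1) (lpow N i @^-1: C))%VS.
have KP x : x \in K <-> (forall i, (i <= m)%N -> iter i N x \in C).
  rewrite memvE; split=> [/subv_bigcapP xK i im|xC].
    have := xK (Ordinal (im : (i < m.+1)%N)) isT.
    by rewrite -memvE -memv_preim lpowE.
  apply/subv_bigcapP => i _; rewrite -memvE -memv_preim lpowE; apply: xC.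
  by rewrite -ltnS.
exists K; split=> //.
  apply/eqP; rewrite -subv0; apply/subvP => x /memv_capP[].
  move=> /mem_jordan_span[y yY ->] /KP yC; rewrite memv0 big1 // => i _.
  by rewrite (jordan_span_zero yY yC) iter_lfun0.
apply/eqP; rewrite eqEsubv subvf /=; apply/subvP => x _.
suff H k : (k <= m.+1)%N -> exists2 u, u \in U &
    forall i, (m.+1 - k <= i)%N -> iter i N (x - u) \in C.
  have [u uU uC] := H m.+1 (leqnn _).
  rewrite -(subrKC u x) memv_add //; apply/KP => i _; apply: uC.
  by rewrite subnn.
elim: k => [_|k IH km].
  exists 0 => [|i]; first exact: mem0v.
  by rewrite subn0 => mi; rewrite iter_nilpotent // mem0v.
have [u uU uC] := IH (ltnW km).
have [y yY yC] := VC (iter (m - k)%N N (x - u)).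
exists (u + iter k N y).
  apply: memvD => //; rewrite memvE; apply: (sumv_sup (Ordinal km)) => //.
  by rewrite -memvE; apply/mem_iter_img; exists y.
move=> i; rewrite opprD addrA iter_lfunD iter_lfunN subSS leq_eqVlt => /orP[/eqP <-|ik].
  by rewrite -iterD subnK.
rewrite -iterD [iter (i + k) _ _]iter_nilpotent ?subr0; last by lia.
by apply: uC; lia.
Qed.

End JordanSpan.

End Complements.

Section Subspaces.
Variables (R : realType) (V : vectType R).
Implicit Types (f g : 'End(V)) (U C K : {vspace V}).

Lemma full_add U C : (U :&: C)%VS = 0%VS -> (\dim {:V} <= \dim C + \dim U)%N ->
  (U + C)%VS = fullv.
Proof.
move=> UC dV; apply/eqP; rewrite eqEdim subvf /=.
by rewrite dimv_disjoint_sum // addnC.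
Qed.

Lemma capv_eq0P U C : (forall x, x \in U -> x \in C -> x = 0) -> (U :&: C)%VS = 0%VS.
Proof.
move=> h; apply/eqP; rewrite -subv0; apply/subvP => x /memv_capP[xU xC].
by rewrite (h x) // mem0v.
Qed.

Lemma capv_eq0 U C x : (U :&: C)%VS = 0%VS -> x \in U -> x \in C -> x = 0.
Proof. by move=> UC xU xC; apply/eqP; rewrite -memv0 -UC memv_cap xU. Qed.

Lemma full_decompose U C : (U + C)%VS = fullv ->
  forall x, exists u v, [/\ u \in U, v \in C & x = u + v].
Proof.
move=> UC x; have : x \in (U + C)%VS by rewrite UC memvf.
by move=> /memv_addP[u uU [v vC ->]]; exists u, v.
Qed.

Lemma neq0_vspace U : U != 0%VS -> exists2 x, x \in U & x != 0.
Proof. by exists (vpick U); rewrite ?memv_pick ?vpick0. Qed.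

Lemma orthogonal_projection (dot : {dot V for @idfun R}) U :
  exists P : 'End(V), (forall x, P x \in U) /\
    (forall u x, u \in U -> dot u (P x) = dot u x).
Proof.
have [K [KP dK]] := perp_exists dot \1%VF U.
have UK : (U :&: K)%VS = 0%VS.
  by apply: capv_eq0P => x xU /KP/(_ x xU); rewrite id_lfunE => /dot_eq0.
have UKf := full_add UK dK.
exists (daddv_pi U K); split=> [x|u x uU]; first exact: memv_pi.
have xUK : x \in (U + K)%VS by rewrite UKf memvf.
rewrite -[in RHS](daddv_pi_add UK xUK) dotDr.
have /KP/(_ u uU) := memv_pi K U x.
by rewrite id_lfunE => ->; rewrite addr0.
Qed.

End Subspaces.

(** * Structure maps and indecomposability *)

Section Systems.
Variables (R : realType) (V : vectType R) (dot : {dot V for @idfun R}).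
Implicit Types (k : kind) (e mu : sign) (s L S N T : 'End(V)) (U Y C : {vspace V}).

Definition structure_map e s :=
  (forall x, s (s x) = sg e *: x) /\ (forall x y, dot (s x) y = sg e * dot x (s y)).

(** For anti-automorphisms the equation is paired with vectors, which removes the adjoint and leaves
    a statement about the form [dot x (s y)]. *)
Definition compatible k mu s L : Prop :=
  match k with
  | Aut => forall x, L (s x) = sg mu *: s (L x)
  | Antiaut => forall x y, dot (L x) (s y) = sg mu * dot x (s (L y))
  end.

(* Unlike [indecomposable], this is invariant under equivalence: for
   anti-automorphisms the summands are orthogonal for [dot x (s y)] instead of
   being [s]-invariant. *)
Definition indec k s L : Prop := forall U1 U2 : {vspace V},
  invariant L U1 -> invariant L U2 -> (U1 :&: U2)%VS = 0%VS ->
  (U1 + U2)%VS = fullv ->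
  match k with
  | Aut => invariant s U1 /\ invariant s U2
  | Antiaut => {in U1 & U2, forall x y, dot x (s y) = 0}
  end -> U1 = 0%VS \/ U2 = 0%VS.

Lemma sgK mu : sg mu * sg mu = 1 :> R.
Proof. by case: mu; rewrite /= ?mulrNN mulr1. Qed.

Lemma sg_neq0 mu : sg mu != 0 :> R.
Proof. by case: mu; rewrite /= ?oppr_eq0 oner_eq0. Qed.

Lemma order_two_structure s : order_two_structure_map dot s ->
  exists e, structure_map e s.
Proof.
move=> [iso [e ss]]; exists e.
have ssE x : s (s x) = sg e *: x.
  by move/lfunP/(_ x): ss; rewrite comp_lfunE scale_lfunE id_lfunE.
by split=> // x y; rewrite -iso ssE dotZl.
Qed.

Section StructureMap.
Variables (e : sign) (s : 'End(V)).
Hypothesis hs : structure_map e s.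

Lemma structure_map_inj x : s x = 0 -> x = 0.
Proof.
move=> sx; have /eqP := hs.1 x; rewrite sx lfun0 eq_sym scaler_eq0.
by rewrite (negPf (sg_neq0 e)) => /eqP.
Qed.

Lemma structure_form_sym x y : dot x (s y) = sg e * dot y (s x).
Proof. by rewrite -hs.2 dotC. Qed.

Lemma structure_form_nondeg x : (forall y, dot y (s x) = 0) -> x = 0.
Proof. by move=> h; apply/structure_map_inj/(dot_nondegenerate (dot := dot)). Qed.

Lemma lker_structure_map : lker s == 0%VS.
Proof.
rewrite -subv0; apply/subvP => x; rewrite memv_ker memv0 => /eqP sx.
by rewrite (structure_map_inj sx).
Qed.

Lemma gamma_compatible k mu L : gamma dot k s L = sg mu *: L -> compatible k mu s L.
Proof.
move=> gL; have h x : (if k is Aut then L else adjoint dot L) (s x) = sg mu *: s (L x).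
  have /lfunP/(_ x) := gL; rewrite /gamma !comp_lfunE scale_lfunE.
  move/(congr1 s); rewrite lfunZ (lker0_lfunVK lker_structure_map).
  by [].
case: k h gL => //= h _ x y.
by rewrite adjointE h dotZr.
Qed.

End StructureMap.

Lemma jordan_compatible k mu s L S N : jordan_chevalley L S N ->
  compatible k mu s L -> compatible k mu s S /\ compatible k mu s N.
Proof.
move=> JC; have [LSN _ _ _] := JC.
have NE x : N x = L x - S x by rewrite LSN add_lfunE addrC addKr.
case: k => /= hL.
  have hS := jordan_semicommute JC hL; split=> // x.
  by rewrite !NE hL hS lfunD lfunN scalerBr.
have hS := jordan_semiadjoint JC hL; split=> // x y.
by rewrite !NE dotDl dotNl lfunD lfunN dotDr dotNr mulrBr hL hS.
Qed.

Lemma compatible_exp k mu s N i : compatible k mu s N ->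
  match k with
  | Aut => forall x, iter i N (s x) = sg mu ^+ i *: s (iter i N x)
  | Antiaut => forall x y, dot (iter i N x) (s y) = sg mu ^+ i * dot x (s (iter i N y))
  end.
Proof.
case: k => /= hN.
  elim: i => [|i IH] x; first by rewrite expr0 scale1r.
  by rewrite !iterS IH lfunZ hN scalerA exprSr.
elim: i => [|i IH] x y; first by rewrite expr0 mul1r.
by rewrite iterSr IH hN mulrA -exprSr -iterS.
Qed.

Lemma compatible_iter k mu s N i : compatible k mu s N ->
  exists c : R, c * c = 1 /\
  match k with
  | Aut => forall x, iter i N (s x) = c *: s (iter i N x)
  | Antiaut => forall x y, dot (iter i N x) (s y) = c * dot x (s (iter i N y))
  end.
Proof.
move=> hN; exists (sg mu ^+ i); split; last exact: compatible_exp.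
by rewrite -exprMn sgK expr1n.
Qed.

(* For anti-automorphisms, an equivalence that makes the two summands
   orthogonal for [dot] makes them invariant under the structure map. *)
Lemma indec_of_pair k e s L : structure_map e s ->
  indecomposable_pair k dot L s -> indec k s L /\ {:V}%VS != 0%VS.
Proof.
move=> hs hp; split; last first.
  have /hp[] // : equivalent k dot dot {:V}%VS {:V}%VS L s L s.
  exists \1%VF; split.
  - by rewrite lim1g.
  - by move=> x y _ _; rewrite !id_lfunE.
  - by move=> x _; rewrite !id_lfunE.
  by case: (k) => [x _|x y _ _]; rewrite !id_lfunE.
move=> U1 U2 LU1 LU2 U12 U12f orth.
have [->|U1n0] := eqVneq U1 0%VS; first by left.
have [->|U2n0] := eqVneq U2 0%VS; first by right.
exfalso; case: k hp orth => hp orth.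
  have /hp[_ _] : equivalent Aut dot dot {:V}%VS {:V}%VS L s L s.
    exists \1%VF; split.
    - by rewrite lim1g.
    - by move=> x y _ _; rewrite !id_lfunE.
    - by move=> x _; rewrite !id_lfunE.
    by move=> x _; rewrite !id_lfunE.
  apply; exists U1, U2; split=> //; apply/stable2P; split=> //.
    exact: orth.1.
  exact: orth.2.
have [P [PU1 dotP]] := orthogonal_projection dot U1.
pose q := daddv_pi U2 U1; pose p := daddv_pi U1 U2.
have pq x : p x + q x = x by apply: daddv_pi_add; rewrite ?U12f ?memvf.
have U21 : (U2 :&: U1)%VS = 0%VS by rewrite capvC.
have pU x : p x \in U1 by apply: memv_pi.
have qU x : q x \in U2 by apply: memv_pi.
have q2 x : x \in U2 -> q x = x by apply: daddv_pi_id.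
have p1 x : x \in U1 -> p x = x by apply: daddv_pi_id.
have q1 x : x \in U1 -> q x = 0.
  by move=> xU; have := pq x; rewrite p1 // => /(canRL (addKr _)) ->; rewrite addNr.
(* This shear fixes [U1] and removes from each vector of [U2] its orthogonal projection to [U1], so
   that the two images become orthogonal. *)
pose g : 'End(V) := \1%VF - (P \o q)%VF.
have gE x : g x = x - P (q x).
  by rewrite add_lfunE opp_lfunE id_lfunE comp_lfunE.
have g1 x : x \in U1 -> g x = x by move=> xU; rewrite gE q1 // lfun0 subr0.
have g12 x y : x \in U1 -> y \in U2 -> dot x (g y) = 0.
  by move=> xU yU; rewrite gE q2 // dotDr dotNr dotP // subrr.
have g_inj x : g x = 0 -> x = 0.
  move=> gx; rewrite -(pq x).
  have px : p x = 0.
    have : dot (p x) (g (p x + q x)) = 0 by rewrite pq gx dot0r.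
    by rewrite lfunD dotDr (g12 _ _ (pU x) (qU x)) (g1 _ (pU x)) addr0 => /dot_eq0.
  have : g (p x + q x) = 0 by rewrite pq.
  rewrite px !add0r gE (q2 _ (qU x)) => h.
  apply: (capv_eq0 U12) => //.
  by move/eqP: h; rewrite subr_eq0 => /eqP ->.
have g0 : lker g == 0%VS.
  rewrite -subv0; apply/subvP => x; rewrite memv_ker memv0 => /eqP gx.
  by rewrite (g_inj x gx).
have gK := lker0_lfunK g0; have gVK := lker0_lfunVK g0.
pose s' : 'End(V) := (adjoint dot g^-1 \o (s \o g^-1))%VF.
have s'E x y : dot (g x) (s' (g y)) = dot x (s y).
  by rewrite !comp_lfunE -adjointE !gK.
pose L' : 'End(V) := (g \o (L \o g^-1))%VF.
have L'E x : L' (g x) = g (L x) by rewrite !comp_lfunE gK.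
have /hp[_ _] : equivalent Antiaut dot dot {:V}%VS {:V}%VS L s L' s'.
  exists g; split.
  - exact: lker0_limgf.
  - by move=> x y _ _ /(can_inj gK).
  - by move=> x _; rewrite L'E.
  by move=> x y _ _; rewrite s'E.
have decomp z : exists2 v, z = g v & z = g (p v) + g (q v).
  by exists (g^-1%VF z); rewrite ?gVK // -lfunD pq gVK.
have gorth x y : x \in U1 -> y \in U2 -> dot (g x) (g y) = 0.
  by move=> xU yU; rewrite g1 // g12.
have img0 U : U != 0%VS -> (g @: U)%VS != 0%VS.
  by rewrite -!dimv_eq0 limg_dim_eq // (eqP g0) capv0.
apply; exists (g @: U1)%VS, (g @: U2)%VS; split; rewrite ?img0 //.
- split; last by rewrite -limgD U12f lker0_limgf.
  by rewrite -lker0_img_cap // U12 limg0.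
- apply/stable2P; split=> _ /memv_imgP[u uU ->].
    by rewrite L'E memv_img // LU1.
  (* [s' (g u)] is orthogonal to [g @: U2] because the form pairs [U1] and [U2] trivially. As the
     two images are orthogonal, its component along [g @: U2] is orthogonal to itself. *)
  have [v zv ->] := decomp (s' (g u)).
  suff -> : g (q v) = 0 by rewrite addr0 memv_img.
  have : dot (g (q v)) (s' (g u)) = 0.
    by rewrite s'E (structure_form_sym hs) orth ?mulr0.
  by rewrite zv -{2}(pq v) lfunD dotDr dotC (gorth _ _ (pU v) (qU v)) add0r => /dot_eq0.
apply/stable2P; split=> _ /memv_imgP[u uU ->].
  by rewrite L'E memv_img // LU2.
have [v zv ->] := decomp (s' (g u)).
suff -> : g (p v) = 0 by rewrite add0r memv_img.
have : dot (g (p v)) (s' (g u)) = 0 by rewrite s'E orth.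
by rewrite zv -{2}(pq v) lfunD dotDr (gorth _ _ (pU v) (qU v)) addr0 => /dot_eq0.
Qed.

End Systems.

(** * Reduced spaces *)

Section Reduction.
Variables (R : realType) (V : vectType R) (dot : {dot V for @idfun R}).
Variables (k : kind) (e mu : sign) (s L S N : 'End(V)).
Implicit Types (U Y C : {vspace V}).
Hypothesis hs : structure_map dot e s.
Hypothesis LSN : L = S + N.
Hypothesis SN : forall x, S (N x) = N (S x).
Hypothesis cS : compatible dot k mu s S.
Hypothesis cN : compatible dot k mu s N.
Hypothesis ind : indec dot k s L.

Let LE x : L x = S x + N x. Proof. by rewrite LSN add_lfunE. Qed.

Lemma iter_commute i x : S (iter i N x) = iter i N (S x).
Proof. by elim: i => //= i <-; rewrite SN. Qed.

Lemma graded_commutes T : graded mu S T ->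
  exists c : R, c * c = 1 /\
  match k with
  | Aut => forall x, T (s x) = c *: s (T x)
  | Antiaut => forall x y, dot (T x) (s y) = c * dot x (s (T y))
  end.
Proof.
by case: k cS => /= h gT; [apply: graded_semicommute h gT|apply: graded_semiadjoint h gT].
Qed.

Lemma system_spectrum : semisimple S -> {:V}%VS != 0%VS ->
  exists sp, spectrum_ok mu sp /\ has_spectrum S sp.
Proof.
move=> ssS V0; apply: spectrum_exists => //.
  by have [v _ v0] := neq0_vspace V0; exists v.
move=> T gT TT [x x0 Tx].
have [c [cc hT]] := graded_commutes gT.
have TS y : T (S y) = S (T y).
  exact: generated_commute2 (graded_generated gT) (gen_self S) _.
have TN y : T (N y) = N (T y).
  by apply/esym/(generated_commute _ (graded_generated gT)) => z; rewrite SN.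
have TL y : T (L y) = L (T y) by rewrite !LE lfunD TS TN.
have c0 : c != 0 by apply: contra_eq_neq cc => ->; rewrite mulr0 eq_sym oner_eq0.
have kerimg : (lker T :&: limg T)%VS = 0%VS.
  apply: capv_eq0P => y; rewrite memv_ker => /eqP Ty /memv_imgP[z _ yz].
  by rewrite yz TT // -yz.
have full : (lker T + limg T)%VS = fullv.
  by apply: full_add => //; rewrite -(limg_ker_dim T fullv) capfv addnC.
have kerL : invariant L (lker T).
  by move=> y; rewrite !memv_ker TL => /eqP ->; rewrite lfun0.
have imgL : invariant L (limg T).
  by move=> _ /memv_imgP[y _ ->]; rewrite -TL memv_img ?memvf.
have [|K0|T0] := ind kerL imgL kerimg full.
- case: k hT => hT.
    split=> [y|_ /memv_imgP[y _ ->]].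
      by rewrite !memv_ker hT => /eqP ->; rewrite lfun0 scaler0.
    have -> : s (T y) = c *: T (s y) by rewrite hT scalerA cc scale1r.
    by rewrite memvZ // memv_img ?memvf.
  move=> y ?; rewrite memv_ker => /eqP Ty /memv_imgP[z _ ->].
  by apply: (mulfI c0); rewrite -hT Ty dot0l mulr0.
- have : x \in lker T by rewrite memv_ker Tx.
  by rewrite K0 memv0 (negPf x0).
by move=> y; apply/eqP; rewrite -memv0 -T0 memv_img ?memvf.
Qed.

Section Core.
Variables (m : nat) (sp : spectrum R).
Hypothesis Nm : forall x, iter m.+1 N x = 0.
Hypothesis ok : spectrum_ok mu sp.
Hypothesis hsp : has_spectrum S sp.

(** The condition under which the subspaces [N ^ i Y] together split off as a direct summand. It can
    be checked on subspaces that are not yet known to generate [V]. *)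
Definition nondegenerate Y := match k with
  | Aut => invariant s Y /\ (forall y, y \in Y -> iter m N y = 0 -> y = 0)
  | Antiaut => forall y, y \in Y ->
      (forall x, x \in Y -> dot x (s (iter m N y)) = 0) -> y = 0
  end.

Lemma nondegenerate_inj Y : nondegenerate Y ->
  forall y, y \in Y -> iter m N y = 0 -> y = 0.
Proof.
rewrite /nondegenerate; case: (k) => [[_ h] //|h] y yY Ny; apply: h => // x _.
by rewrite Ny lfun0 dot0r.
Qed.

(** [C] is an invariant complement of [N ^ m Y] for automorphisms, and the orthogonal space of [Y]
    for the form otherwise. In the second case it meets [N ^ m Y] trivially by nondegeneracy and is
    a complement by dimension. *)
Lemma dual_subspace Y : invariant S Y -> nondegenerate Y -> exists C : {vspace V},
  [/\ forall y, y \in Y -> iter m N y \in C -> y = 0,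
      forall v, exists2 y, y \in Y & v - iter m N y \in C, invariant S C
    & match k with
      | Aut => invariant s C
      | Antiaut => forall u v, u \in Y -> v \in C -> dot u (s v) = 0
      end].
Proof.
move=> SY nY; have inj := nondegenerate_inj nY; rewrite /nondegenerate in nY.
pose W := iter m (lfun_img N) Y.
have WP v : v \in W <-> exists2 y, y \in Y & v = iter m N y by apply: mem_iter_img.
have SW : invariant S W.
  by move=> v /WP[y yY ->]; apply/WP; exists (S y); rewrite ?iter_commute ?SY.
have from_complement C : (W + C)%VS = fullv ->
    forall v, exists2 y, y \in Y & v - iter m N y \in C.
  move=> WC v; have [u [w [/WP[y yY ->] wC ->]]] := full_decompose WC v.
  by exists y; rewrite // addrC addKr.
have [c [cc hc]] := compatible_iter m cN.
case: k nY hc graded_commutes cS cN => [[sY _]|nY] hc gr hS hN.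
  have sW : invariant s W.
    move=> v /WP[y yY ->]; apply/WP; exists (c *: s y); first by rewrite memvZ ?sY.
    by rewrite iter_lfunZ hc scalerA cc scale1r.
  have [C [WC WCf SC sC]] := graded_complement ok hsp (sgK R e) hs.1 gr SW sW.
  exists C; split=> //; last exact: from_complement.
  by move=> y yY yC; apply: inj => //; apply: (capv_eq0 WC) => //; apply/WP; exists y.
have [C [CP dC]] := perp_exists dot s Y.
have YC y : y \in Y -> iter m N y \in C -> y = 0 by move=> yY /CP; apply: nY.
have dW : \dim W = \dim Y.
  have inj0 y : y \in Y -> iter m N y \in 0%VS -> y = 0.
    by move=> yY; rewrite memv0 => /eqP; apply: inj.
  exact: iter_inj_dim inj0 _ (leqnn m).
have WC : (W :&: C)%VS = 0%VS.
  by apply: capv_eq0P => v /WP[y yY ->] /(YC _ yY) ->; rewrite iter_lfun0.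
exists C; split=> //.
- by apply: from_complement; apply: full_add => //; rewrite dW.
- move=> v /CP vC; apply/CP => u uY.
  by apply: (mulfI (sg_neq0 _ mu)); rewrite -hS mulr0 vC ?SY.
by move=> u v uY /CP; apply.
Qed.

Local Notation span Y := (\sum_(i < m.+1) iter i (lfun_img N) Y)%VS.

Lemma iter_mem_span i y Y : y \in Y -> iter i N y \in span Y.
Proof.
move=> yY; have [im|mi] := leqP i m; last by rewrite (iter_nilpotent Nm) // mem0v.
rewrite memvE; apply: (sumv_sup (Ordinal (im : (i < m.+1)%N))) => //.
by rewrite -memvE; apply/mem_iter_img; exists y.
Qed.

Lemma span_invariant (f : 'End(V)) Y :
  (forall i y, y \in Y -> f (iter i N y) \in span Y) -> invariant f (span Y).
Proof.
move=> h x /mem_jordan_span[y yY ->]; rewrite lfun_sum.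
by apply: memv_suml => i _; apply: h.
Qed.

(** The span of the [N ^ i Y] and the complement [K] cut out by the dual subspace form a
    decomposition as in [indec]. The span contains [Y], so [K] is the summand that vanishes. *)
Lemma jordan_span_full Y : invariant S Y -> nondegenerate Y -> Y != 0%VS ->
  [/\ span Y = fullv, directv (span Y) & \dim {:V} = (m.+1 * \dim Y)%N].
Proof.
move=> SY nY Y0; have [C [YC VC SC sC]] := dual_subspace SY nY.
have [K [KP UK UKf]] := jordan_span_complement Nm YC VC.
have LU : invariant L (span Y).
  apply: span_invariant => i y yY; rewrite LE memvD //.
    by rewrite iter_commute iter_mem_span ?SY.
  by rewrite -iterS iter_mem_span.
have NC x i : x \in K -> iter i N x \in C.
  move=> /KP h; have [im|mi] := leqP i m; first exact: h.
  by rewrite (iter_nilpotent Nm) // mem0v.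
have LK : invariant L K.
  move=> x xK; apply/KP => i _; rewrite LE iter_lfunD -iter_commute -iterSr.
  by rewrite memvD // ?SC // NC.
suff UV : span Y = fullv.
  by split=> //; [apply: (directv_jordan_span Nm YC)|rewrite -UV (dim_jordan_span Nm YC)].
have [|U0|K0] := ind LU LK UK UKf; last by rewrite -UKf K0 addv0.
- rewrite /nondegenerate in nY; have hi i := compatible_iter i cN.
  case: k nY sC hi => [[sY _]|nY] sC hi.
    split=> [|x xK].
      apply: span_invariant => i y yY; have [c [cc hc]] := hi i.
      have -> : s (iter i N y) = iter i N (c *: s y).
        by rewrite iter_lfunZ hc scalerA cc scale1r.
      by rewrite iter_mem_span ?memvZ ?sY.
    apply/KP => i _; have [c [cc ->]] := hi i.
    by rewrite memvZ ?sC ?NC.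
  move=> x y /mem_jordan_span[z zY ->] yK; rewrite dot_suml big1 // => i _.
  by have [c [_ ->]] := hi i; rewrite sC ?mulr0 ?NC.
have [y yY /eqP] := neq0_vspace Y0; case; apply/eqP.
by rewrite -memv0 -U0 (@iter_mem_span 0%N).
Qed.

Hypothesis Nm_neq0 : exists x, iter m N x != 0.

(** Both spaces have dimension [\dim {:V} / (m + 1)]. This is the minimality on which the
    classification rests. *)
Lemma nondegenerate_eq Y1 Y : invariant S Y1 -> nondegenerate Y1 -> Y1 != 0%VS ->
  invariant S Y -> nondegenerate Y -> Y != 0%VS -> (Y1 <= Y)%VS -> Y1 = Y.
Proof.
move=> SY1 nY1 Y10 SY nY Y0 Y1Y; apply/eqP; rewrite eqEdim Y1Y /=.
have [_ _ d1] := jordan_span_full SY1 nY1 Y10.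
have [_ _ d] := jordan_span_full SY nY Y0.
by rewrite -(leq_pmul2l (ltn0Sn m)) -d1 -d.
Qed.

(** An invariant complement of the kernel of [N ^ m] serves. For anti-automorphisms that kernel is
    the radical of the form [dot x (s (iter m N y))], which is therefore nondegenerate on a
    complement. *)
Lemma nondegenerate_exists :
  exists Y, [/\ invariant S Y, nondegenerate Y & Y != 0%VS].
Proof.
pose K := lker (lpow N m).
have KP x : (x \in K) = (iter m N x == 0) by rewrite memv_ker lpowE.
have SK : invariant S K.
  by move=> x; rewrite !KP -iter_commute => /eqP ->; rewrite lfun0.
have nz Y : (K + Y)%VS = fullv -> Y != 0%VS.
  move=> KY; apply/eqP => Y0; have [x] := Nm_neq0; rewrite -KP; suff -> : x \in K by [].
  by move: KY; rewrite Y0 addv0 => ->; rewrite memvf.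
have [c [cc hc]] := compatible_iter m cN.
have c0 : c != 0 by apply: contra_eq_neq cc => ->; rewrite mulr0 eq_sym oner_eq0.
rewrite /nondegenerate; case: k hc graded_commutes => hc gr.
  have sK : invariant s K.
    by move=> x; rewrite !KP hc => /eqP ->; rewrite lfun0 scaler0.
  have [Y [KY KYf SY sY]] := graded_complement ok hsp (sgK R e) hs.1 gr SK sK.
  exists Y; split=> //; last exact: nz.
  by split=> // y yY /eqP; rewrite -KP => yK; apply: (capv_eq0 KY).
have [Y [KY KYf SY]] := invariant_complement ok hsp SK.
exists Y; split=> // [y yY hy|]; last exact: nz.
apply: (capv_eq0 KY) => //; rewrite KP; apply/eqP.
apply: (structure_form_nondeg hs) => x.
have [u [v [uK vY ->]]] := full_decompose KYf x.
rewrite dotDl (hy _ vY) addr0; apply: (mulfI c0); rewrite -hc mulr0.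
by move: uK; rewrite KP => /eqP ->; rewrite dot0l.
Qed.

(** All Jordan blocks have the length [m + 1], so a vector killed by [N ^ m] has no component in
    [Y]. *)
Lemma ker_limg x : iter m N x = 0 -> x \in limg N.
Proof.
have [Y [SY nY Y0]] := nondegenerate_exists.
have [full _ _] := jordan_span_full SY nY Y0.
have [y yY ->] : exists2 y : 'I_m.+1 -> V, (forall i, y i \in Y) &
    x = \sum_(i < m.+1) iter i N (y i).
  by apply/(mem_jordan_span N m Y); rewrite full memvf.
rewrite iter_lfun_sum big_ord_recl big1 ?addr0 => [/(nondegenerate_inj nY (yY _)) y0|i _].
  rewrite big_ord_recl y0 add0r; apply: memv_suml => i _.
  by rewrite /= memv_img ?memvf.
by rewrite -iterD (iter_nilpotent Nm) //= /bump /=; lia.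
Qed.

Lemma height_succ n : height N n -> n = m.+1.
Proof.
move=> [Nn minn]; apply/eqP; rewrite eqn_leq minn //= ltnNge.
have [x /eqP xm] := Nm_neq0; apply/negP => nm; apply: xm.
by rewrite -(subnK nm) iterD Nn iter_lfun0.
Qed.

(** By [ker_limg] a complement of [limg N] is a complement of the kernel of [N ^ m], and the
    argument of [nondegenerate_exists] applies. *)
Lemma reduced_nondegenerate n Y : height N n -> reduced_space k s S N n Y ->
  [/\ invariant S Y, nondegenerate Y & Y != 0%VS].
Proof.
move=> /height_succ -> [/stable1P SY [YN YNf] _ full sY].
have inj y : y \in Y -> iter m N y = 0 -> y = 0.
  by move=> yY /ker_limg; apply: (capv_eq0 YN).
split=> //; last first.
  apply/eqP => Y0; have [x] := Nm_neq0; have : x \in {:V}%VS by rewrite memvf.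
  rewrite -full Y0 => /mem_jordan_span[y yY ->].
  rewrite big1 ?iter_lfun0 ?eqxx // => i _; have := yY i.
  by rewrite memv0 => /eqP ->; rewrite iter_lfun0.
have [c [cc hc]] := compatible_iter m cN.
have c0 : c != 0 by apply: contra_eq_neq cc => ->; rewrite mulr0 eq_sym oner_eq0.
rewrite /nondegenerate; case: k hc sY => hc sY.
  by split=> //; apply/stable1P.
move=> y yY hy; apply: inj => //; apply: (structure_form_nondeg hs) => x.
have [u [_ [uY /memv_imgP[v _ ->] ->]]] := full_decompose YNf x.
rewrite dotDl (hy _ uY) add0r; apply: (mulfI c0); rewrite -hc mulr0.
by rewrite -iterSr Nm dot0l.
Qed.

Lemma reduction_exists : exists Y t, reduction dot k s S N Y t.
Proof.
have [Y [SY nY Y0]] := nondegenerate_exists; have inj := nondegenerate_inj nY.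
have [full direct _] := jordan_span_full SY nY Y0.
have [P [PY dotP]] := orthogonal_projection dot Y.
(* Composing with the orthogonal projection [P] represents the form on [Y] by a map into [Y]. *)
exists Y, (if k is Aut then s else (P \o (s \o lpow N m))%VF); exists m.+1; split.
- split=> // i Ni; rewrite ltnNge; apply/negP => im.
  have [x /eqP []] := Nm_neq0.
  by rewrite -(subnK im) iterD Ni iter_lfun0.
- split=> //; first exact/stable1P.
    split; first apply: capv_eq0P => y yY /memv_imgP[v _ yv].
      by apply: inj => //; rewrite yv -iterSr Nm.
    apply/eqP; rewrite eqEsubv subvf /= -[X in (X <= _)%VS]full; apply/subv_sumP => i _.
    case: i => [[|i] im] /=; first exact: addvSl.
    apply: (subv_trans _ (addvSr Y (limg N))); exact: limgS (subvf _).
  by move: nY; rewrite /nondegenerate; case: (k) => // -[sY _]; apply/stable1P.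
rewrite /reduced_structure_map; move: nY; rewrite /nondegenerate.
case: (k) => [[sY _]|_]; first by split=> //; apply/stable1P.
split; first by apply/stable1P => x _; rewrite comp_lfunE.
by move=> x y xY _; rewrite !comp_lfunE dotP // lpowE.
Qed.

End Core.
End Reduction.

(** * Lifting equivalences from reduced spaces *)

Section SquareRoot.
Variables (R : realType) (V : vectType R).
Implicit Types (M C X Z : 'End(V)).

Lemma generated_lpow M k : generated M (lpow M k).
Proof. by elim: k => [|k IH]; [apply: gen_id|apply: gen_comp]. Qed.

(* Newton's iteration for [C ^ 2 = 1 + M], starting at [C = 1]. *)
Lemma unipotent_sqrt M k : (forall x, iter k M x = 0) ->
  exists2 C, generated M C & forall x, C (C x) = x + M x.
Proof.
move=> Mk; suff [C [X [Z [gC [gX gZ] CE CC]]]] : exists C X Z,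
    [/\ generated M C, generated M X /\ generated M Z,
        forall x, C x = x + M (X x)
      & forall x, C (C x) = x + M x + iter k.+1 M (Z x)].
  by exists C => // x; rewrite CC iterS Mk lfun0 addr0.
elim: (k) => [|j [C [X [Z [gC [gX gZ] CE CC]]]]].
  exists \1%VF, (0 *: \1%VF), ((-1) *: \1%VF).
  have g1 := gen_id M; split=> //; first by split; apply: gen_scale.
    by move=> x; rewrite scale_lfunE !id_lfunE scale0r lfun0 addr0.
  by move=> x; rewrite scale_lfunE !id_lfunE scaleN1r /= lfunN addrK.
(* Since [C] is [1 + M X], subtracting half the error [D] removes it up to [- M X D + D ^ 2 / 4],
   which contains one more power of [M]. *)
pose D : 'End(V) := (lpow M j.+1 \o Z)%VF.
pose D' : 'End(V) := (lpow M j \o Z)%VF.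
have gD : generated M D by apply: generated_comp gZ; apply: generated_lpow.
have gD' : generated M D' by apply: generated_comp gZ; apply: generated_lpow.
have comm := generated_commute2 (S := M).
have DE x : D x = M (D' x) by rewrite !comp_lfunE !lpowE.
exists (C + (- 2^-1) *: D), (X + (- 2^-1) *: D'),
  ((- 1) *: (X \o Z)%VF + 4^-1 *: (D' \o Z)%VF); split.
- by apply: gen_add => //; apply: gen_scale.
- split; apply: gen_add => //; apply: gen_scale => //; exact: generated_comp.
- move=> x; rewrite !(add_lfunE, scale_lfunE) CE DE !(lfunD, lfunZ).
  by rewrite addrA.
move=> x; rewrite -lpowE.
have gP := generated_lpow M j.+2.
have CD y : C (D y) = D y + M (X (D y)) by rewrite CE.
rewrite !(add_lfunE, scale_lfunE, lfunD, lfunZ) CC (comm _ _ gD gC) CD.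
have -> : iter j.+1 M (Z x) = D x by rewrite comp_lfunE lpowE.
have -> : lpow M j.+2 ((X \o Z)%VF x) = M (X (D x)).
  rewrite [lpow _ _ _]lpowE iterS -lpowE [in LHS]comp_lfunE [in RHS]comp_lfunE.
  by rewrite (comm _ _ (generated_lpow M j.+1) gX).
have -> : lpow M j.+2 ((D' \o Z)%VF x) = D (D x).
  rewrite [lpow _ _ _]lpowE iterS -lpowE [in LHS]comp_lfunE [in RHS]DE; congr (M _).
  rewrite (comm _ _ (generated_lpow M j.+1) gD').
  by rewrite [D x]comp_lfunE.
vfield.
Qed.

End SquareRoot.

Section JordanCoordinates.
Variables (R : realType) (V : vectType R) (N : 'End(V)) (m : nat) (Y : {vspace V}).
Hypothesis Nm : forall x, iter m.+1 N x = 0.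
Hypothesis inj : forall y, y \in Y -> iter m N y = 0 -> y = 0.
Hypothesis full : (\sum_(i < m.+1) iter i (lfun_img N) Y)%VS = fullv.

Lemma jordan_coordinates : exists c : 'I_m.+1 -> 'End(V),
  (forall i x, c i x \in Y) /\ forall x, x = \sum_(i < m.+1) iter i N (c i x).
Proof.
pose f (i : 'I_m.+1) : 'End(V) := (lpow N i \o projv Y)%VF.
pose Vs (i : 'I_m.+1) := iter i (lfun_img N) Y.
(* The inverse yields some preimage under [f i], possibly outside [Y]. Projecting it to [Y] keeps
   its image, as [f i] starts with the same projection. *)
exists (fun i => projv Y \o ((f i)^-1 \o sumv_pi (\sum_(j < m.+1) Vs j)%VS i))%VF.
split=> [i x|x]; first by rewrite comp_lfunE memv_proj.
have {1}-> : x = \sum_(i < m.+1) sumv_pi (\sum_(j < m.+1) Vs j)%VS i x.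
  by rewrite sumv_pi_sum // full memvf.
apply: eq_bigr => i _; rewrite !comp_lfunE.
set z := sumv_pi _ _ _.
have : z \in limg (f i).
  have /mem_iter_img[y yY ->] : z \in Vs i by apply: memv_sum_pi.
  have -> : iter i N y = f i y by rewrite comp_lfunE projv_id // lpowE.
  by rewrite memv_img ?memvf.
by move/limg_lfunVK; rewrite {1}comp_lfunE lpowE.
Qed.

Lemma jordan_coordinates_eq (y z : 'I_m.+1 -> V) :
  (forall i, y i \in Y) -> (forall i, z i \in Y) ->
  \sum_(i < m.+1) iter i N (y i) = \sum_(i < m.+1) iter i N (z i) ->
  forall i, y i = z i.
Proof.
move=> yY zY yz i; apply/eqP; rewrite -subr_eq0; apply/eqP.
have inj0 u : u \in Y -> iter m N u \in 0%VS -> u = 0.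
  by move=> uY; rewrite memv0 => /eqP; apply: inj.
apply: (jordan_span_zero Nm inj0 (y := fun i => y i - z i)) => [j|j _].
  by rewrite memvB.
under eq_bigr do rewrite iter_lfunD iter_lfunN.
by rewrite sumrB yz subrr iter_lfun0 mem0v.
Qed.

End JordanCoordinates.

Section Lifting.
Variables (R : realType) (V : vectType R).
Variables (N N' S S' : 'End(V)) (m : nat) (Y Y' : {vspace V}) (g : 'End(V)).
Hypothesis Nm : forall x, iter m.+1 N x = 0.
Hypothesis N'm : forall x, iter m.+1 N' x = 0.
Hypothesis inj : forall y, y \in Y -> iter m N y = 0 -> y = 0.
Hypothesis inj' : forall y, y \in Y' -> iter m N' y = 0 -> y = 0.
Hypothesis full : (\sum_(i < m.+1) iter i (lfun_img N) Y)%VS = fullv.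
Hypothesis SN : forall x, S (N x) = N (S x).
Hypothesis S'N' : forall x, S' (N' x) = N' (S' x).
Hypothesis SY : invariant S Y.
Hypothesis gY : (g @: Y)%VS = Y'.
Hypothesis g_inj : {in Y &, injective g}.
Hypothesis gS : {in Y, forall y, g (S y) = S' (g y)}.

Lemma jordan_lift : exists G : 'End(V),
  [/\ forall y, (forall i, y i \in Y) ->
        G (\sum_(i < m.+1) iter i N (y i)) = \sum_(i < m.+1) iter i N' (g (y i)),
      forall x, G x = 0 -> x = 0,
      forall x, G (S x) = S' (G x)
    & forall x, G (N x) = N' (G x)].
Proof.
have [c [cY cE]] := jordan_coordinates full.
pose G : 'End(V) := \sum_(i < m.+1) (lpow N' i \o (g \o c i))%VF.
have GE x : G x = \sum_(i < m.+1) iter i N' (g (c i x)).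
  by rewrite sum_lfunE; apply: eq_bigr => i _; rewrite !comp_lfunE lpowE.
have GN y : (forall i, y i \in Y) ->
    G (\sum_(i < m.+1) iter i N (y i)) = \sum_(i < m.+1) iter i N' (g (y i)).
  move=> yY; rewrite GE; apply: eq_bigr => i _; congr (iter _ _ (g _)).
  by apply: (jordan_coordinates_eq Nm inj (fun j => cY j _) yY); rewrite -cE.
have gYY y : y \in Y -> g y \in Y' by move=> yY; rewrite -gY memv_img.
exists G; split=> // [x|x|x].
- rewrite GE => Gx; rewrite [x]cE big1 // => i _.
  suff -> : c i x = 0 by rewrite iter_lfun0.
  apply: g_inj; rewrite ?mem0v // lfun0.
  apply: (jordan_coordinates_eq N'm inj' (y := fun i => g (c i x)) (z := fun=> 0)).
  + by move=> j; apply: gYY.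
  + by move=> j; apply: mem0v.
  by rewrite Gx big1 // => j _; rewrite iter_lfun0.
- rewrite [x in G (S x)]cE [in RHS]GE (lfun_sum S) (lfun_sum S').
  under eq_bigr do rewrite (iter_commute SN).
  rewrite GN => [|i]; last exact: SY.
  by apply: eq_bigr => i _; rewrite (iter_commute S'N') gS.
rewrite [x in G (N x)]cE [in RHS]GE (lfun_sum N) (lfun_sum N').
(* [N] shifts the coordinates by one place: the new coordinate at [0] is zero, and the last one is
   lost to [N ^ (m + 1) = 0]. *)
pose z (i : 'I_m.+1) := if unlift ord0 i is Some j then c (widen_ord (leqnSn m) j) x else 0.
have z0 : z ord0 = 0 by rewrite /z unlift_none.
have zS i : z (lift ord0 i) = c (widen_ord (leqnSn m) i) x by rewrite /z liftK.
have -> : \sum_(i < m.+1) N (iter i N (c i x)) = \sum_(i < m.+1) iter i N (z i).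
  rewrite big_ord_recr big_ord_recl /= z0 add0r -iterS Nm addr0.
  by apply: eq_bigr => i _; rewrite zS.
rewrite GN => [|i]; last by rewrite /z; case: unlift => [j|]; [apply: cY|apply: mem0v].
rewrite big_ord_recl big_ord_recr /= z0 lfun0 add0r -iterS N'm addr0.
by apply: eq_bigr => i _; rewrite zS.
Qed.

End Lifting.

(** * Lifts that respect the structure maps *)

Section Equivalence.
Variables (R : realType) (V : vectType R) (dot : {dot V for @idfun R}).
Variables (k : kind) (mu : sign) (m : nat).
Variables (e e' : sign) (s s' S S' N N' : 'End(V)) (Y Y' : {vspace V}).
Hypothesis hs : structure_map dot e s.
Hypothesis hs' : structure_map dot e' s'.
Hypothesis SN : forall x, S (N x) = N (S x).
Hypothesis S'N' : forall x, S' (N' x) = N' (S' x).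
Hypothesis cS : compatible dot k mu s S.
Hypothesis cN : compatible dot k mu s N.
Hypothesis cS' : compatible dot k mu s' S'.
Hypothesis cN' : compatible dot k mu s' N'.
Hypothesis Nm : forall x, iter m.+1 N x = 0.
Hypothesis N'm : forall x, iter m.+1 N' x = 0.
Hypothesis kerN : forall x, iter m N x = 0 -> x \in limg N.
Hypothesis SY : invariant S Y.
Hypothesis nY : nondegenerate dot k s N m Y.
Hypothesis nY' : nondegenerate dot k s' N' m Y'.
Hypothesis Y_neq0 : Y != 0%VS.
Hypothesis full : (\sum_(i < m.+1) iter i (lfun_img N) Y)%VS = fullv.

Let inj := nondegenerate_inj nY.
Let inj' := nondegenerate_inj nY'.

Lemma lift_aut g : k = Aut -> (g @: Y)%VS = Y' -> {in Y &, injective g} ->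
  {in Y, forall y, g (S y) = S' (g y)} -> {in Y, forall y, g (s y) = s' (g y)} ->
  equivalent Aut dot dot {:V}%VS {:V}%VS (S + N) s (S' + N') s'.
Proof.
move=> kA gY g_inj gS gs.
have [G [GE G0 GS GN]] :=
  jordan_lift Nm N'm inj inj' full SN S'N' SY gY g_inj gS.
have kerG : lker G == 0%VS.
  by rewrite -subv0; apply/subvP => x; rewrite memv_ker memv0 => /eqP/G0 ->.
exists G; split.
- exact: lker0_limgf.
- by move=> x y _ _ /(can_inj (lker0_lfunK kerG)).
- by move=> x _; rewrite !add_lfunE lfunD GS GN.
move=> x _; move: nY cN cN'; rewrite /nondegenerate kA => -[sY _] hN hN'.
have /mem_jordan_span[y yY ->] : x \in (\sum_(i < m.+1) iter i (lfun_img N) Y)%VS.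
  by rewrite full memvf.
have sE i z : s (iter i N z) = iter i N (sg mu ^+ i *: s z).
  by rewrite iter_lfunZ (compatible_exp (k := Aut) i hN) scalerA -exprMn sgK expr1n
    scale1r.
have s'E i z : s' (iter i N' z) = iter i N' (sg mu ^+ i *: s' z).
  by rewrite iter_lfunZ (compatible_exp (k := Aut) i hN') scalerA -exprMn sgK expr1n
    scale1r.
rewrite (lfun_sum s) GE // (lfun_sum s').
under eq_bigr do rewrite sE.
rewrite GE => [|i]; last by rewrite memvZ ?sY.
by apply: eq_bigr => i _; rewrite s'E lfunZ gs.
Qed.

(* The lift of [g] respects the two forms up to a selfadjoint unipotent map
   that commutes with [S] and [N]. The inverse of its square root corrects it. *)
Lemma lift_antiaut g : k = Antiaut -> (g @: Y)%VS = Y' -> {in Y &, injective g} ->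
  {in Y, forall y, g (S y) = S' (g y)} ->
  {in Y &, forall x y, dot (g x) (s' (iter m N' (g y))) = dot x (s (iter m N y))} ->
  equivalent Antiaut dot dot {:V}%VS {:V}%VS (S + N) s (S' + N') s'.
Proof.
move=> kA gY g_inj gS gt.
have [G [GE G0 GS GN]] :=
  jordan_lift Nm N'm inj inj' full SN S'N' SY gY g_inj gS.
have GNi i x : G (iter i N x) = iter i N' (G x) by elim: i => //= i <-; rewrite GN.
have Gg y : y \in Y -> G y = g y.
  move=> yY; have := GE (fun i => if i == ord0 then y else 0).
  rewrite !big_ord_recl !big1 /= ?addr0 => [|i _|i _].
  - by apply=> i; case: eqP => // _; apply: mem0v.
  - by rewrite /= lfun0 -iterS iter_lfun0.
  by rewrite -iterS iter_lfun0.
move: nY cS cN cS' cN'; rewrite kA /= => nY0 hS hN hS' hN'.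
have topN x y i : (0 < i)%N -> dot (iter i N x) (s (iter m N y)) = 0.
  move=> i0; rewrite (compatible_exp (k := Antiaut) i hN) -iterD.
  by rewrite (iter_nilpotent Nm) ?lfun0 ?dot0r ?mulr0 //; lia.
have topN' x y i : (0 < i)%N -> dot (iter i N' x) (s' (iter m N' y)) = 0.
  move=> i0; rewrite (compatible_exp (k := Antiaut) i hN') -iterD.
  by rewrite (iter_nilpotent N'm) ?lfun0 ?dot0r ?mulr0 //; lia.
(* Paired with the image of [N ^ m], only the components in [Y] count, and on [Y] the map [g]
   respects the forms. *)
have top x y : dot (G x) (s' (G (iter m N y))) = dot x (s (iter m N y)).
  have spanY z : exists2 u : 'I_m.+1 -> V, (forall i, u i \in Y) &
      z = \sum_(i < m.+1) iter i N (u i).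
    by apply/mem_jordan_span; rewrite full memvf.
  have [u uY ->] := spanY x; have [v vY ->] := spanY y.
  have vE : iter m N (\sum_(i < m.+1) iter i N (v i)) = iter m N (v ord0).
    rewrite iter_lfun_sum big_ord_recl big1 ?addr0 //= => i _.
    by rewrite -iterS -iterD (iter_nilpotent Nm) //; lia.
  rewrite vE GNi (Gg _ (vY ord0)) GE // !big_ord_recl /= !dotDl gt //.
  congr (_ + _); rewrite !dot_suml !big1 // => i _; rewrite -iterS.
    exact: topN.
  exact: topN'.
(* The form twisted by [N ^ m] has the symmetry [e mu ^ m] before and [e' mu ^ m] after the lift,
   and it is not zero on [Y]. *)
have ee' : sg e = sg e' :> R.
  have [y yY y0] := neq0_vspace Y_neq0.
  have [x [xY txy]] : exists x, x \in Y /\ dot x (s (iter m N y)) != 0.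
    apply: contrapT => hx; case/eqP: y0; apply: nY0 => // x xY.
    by apply: contrapT => /eqP h; apply: hx; exists x.
  have sym : dot x (s (iter m N y)) = sg e * sg mu ^+ m * dot y (s (iter m N x)).
    by rewrite (structure_form_sym hs) (compatible_exp (k := Antiaut) m hN) mulrA.
  have sym' : dot x (s (iter m N y)) = sg e' * sg mu ^+ m * dot y (s (iter m N x)).
    rewrite -top (structure_form_sym hs') GNi (compatible_exp (k := Antiaut) m hN').
    by rewrite -GNi top mulrA.
  have t0 : dot y (s (iter m N x)) != 0.
    by apply: contra_neq txy => h; rewrite sym h mulr0.
  have mu0 : sg mu ^+ m != 0 :> R by rewrite expf_neq0 ?sg_neq0.
  by apply: (mulIf mu0); apply: (mulIf t0); rewrite -sym -sym'.
(* As [s] is its own inverse up to the sign [e], this [B] expresses the pulled back form through the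
   original one. *)
pose B : 'End(V) := sg e *: (s \o (adjoint dot G \o (s' \o G)))%VF.
have BE x y : dot x (s (B y)) = dot (G x) (s' (G y)).
  rewrite scale_lfunE lfunZ !comp_lfunE hs.1 scalerA sgK scale1r.
  by rewrite -adjointE.
have nondeg u v : (forall x, dot x (s u) = dot x (s v)) -> u = v.
  move=> uv; apply/eqP; rewrite -subr_eq0; apply/eqP.
  apply: (structure_form_nondeg hs) => x.
  by rewrite lfunD lfunN dotDr dotNr uv subrr.
have mu0 := sg_neq0 R mu.
have BS y : B (S y) = S (B y).
  by apply: nondeg => x; apply: (mulfI mu0); rewrite -hS !BE GS -hS' GS.
have BN y : B (N y) = N (B y).
  by apply: nondeg => x; apply: (mulfI mu0); rewrite -hN !BE GN -hN' GN.
have Bself x y : dot (B x) (s y) = dot x (s (B y)).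
  rewrite (structure_form_sym hs) BE (structure_form_sym hs') -ee' BE.
  by rewrite mulrA sgK mul1r.
pose M : 'End(V) := B - \1%VF.
have ME x : M x = B x - x by rewrite add_lfunE opp_lfunE id_lfunE.
have BM x : B x = x + M x by rewrite ME addrC subrK.
have MN i x : M (iter i N x) = iter i N (M x).
  by elim: i => //= i <-; rewrite !ME BN lfunD lfunN.
have Mnil x : iter m.+1 M x = 0.
  (* [M] commutes with [N], and by [top] the map [N ^ m] kills the image of [M], which therefore
     lies in the image of [N]. So every application of [M] gains a factor [N]. *)
  suff H j : exists z, iter j M x = iter j N z by have [z ->] := H m.+1.
  elim: j => [|j [z zE]]; first by exists x.
  have /kerN /memv_imgP[w _ wE] : iter m N (M z) = 0.
    rewrite -MN ME; apply/eqP; rewrite subr_eq0; apply/eqP.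
    by apply: nondeg => y; rewrite BE top.
  by exists w; rewrite iterS zE MN wE -iterSr.
have [C gC CC] := unipotent_sqrt Mnil.
have MS x : S (M x) = M (S x) by rewrite !ME BS lfunD lfunN.
have MN1 x : N (M x) = M (N x) by rewrite (MN 1%N).
have CS x : C (S x) = S (C x) by rewrite (generated_commute MS gC).
have CN x : C (N x) = N (C x) by rewrite (generated_commute MN1 gC).
have Cself x y : dot (C x) (s y) = dot x (s (C y)).
  apply: generated_selfadjoint gC x y => x y.
  by rewrite !ME dotDl dotNl lfunD lfunN dotDr dotNr Bself.
have kerG : lker G == 0%VS.
  by rewrite -subv0; apply/subvP => x; rewrite memv_ker memv0 => /eqP/G0 ->.
have kerC : lker C == 0%VS.
  rewrite -subv0; apply/subvP => x; rewrite memv_ker memv0 => /eqP Cx.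
  apply/eqP/G0/(structure_form_nondeg hs') => y.
  rewrite -(lker0_lfunVK kerG y) -BE BM -CC Cx.
  by rewrite lfun0 lfun0 dot0r.
have CK := lker0_lfunK kerC; have CVK := lker0_lfunVK kerC.
have kerV : lker C^-1%VF == 0%VS.
  rewrite -subv0; apply/subvP => x; rewrite memv_ker memv0 => /eqP Cx.
  by rewrite -(CVK x) Cx lfun0.
exists (G \o C^-1)%VF; split.
- by rewrite limg_comp (lker0_limgf kerV) (lker0_limgf kerG).
- move=> x y _ _; rewrite !comp_lfunE => /(can_inj (lker0_lfunK kerG)).
  exact: (can_inj CVK).
- move=> x _; rewrite !add_lfunE !comp_lfunE lfunD.
  have CiS : C^-1%VF (S x) = S (C^-1%VF x).
    by apply: (can_inj CK); rewrite CVK CS CVK.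
  have CiN : C^-1%VF (N x) = N (C^-1%VF x).
    by apply: (can_inj CK); rewrite CVK CN CVK.
  by rewrite CiS CiN lfunD GS GN.
move=> x y _ _; rewrite !comp_lfunE -BE BM -CC -Cself CVK.
by rewrite CVK.
Qed.

End Equivalence.

(** * Classification on the reduced space *)

Section MatrixAlgebra.
Variable R : realType.
Implicit Types a b c d x y : R.

Lemma ord2P (P : 'I_2 -> Prop) : P 0 -> P 1 -> forall i, P i.
Proof. by move=> P0 P1; case=> [[|[|//]] h]; [move: P0|move: P1]; congr P; apply: val_inj. Qed.

Lemma sum2 (V : nmodType) (F : 'I_2 -> V) : \sum_i F i = F 0 + F 1.
Proof. by rewrite big_ord_recl big_ord1; congr (_ + F _); apply: val_inj. Qed.

Lemma mx22P (M : 'M[R]_2) : M = mx22 (M 0 0) (M 0 1) (M 1 0) (M 1 1).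
Proof. by apply/matrixP; apply: ord2P; apply: ord2P; rewrite mxE. Qed.

Lemma mx22E a b c d : (mx22 a b c d 0 0 = a) * (mx22 a b c d 0 1 = b)
  * (mx22 a b c d 1 0 = c) * (mx22 a b c d 1 1 = d).
Proof. by rewrite !mxE. Qed.

Lemma scalar22 a : a%:M = mx22 a 0 0 a.
Proof. by rewrite [LHS]mx22P !mxE. Qed.

Lemma mx22Z x a b c d : x *: mx22 a b c d = mx22 (x * a) (x * b) (x * c) (x * d).
Proof. by rewrite [LHS]mx22P !mxE. Qed.

Lemma mx22D a b c d a' b' c' d' :
  mx22 a b c d + mx22 a' b' c' d' = mx22 (a + a') (b + b') (c + c') (d + d').
Proof. by rewrite [LHS]mx22P !mxE. Qed.

Lemma mx22N a b c d : - mx22 a b c d = mx22 (- a) (- b) (- c) (- d).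
Proof. by rewrite [LHS]mx22P !mxE. Qed.

Lemma mx22T a b c d : (mx22 a b c d)^T = mx22 a c b d.
Proof. by rewrite [LHS]mx22P !mxE. Qed.

Lemma mx22M a b c d a' b' c' d' : mx22 a b c d *m mx22 a' b' c' d' =
  mx22 (a * a' + b * c') (a * b' + b * d') (c * a' + d * c') (c * b' + d * d').
Proof. by rewrite [LHS]mx22P !mxE !sum2 !mxE. Qed.

Lemma mxAE a b : mxA a b = mx22 a (- b) b a.
Proof. by rewrite /mxA /mxJ scalar22 !mx22Z mx22D !mulr1 !mulr0 !addr0 !add0r mulrN1. Qed.

Lemma zero22 : 0 = mx22 0 0 0 0 :> 'M[R]_2.
Proof. by rewrite [LHS]mx22P !mxE. Qed.

Lemma tr22 a b c d : \tr (mx22 a b c d) = a + d.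
Proof. by rewrite /mxtrace sum2 !mxE. Qed.

Lemma det22 a b c d : \det (mx22 a b c d) = a * d - b * c.
Proof.
by rewrite (expand_det_row _ 0) sum2 /cofactor !det_mx11 !mxE /= expr0 expr1; ring.
Qed.

End MatrixAlgebra.

Section Frames.
Variables (R : realType) (V : vectType R).
Implicit Types (f : 'End(V)) (z w : V).

Definition frame n f (M : 'M[R]_n) (b : 'I_n -> V) :=
  forall j, f (b j) = \sum_i M i j *: b i.

Definition pairv z w (i : 'I_2) : V := if i == 0 then z else w.

Definition joinv m n (x : 'I_m -> V) (y : 'I_n -> V) (i : 'I_(m + n)) : V :=
  match split i with inl j => x j | inr j => y j end.

Lemma joinv_l m n x y (i : 'I_m) : @joinv m n x y (lshift n i) = x i.
Proof. by rewrite /joinv (unsplitK (inl i)). Qed.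

Lemma joinv_r m n x y (i : 'I_n) : @joinv m n x y (rshift m i) = y i.
Proof. by rewrite /joinv (unsplitK (inr i)). Qed.

Lemma frame1 f z a : f z = a *: z -> frame f (a%:M : 'M_1) (fun=> z).
Proof. by move=> fz j; rewrite big_ord1 fz [j]ord1 !mxE eqxx. Qed.

Lemma frame_pair f z w a b c d : f z = a *: z + c *: w -> f w = b *: z + d *: w ->
  frame f (mx22 a b c d) (pairv z w).
Proof. by move=> fz fw; apply: ord2P; rewrite sum2 !mx22E. Qed.

Lemma frame_join m n f (A : 'M[R]_m) (B : 'M[R]_(m, n)) (C : 'M[R]_(n, m))
    (D : 'M[R]_n) (x : 'I_m -> V) (y : 'I_n -> V) :
  (forall j, f (x j) = \sum_i A i j *: x i + \sum_i C i j *: y i) ->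
  (forall j, f (y j) = \sum_i B i j *: x i + \sum_i D i j *: y i) ->
  frame f (block_mx A B C D) (joinv x y).
Proof.
move=> fx fy j; rewrite big_split_ord /=.
have h (G : 'I_m -> R) : \sum_i G i *: joinv x y (lshift n i) = \sum_i G i *: x i.
  by apply: eq_bigr => i _; rewrite joinv_l.
have h' (G : 'I_n -> R) : \sum_i G i *: joinv x y (rshift m i) = \sum_i G i *: y i.
  by apply: eq_bigr => i _; rewrite joinv_r.
rewrite h h'; case: (split_ordP j) => {}j ->; rewrite ?joinv_l ?joinv_r ?fx ?fy.
  by congr (_ + _); apply: eq_bigr => i _; rewrite ?block_mxEul ?block_mxEdl.
by congr (_ + _); apply: eq_bigr => i _; rewrite ?block_mxEur ?block_mxEdr.
Qed.

Definition independent n (b : 'I_n -> V) :=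
  forall c : 'I_n -> R, \sum_i c i *: b i = 0 -> forall i, c i = 0.

Lemma independent_pair z w :
  (forall a b, a *: z + b *: w = 0 -> a = 0 /\ b = 0) -> independent (pairv z w).
Proof.
by move=> h c; rewrite sum2 => /h[c0 c1]; apply: ord2P.
Qed.

Lemma independent_join (x y : 'I_2 -> V) :
  (forall a b c d, a *: x 0 + b *: x 1 + (c *: y 0 + d *: y 1) = 0 ->
     [/\ a = 0, b = 0, c = 0 & d = 0]) -> independent (joinv x y).
Proof.
move=> h c; rewrite big_split_ord !sum2 !joinv_l !joinv_r => /h[c0 c1 c2 c3] i.
by case: (split_ordP i) => {}i ->; move: i; apply: ord2P.
Qed.

Lemma complex_free (J : 'End(V)) z a b : (forall x, J (J x) = - x) -> z != 0 ->
  a *: z + b *: J z = 0 -> a = 0 /\ b = 0.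
Proof.
move=> JJ z0 h; have : (a ^+ 2 + b ^+ 2) *: z = 0.
  have -> : (a ^+ 2 + b ^+ 2) *: z = a *: (a *: z + b *: J z) - b *: J (a *: z + b *: J z).
    by rewrite lfunD !lfunZ JJ; vring.
  by rewrite h lfun0 !scaler0 subr0.
move/eqP; rewrite scaler_eq0 (negPf z0) orbF paddr_eq0 ?sqr_ge0 // !sqrf_eq0.
by case/andP => /eqP -> /eqP ->.
Qed.

(** [J] and [s] act as quaternion units; multiplying the combination by its conjugate yields the sum
    of squares. *)
Lemma quaternion_free (J s : 'End(V)) z a b c d :
  (forall x, J (J x) = - x) -> (forall x, s (s x) = - x) ->
  (forall x, J (s x) = - s (J x)) -> z != 0 ->
  a *: z + b *: J z + (c *: s z + d *: s (J z)) = 0 ->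
  [/\ a = 0, b = 0, c = 0 & d = 0].
Proof.
move=> JJ ss Js z0 h.
have : (a ^+ 2 + b ^+ 2 + c ^+ 2 + d ^+ 2) *: z = 0.
  pose u := a *: z + b *: J z + (c *: s z + d *: s (J z)).
  have -> : (a ^+ 2 + b ^+ 2 + c ^+ 2 + d ^+ 2) *: z =
      a *: u - b *: J u - c *: s u - d *: s (J u).
    by rewrite /u !(lfunD, lfunZ, Js, JJ, ss, lfunN); vring.
  by rewrite /u h !lfun0 !scaler0 !subr0.
move/eqP; rewrite scaler_eq0 (negPf z0) orbF.
rewrite !paddr_eq0 ?addr_ge0 ?sqr_ge0 // !sqrf_eq0.
by case/andP => /andP[/andP[/eqP -> /eqP ->] /eqP ->] /eqP ->.
Qed.

Lemma involution_eigenvector (h : 'End(V)) (U : {vspace V}) : (forall x, h (h x) = x) ->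
  invariant h U -> U != 0%VS ->
  exists z (e : sign), [/\ z \in U, z != 0 & h z = sg e *: z].
Proof.
move=> hh hU /neq0_vspace[x xU x0].
have [hx|hx] := eqVneq (x + h x) 0.
  exists x, Minus; split=> //; rewrite scaleN1r.
  by apply/eqP; rewrite -addr_eq0 addrC hx.
exists (x + h x), Plus; split=> //; first by rewrite memvD ?hU.
by rewrite lfunD hh scale1r addrC.
Qed.

End Frames.

(* The dimension of [Y_lambda]. *)
Definition form_dim (R : realType) (k : kind) (e mu : sign) (sp : spectrum R) : nat :=
  match sp with
  | Sreal _ => if e is Plus then 1%N else 2%N
  | Scomplex _ _ =>
      match k, e, mu with
      | Aut, Minus, Minus | Antiaut, Minus, Plus => 4%N
      | _, _, _ => 2%N
      end
  | Spair _ => 2%N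
  | Squad _ _ => 4%N
  end.

Lemma normal_form_structure (R : realType) k e mu n (S0 t0 : 'M[R]_n) :
  normal_form k e mu S0 t0 -> t0^T = sg e *: t0 /\ t0 *m t0 = sg e *: 1%:M.
Proof.
have sK m (d : sign) : (sg d)%:M^T = 1 *: (sg d)%:M :> 'M[R]_m /\
    (sg d)%:M *m (sg d)%:M = 1 *: 1%:M :> 'M[R]_m.
  by rewrite tr_scalar_mx -scalar_mxM sgK !scale1r.
have sK' m (d : sign) : (sg d *: 1%:M)^T = 1 *: (sg d *: 1%:M) :> 'M[R]_m /\
    (sg d *: 1%:M) *m (sg d *: 1%:M) = 1 *: 1%:M :> 'M[R]_m.
  by rewrite !scalemx1 tr_scalar_mx -scalar_mxM sgK scale1r.
have sJ (d : sign) : (sg d *: (mxJ R))^T = -1 *: (sg d *: (mxJ R)) /\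
    (sg d *: (mxJ R)) *m (sg d *: (mxJ R)) = -1 *: 1%:M :> 'M[R]_2.
  rewrite /mxJ !mx22Z mx22T mx22M !scalar22 mx22Z.
  by split; congr mx22; case: (d) => /=; ring.
have hJ : (mxJ R)^T = -1 *: (mxJ R) /\ (mxJ R) *m (mxJ R) = -1 *: 1%:M :> 'M[R]_2.
  by have := sJ Plus; rewrite /= !scale1r.
have hK (d : sign) : (mxK R d)^T = sg d *: mxK R d /\
    mxK R d *m mxK R d = sg d *: 1%:M :> 'M[R]_(2 + 2).
  rewrite /mxK tr_block_mx scale_block_mx mulmx_block !mulmx0 !mul0mx !addr0 !add0r.
  rewrite mulmx1 mul1mx linearZ /= !trmx0 !trmx1 !scaler0 scalerA sgK scale1r.
  by rewrite !scalemx1 -scalar_mx_block.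
have hR : (mxR R)^T = 1 *: (mxR R) /\ (mxR R) *m (mxR R) = 1 *: 1%:M :> 'M[R]_2.
  rewrite /mxR mx22T mx22M !scale1r scalar22; split; congr mx22; ring.
have hT : (mxT R)^T = 1 *: (mxT R) /\ (mxT R) *m (mxT R) = 1 *: 1%:M :> 'M[R]_2.
  rewrite /mxT mx22T mx22M !scale1r scalar22; split; congr mx22; ring.
by case.
Qed.

(** * Bases for automorphisms *)

Section ClassificationAut.
Variables (R : realType) (V : vectType R) (S s : 'End(V)) (e mu : sign).
Variables (sp : spectrum R) (U : {vspace V}).
Hypothesis ok : spectrum_ok mu sp.
Hypothesis hS : has_spectrum S sp.
Hypothesis ss : forall x, s (s x) = sg e *: x.
Hypothesis Ss : forall x, S (s x) = sg mu *: s (S x).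
Hypothesis SU : invariant S U.
Hypothesis sU : invariant s U.
Hypothesis U0 : U != 0%VS.

Lemma semilinear_frame a b (J : 'End(V)) z : mu = Minus ->
  S z = a *: z + b *: J z -> S (J z) = (- b) *: z + a *: J z ->
  frame S (diag2 (mxA a b) (- mxA a b)) (joinv (pairv z (J z)) (pairv (s z) (s (J z))))
  /\ frame s (mxK R e) (joinv (pairv z (J z)) (pairv (s z) (s (J z)))).
Proof.
move=> muM Sz SJz; split; apply: frame_join; apply: ord2P;
  rewrite !sum2 /pairv /= ?mxAE ?mx22N ?zero22 ?scalar22 ?mx22Z ?mx22E.
- by rewrite Sz; vring.
- by rewrite SJz; vring.
- by rewrite Ss muM /= Sz !(lfunD, lfunZ); vring.
- by rewrite Ss muM /= SJz !(lfunD, lfunZ); vring.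
- by vring.
- by vring.
- by rewrite ss; vring.
by rewrite ss; vring.
Qed.

Lemma normal_form_aut : exists n (S0 t0 : 'M[R]_n) (b : 'I_n -> V),
  [/\ n = form_dim Aut e mu sp, normal_form Aut e mu S0 t0,
      forall i, b i \in U, frame S S0 b /\ frame s t0 b & independent b].
Proof.
have muP_or : mu = Plus \/ mu = Minus by case: (mu); [left|right].
have [y0 y0U y0_neq0] := neq0_vspace U0.
have eP_or : e = Plus \/ e = Minus by case: (e); [left|right].
have sInv : e = Plus -> forall x, s (s x) = x by move=> eP x; rewrite ss eP scale1r.
have sCpx : e = Minus -> forall x, s (s x) = - x by move=> eM x; rewrite ss eM scaleN1r.
have indep1 z : z != 0 -> independent (fun _ : 'I_1 => z).
  move=> z0 c; rewrite big_ord1 => /eqP; rewrite scaler_eq0 (negPf z0) orbF => /eqP c0 i.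
  by rewrite (ord1 i).
move: ok hS; case: sp => [a|a b|a|a b] ok' hS'.
- have Sa := hS'; case: eP_or => eE.
    have [z [d [zU z0 sz]]] := involution_eigenvector (sInv eE) sU U0.
    exists 1%N; case: muP_or => muE.
      exists a%:M, (sg d)%:M, (fun=> z); rewrite eE muE; split=> //.
      + exact: nf1_real.
      + by split; apply: frame1; rewrite // Sa.
      exact: indep1.
    have a0 : a = 0 by move: ok'; rewrite /= muE => -[].
    exists 0, (sg d)%:M, (fun=> z); rewrite eE muE; split=> //.
    + exact: nf2_zero.
    + split; last exact: frame1.
      by rewrite -[0](scale0r 1%:M) scalemx1; apply: frame1; rewrite Sa a0.
    exact: indep1.
  have free2 : independent (pairv y0 (s y0)).
    by apply: independent_pair => c d; apply: complex_free => //; apply: sCpx.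
  have inU i : pairv y0 (s y0) i \in U by move: i; apply: ord2P => //; apply: sU.
  exists 2%N; case: muP_or => muE.
    exists (mxA a 0), (sg Plus *: (mxJ R)), (pairv y0 (s y0)); rewrite eE muE; split=> //.
    + exact: nf3.
    + rewrite mxAE /mxJ mx22Z; split; apply: frame_pair; rewrite ?Sa ?sCpx //=; vring.
  have a0 : a = 0 by move: ok'; rewrite /= muE => -[].
  (* The value [a = 0] of the entry with eigenvalues [+-a]. *)
  exists (mx22 0 0 0 (- 0)), (mxJ R), (pairv y0 (s y0)); rewrite eE muE; split=> //.
  + exact: nf4_real.
  by split; apply: frame_pair; rewrite ?Sa ?sCpx ?a0 //=; vring.
- case: ok' => b0 hmu; have [J [JE JJ SE]] := complex_unit b0 hS'.
  have JU : invariant J U.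
    move=> x xU; rewrite JE !(scale_lfunE, add_lfunE, id_lfunE).
    by rewrite memvZ // memvD ?SU // memvZ.
  have Js x : J (s x) = sg mu *: s (J x).
    rewrite JE !(scale_lfunE, add_lfunE, id_lfunE) !(lfunD, lfunZ) Ss.
    by case: hmu => ->; [case: (mu) |]; rewrite ?oppr0 ?scale0r /=; vring.
  have SJ x : S (J x) = (- b) *: x + a *: J x by rewrite SE JJ; vring.
  have Jframe z : frame S (mxA a b) (pairv z (J z)).
    by rewrite mxAE; apply: frame_pair; rewrite ?SE ?JJ //; vring.
  have Jindep z : z != 0 -> independent (pairv z (J z)).
    by move=> z0; apply: independent_pair => c d; apply: complex_free.
  have JinU z : z \in U -> forall i, pairv z (J z) i \in U.
    by move=> zU; apply: ord2P => //; apply: JU.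
  case: muP_or => muE; case: eP_or => eE; rewrite muE eE /=.
  + have [z [d [zU z0 sz]]] := involution_eigenvector (sInv eE) sU U0.
    exists 2%N, (mxA a b), (sg d *: 1%:M), (pairv z (J z)); split=> //.
    * exact: nf1_complex.
    * exact: JinU.
    * split=> //; rewrite scalar22 mx22Z; apply: frame_pair.
        by rewrite sz; vring.
      have -> : s (J z) = J (s z) by rewrite Js muE scale1r.
      by rewrite sz lfunZ; vring.
    exact: Jindep.
  (* [s] and [J] commute and both square to [-1], so [s \o J] is an involution. On its eigenspace
     for [d] the map [s] is [- d J], which reverses the sign. *)
  + have sJ2 x : (s \o J)%VF ((s \o J)%VF x) = x.
      by rewrite !comp_lfunE Js muE scale1r JJ !lfunN sCpx // opprK.
    have sJU : invariant (s \o J)%VF U by move=> x xU; rewrite comp_lfunE sU ?JU.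
    have [z [d [zU z0]]] := involution_eigenvector sJ2 sJU U0.
    rewrite comp_lfunE => sJz; have sz : s z = (- sg d) *: J z.
      have sJJ : s (J (J z)) = J (s (J z)) by rewrite [in RHS]Js muE scale1r.
      by rewrite -[s z]opprK -lfunN -JJ sJJ sJz lfunZ scaleNr.
    exists 2%N, (mxA a b), (sg (if d is Plus then Minus else Plus) *: (mxJ R)), (pairv z (J z)).
    have sgN : sg (if d is Plus then Minus else Plus) = - sg d :> R.
      by case: (d); rewrite //= opprK.
    split=> //.
    * by apply: nf3 => [|b00]; [apply: ltW|rewrite b00 ltxx in b0].
    * exact: JinU.
    * split=> //; rewrite sgN /mxJ mx22Z; apply: frame_pair.
        by rewrite sz; vring.
      by rewrite sJz; vring.
    exact: Jindep.
  + have a0 : a = 0 by move: hmu; rewrite muE => -[].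
    (* [J] anticommutes with [s] and exchanges its eigenspaces, so the eigenvalue can be chosen and
       no sign appears. *)
    have [z [zU z0 sz]] : exists z, [/\ z \in U, z != 0 & s z = z].
      have [z [[] [zU z0 sz]]] := involution_eigenvector (sInv eE) sU U0.
        by exists z; rewrite sz scale1r.
      exists (J z); split; first exact: JU.
        by apply: contra_neq z0 => Jz; apply: oppr_inj; rewrite -JJ Jz lfun0 oppr0.
      have -> : s (J z) = - J (s z) by rewrite Js muE scaleN1r opprK.
      by rewrite sz scaleN1r lfunN opprK.
    exists 2%N, (b *: (mxJ R)), (mxR R), (pairv z (J z)); split=> //.
    * exact: nf2_imaginary.
    * exact: JinU.
    * split; first by have := Jframe z; rewrite /mxA a0 scale0r add0r.
      rewrite /mxR; apply: frame_pair; first by rewrite sz; vring.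
      have -> : s (J z) = - J (s z) by rewrite Js muE scaleN1r opprK.
      by rewrite sz; vring.
    exact: Jindep.
  have a0 : a = 0 by move: hmu; rewrite muE => -[].
  (* [J] and [s] are anticommuting complex structures, so each nonzero vector generates four
     dimensions. This is the entry with [a = 0]. *)
  have [fS fs] := semilinear_frame muE (SE y0) (SJ y0).
  exists (2 + 2)%N, (diag2 (mxA a b) (- mxA a b)), (mxK R Minus),
    (joinv (pairv y0 (J y0)) (pairv (s y0) (s (J y0)))); split=> //.
  + by apply: nf4_complex; rewrite // a0.
  + move=> i; case: (split_ordP i) => j ->; rewrite ?joinv_l ?joinv_r; move: j.
      exact: JinU y0U.
    by apply: ord2P; rewrite /pairv /=; apply: sU => //; apply: JU.
  + by split=> //; rewrite -eE.
  apply: independent_join => c1 c2 d1 d2; apply: quaternion_free => // x; first exact: sCpx.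
  by rewrite Js muE scaleN1r.
- case: ok' => a0 muE; have [E [EE E2 SE]] := pair_unit a0 hS'.
  have Es x : E (s x) = - s (E x).
    by rewrite EE !scale_lfunE lfunZ Ss muE scaleN1r scalerN.
  have EU : invariant E U by move=> x xU; rewrite EE scale_lfunE memvZ ?SU.
  have s_neq0 z : z != 0 -> s z != 0.
    apply: contra_neq => sz; apply/eqP; have /eqP := ss z.
    by rewrite sz lfun0 eq_sym scaler_eq0 (negPf (sg_neq0 R e)).
  (* [s] exchanges the two eigenspaces of [E], so the eigenvalue [1] occurs. *)
  have [z [zU z0 Ez]] : exists z, [/\ z \in U, z != 0 & E z = z].
    have [z [[] [zU z0 Ez]]] := involution_eigenvector E2 EU U0.
      by exists z; rewrite Ez scale1r.
    exists (s z); rewrite sU ?s_neq0 //; split=> //.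
    by rewrite Es Ez scaleN1r lfunN opprK.
  have Esz : E (s z) = - s z by rewrite Es Ez.
  have fS : frame S (mx22 a 0 0 (- a)) (pairv z (s z)).
    by apply: frame_pair; rewrite SE ?Ez ?Esz; vring.
  have free2 : independent (pairv z (s z)).
    apply: independent_pair => c d h.
    have := congr1 E h; rewrite lfunD !lfunZ Ez Esz lfun0 => h'.
    have c0 : (2 * c) *: z = 0.
      by rewrite -[RHS](addr0 0) -{1}h -h'; vring.
    have d0 : (2 * d) *: s z = 0.
      by rewrite -[RHS](subr0 0) -{1}h -h'; vring.
    move/eqP: c0; move/eqP: d0; rewrite !scaler_eq0 (negPf z0) (negPf (s_neq0 _ z0)).
    by rewrite !orbF !mulf_eq0 pnatr_eq0 /= => /eqP -> /eqP ->.
  have inU i : pairv z (s z) i \in U by move: i; apply: ord2P => //; apply: sU.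
  exists 2%N, (mx22 a 0 0 (- a)); case: eP_or => eE; rewrite eE muE.
    exists (mxT R), (pairv z (s z)); split=> //; first exact: nf2_real.
    by split=> //; apply: frame_pair; rewrite ?sInv //; vring.
  exists (mxJ R), (pairv z (s z)); split=> //; first by apply: nf4_real; apply: ltW.
  by split=> //; apply: frame_pair; rewrite ?sCpx //; vring.
case: ok' => a0 b0 muE.
have [E [J [F [gJ [gF EF] JJ [E2 EJ] SE]]]] := quad_units a0 b0 hS'.
have SSs x : (S \o S)%VF (s x) = s ((S \o S)%VF x).
  by rewrite !comp_lfunE Ss lfunZ Ss muE scalerA mulrNN mulr1 scale1r.
have Js x : J (s x) = s (J x).
  by rewrite (generated_commute _ gJ) // => y; rewrite SSs.
have Fs x : F (s x) = s (F x).
  by rewrite (generated_commute _ gF) // => y; rewrite SSs.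
have Es x : E (s x) = - s (E x) by rewrite EF !comp_lfunE Fs Ss muE scaleN1r.
have S2U : invariant (S \o S)%VF U by move=> x xU; rewrite comp_lfunE !SU.
have JU := generated_stable S2U gJ.
have EU : invariant E U.
  by move=> x xU; rewrite EF comp_lfunE SU // (generated_stable S2U gF).
have s_neq0 z : z != 0 -> s z != 0.
  apply: contra_neq => sz; apply/eqP; have /eqP := ss z.
  by rewrite sz lfun0 eq_sym scaler_eq0 (negPf (sg_neq0 R e)).
have [z [zU z0 Ez]] : exists z, [/\ z \in U, z != 0 & E z = z].
  have [z [[] [zU z0 Ez]]] := involution_eigenvector E2 EU U0.
    by exists z; rewrite Ez scale1r.
  exists (s z); rewrite sU ?s_neq0 //; split=> //.
  by rewrite Es Ez scaleN1r lfunN opprK.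
have Sz : S z = a *: z + b *: J z by rewrite SE lfunD !lfunZ EJ Ez.
have SJz : S (J z) = (- b) *: z + a *: J z.
  by rewrite SE lfunD !lfunZ !EJ Ez JJ; vring.
have [fS fs] := semilinear_frame muE Sz SJz.
pose bas := joinv (pairv z (J z)) (pairv (s z) (s (J z))).
have inU i : bas i \in U.
  rewrite /bas; case: (split_ordP i) => j ->; rewrite ?joinv_l ?joinv_r; move: j;
  by apply: ord2P; rewrite /pairv /= ?sU ?JU.
have free4 : independent bas.
  apply: independent_join => c1 c2 d1 d2; rewrite /pairv /= => h.
  (* [E] separates the two halves: [u] lies in its eigenspace for [1] and [s v] in that for [-1]. *)
  pose u := c1 *: z + c2 *: J z; pose v := d1 *: z + d2 *: J z.
  have uv : u + s v = 0 by rewrite -h /v lfunD !lfunZ.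
  have Eu : E u = u by rewrite lfunD !lfunZ EJ Ez.
  have Ev : E v = v by rewrite lfunD !lfunZ EJ Ez.
  have uv' : u - s v = 0 by have := congr1 E uv; rewrite lfunD Es Ev Eu lfun0.
  have u0 : 2 *: u = 0 by rewrite -[RHS](addr0 0) -{1}uv -uv'; vring.
  have v0 : 2 *: s v = 0 by rewrite -[RHS](subr0 0) -{1}uv -uv'; vring.
  move/eqP: u0; rewrite scaler_eq0 pnatr_eq0 => /eqP/(complex_free JJ z0)[-> ->].
  move/eqP: v0; rewrite scaler_eq0 pnatr_eq0 => /eqP sv.
  have /eqP := ss v; rewrite sv lfun0 eq_sym scaler_eq0 (negPf (sg_neq0 R e)).
  by move=> /eqP/(complex_free JJ z0)[-> ->].
exists (2 + 2)%N, (diag2 (mxA a b) (- mxA a b)), (mxK R e), bas.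
have nf : normal_form Aut e mu (diag2 (mxA a b) (- mxA a b)) (mxK R e).
  rewrite muE; case: eP_or => ->; first exact: nf2_complex.
  by apply: nf4_complex => //; apply: ltW.
by split.
Qed.

End ClassificationAut.

Section RealNumbers.
Variable R : realType.

Lemma complex_square_root (u v : R) : exists c d : R, c ^+ 2 - d ^+ 2 = u /\ 2 * c * d = v.
Proof.
have := sqr_sqrtc (u +i* v)%C; case: (sqrtc _) => c d; rewrite expr2.
by case=> hu hv; exists c, d; rewrite -hu -hv; split; ring.
Qed.

Lemma scale_to_sign (p : R) : p != 0 -> exists c (d : sign), c ^+ 2 * p = sg d.
Proof.
move=> p0; have p0' : 0 < `|p| by rewrite normr_gt0.
exists (Num.sqrt `|p|)^-1; rewrite exprVn sqr_sqrtr ?ltW //.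
have [pp|pn|p00] := ltgtP p 0; last by rewrite p00 eqxx in p0.
  by exists Minus; rewrite ltr0_norm // invrN mulNr mulVf.
by exists Plus; rewrite gtr0_norm // mulVf.
Qed.

End RealNumbers.

(** * Bases for anti-automorphisms *)

Section ClassificationAntiaut.
Variables (R : realType) (V : vectType R) (dot : {dot V for @idfun R}).
Variables (S f : 'End(V)) (e mu : sign) (sp : spectrum R) (U : {vspace V}).
Local Notation B x y := (dot x (f y)).
Hypothesis ok : spectrum_ok mu sp.
Hypothesis hS : has_spectrum S sp.
Hypothesis Bsym : forall x y, B x y = sg e * B y x.
Hypothesis BS : forall x y, B (S x) y = sg mu * B x (S y).
Hypothesis SU : invariant S U.
Hypothesis Bnd : forall y, y \in U -> (forall x, x \in U -> B x y = 0) -> y = 0.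
Hypothesis U0 : U != 0%VS.

Let BE := (dotDl, dotDr, dotNl, dotNr, dotZl, dotZr, @lfunD R V V, @lfunN R V V,
           @lfunZ R V V).

Definition gram n (t0 : 'M[R]_n) (b : 'I_n -> V) := forall i j, B (b i) (b j) = t0 i j.

Lemma gram_pair z w a b c d : B z z = a -> B z w = b -> B w z = c -> B w w = d ->
  gram (mx22 a b c d) (pairv z w).
Proof. by move=> h1 h2 h3 h4; apply: ord2P; apply: ord2P; rewrite mx22E. Qed.

Lemma gram_join m n (t1 : 'M[R]_m) (t2 : 'M[R]_(m, n)) (t3 : 'M[R]_(n, m))
    (t4 : 'M[R]_n) (x : 'I_m -> V) (y : 'I_n -> V) :
  (forall i j, B (x i) (x j) = t1 i j) -> (forall i j, B (x i) (y j) = t2 i j) ->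
  (forall i j, B (y i) (x j) = t3 i j) -> (forall i j, B (y i) (y j) = t4 i j) ->
  gram (block_mx t1 t2 t3 t4) (joinv x y).
Proof.
move=> h1 h2 h3 h4 i j.
case: (split_ordP i) => {}i ->; case: (split_ordP j) => {}j ->;
  by rewrite ?joinv_l ?joinv_r ?block_mxEul ?block_mxEur ?block_mxEdl ?block_mxEdr.
Qed.

Lemma exists_pairing z : z \in U -> z != 0 -> exists2 w, w \in U & B w z != 0.
Proof.
move=> zU z0; apply: contrapT => h; case/eqP: z0; apply: Bnd => // x xU.
by apply: contrapT => /eqP xz; apply: h; exists x.
Qed.

(** Polarization of the symmetric form [B x (g y)]. *)
Lemma exists_anisotropic (g : 'End(V)) : (forall x y, B x (g y) = B y (g x)) ->
  (exists x y, [/\ x \in U, y \in U & B x (g y) != 0]) ->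
  exists2 z, z \in U & B z (g z) != 0.
Proof.
move=> gsym [x [y [xU yU xy]]]; apply: contrapT => h.
have h0 z : z \in U -> B z (g z) = 0.
  by move=> zU; apply: contrapT => /eqP zz; apply: h; exists z.
have := h0 _ (memvD xU yU); rewrite !BE !h0 // add0r addr0 (gsym y x) -mulr2n.
by move/eqP; rewrite mulrn_eq0 (negPf xy).
Qed.

(** As [J] is selfadjoint, [B x y - i B x (J y)] is complex bilinear, and [c + i d] is the inverse
    of its value at [w] and [z]. The last basis vector is [- J v] because
    [B (J x) (J y) = - B x y]. *)
Lemma hyperbolic_frame (J : 'End(V)) z w a b :
  (forall x, J (J x) = - x) -> (forall x y, B (J x) y = B x (J y)) ->
  B z z = 0 -> B z (J z) = 0 -> B w w = 0 -> B w (J w) = 0 -> B w z != 0 ->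
  S z = a *: z + b *: J z -> S (J z) = (- b) *: z + a *: J z ->
  S w = sg mu *: (a *: w + b *: J w) -> S (J w) = sg mu *: (a *: J w - b *: w) ->
  invariant J U -> z \in U -> w \in U ->
  exists bas : 'I_(2 + 2) -> V, [/\ forall i, bas i \in U,
    frame S (diag2 (mxA a b) (sg mu *: (mxA a b)^T)) bas & gram (mxK R e) bas].
Proof.
move=> JJ BJ zz zJz ww wJw wz Sz SJz Sw SJw JU zU wU.
pose p := B w z; pose q := B w (J z).
have r0 : p ^+ 2 + q ^+ 2 != 0.
  by rewrite gt_eqF // ltr_pwDl ?sqr_ge0 // lt0r sqr_ge0 sqrf_eq0 wz.
pose c := p / (p ^+ 2 + q ^+ 2); pose d := q / (p ^+ 2 + q ^+ 2).
pose v := c *: w + d *: J w.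
have Jv : J v = c *: J w - d *: w by rewrite !BE JJ scalerN.
have vz : B v z = 1 by rewrite !BE BJ -/p -/q /c /d; field.
have vJz : B v (J z) = 0.
  by rewrite !BE BJ JJ !BE -/p -/q /c /d; field.
have vv : B v v = 0 by rewrite !BE !BJ !JJ !BE wJw ww; ring.
have vJv : B v (J v) = 0 by rewrite Jv !BE !BJ !JJ !BE wJw ww; ring.
have vU : v \in U by rewrite memvD ?memvZ ?JU.
have Sv : S v = sg mu *: (a *: v + b *: J v).
  by rewrite Jv !BE Sw SJw; vring.
have SJv : S (J v) = sg mu *: (a *: J v - b *: v).
  by rewrite Jv !BE Sw SJw; vring.
exists (joinv (pairv z (J z)) (pairv v (- J v))); split.
- move=> i; case: (split_ordP i) => j ->; rewrite ?joinv_l ?joinv_r; move: j;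
    by apply: ord2P; rewrite /pairv /= ?memvN ?JU.
- apply: frame_join; apply: ord2P;
    rewrite !sum2 /pairv /= ?mxAE ?mx22T ?mx22N ?zero22 ?scalar22 ?mx22Z ?mx22E.
  + by rewrite Sz; vring.
  + by rewrite SJz; vring.
  + by rewrite Sv; vring.
  by rewrite lfunN SJv; vring.
have zv : B z v = sg e by rewrite Bsym vz mulr1.
have zJv : B z (J v) = 0 by rewrite -BJ Bsym vJz mulr0.
clearbody v.
by apply: gram_join; apply: ord2P; apply: ord2P;
  rewrite /pairv /= ?zero22 ?scalar22 ?mx22Z ?mx22E ?BE ?BJ ?JJ ?BE ?zz ?zJz ?vv ?vJv
    ?vz ?vJz ?zv ?zJv ?oppr0 ?opprK ?mulr0 ?mulr1.
Qed.

Lemma semilinear_adjoint (J : 'End(V)) a b : b != 0 ->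
  J = b^-1 *: (S + (- a) *: \1%VF) -> mu = Plus \/ a = 0 ->
  forall x y, B (J x) y = sg mu * B x (J y).
Proof.
move=> b0 -> hmu x y; rewrite !(scale_lfunE, add_lfunE, id_lfunE) !BE BS.
by case: hmu => ->; [case: (mu)|]; rewrite /=; ring.
Qed.

(** The eigenspaces of [E] are isotropic, so the form pairs one with the other. As [y] is half the
    sum of [y + E y] and [y - E y], the vector [w] pairs nontrivially with one of these, and only
    its component in the opposite eigenspace contributes. *)
Lemma lagrangian_pair (E : 'End(V)) : (forall x, E (E x) = x) ->
  (forall x y, B (E x) y = - B x (E y)) -> invariant E U ->
  exists z w, [/\ z \in U, w \in U, E z = z, E w = - w & B w z != 0].
Proof.
move=> EE BE' EU; have [y yU y_neq0] := neq0_vspace U0.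
have [w wU wy] := exists_pairing yU y_neq0.
have Ep x : E (x + E x) = x + E x by rewrite lfunD EE addrC.
have Em x : E (x - E x) = - (x - E x) by rewrite lfunD lfunN EE opprB addrC.
have two : 2 != 0 :> R by rewrite pnatr_eq0.
have [wz|wz] := eqVneq (B w (y + E y)) 0; last first.
  exists (y + E y), (w - E w); split; rewrite ?Ep ?Em ?memvB ?memvD ?EU //.
  have -> : B (w - E w) (y + E y) = 2 * B w (y + E y).
    by rewrite dotDl dotNl BE' Ep; ring.
  by rewrite mulf_neq0.
have wz' : B w (y - E y) != 0.
  apply: contra_neq wy => wz'; apply: (mulfI two); rewrite mulr0.
  transitivity (B w (y + E y) + B w (y - E y)); last by rewrite wz wz' addr0.
  by rewrite !BE; ring.
exists (w + E w), (y - E y); split; rewrite ?Ep ?Em ?memvB ?memvD ?EU //.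
rewrite Bsym mulf_neq0 ?sg_neq0 //.
have -> : B (w + E w) (y - E y) = 2 * B w (y - E y).
  by rewrite dotDl BE' Em lfunN dotNr; ring.
by rewrite mulf_neq0.
Qed.

Lemma isotropic_eigenspace (E : 'End(V)) z w c : (forall x y, B (E x) y = - B x (E y)) ->
  c * c = 1 -> E z = c *: z -> E w = c *: w -> B z w = 0.
Proof.
move=> BE' cc Ez Ew.
have c0 : c != 0 by apply: contra_eq_neq cc => ->; rewrite mulr0 eq_sym oner_eq0.
have /eqP : c * B z w = - (c * B z w).
  by rewrite -{1}dotZl -Ez BE' Ew lfunZ dotZr.
by rewrite -addr_eq0 -mulr2n mulrn_eq0 mulf_eq0 (negPf c0) => /eqP.
Qed.

Lemma normal_form_antiaut : exists n (S0 t0 : 'M[R]_n) (b : 'I_n -> V),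
  [/\ n = form_dim Antiaut e mu sp, normal_form Antiaut e mu S0 t0,
      forall i, b i \in U & frame S S0 b /\ gram t0 b].
Proof.
have muP_or : mu = Plus \/ mu = Minus by case: (mu); [left|right].
have eP_or : e = Plus \/ e = Minus by case: (e); [left|right].
have [y0 y0U y0_neq0] := neq0_vspace U0.
have [w0 w0U w0y0] := exists_pairing y0U y0_neq0.
have sym0 : e = Plus -> forall x y, B x y = B y x by move=> eP x y; rewrite Bsym eP mul1r.
have skew0 : e = Minus -> forall x y, B x y = - B y x by move=> eM x y; rewrite Bsym eM mulN1r.
have alt0 : e = Minus -> forall x, B x x = 0.
  move=> eM x; have := skew0 eM x x => /eqP; rewrite -addr_eq0 -mulr2n mulrn_eq0.
  by move/eqP.
have unit_vector : e = Plus -> exists z (d : sign), z \in U /\ B z z = sg d.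
  move=> eP; have [||z zU zz] := @exists_anisotropic \1%VF.
  - by move=> x y; rewrite !id_lfunE sym0.
  - by exists w0, y0; rewrite id_lfunE.
  rewrite id_lfunE in zz; have [c [d cd]] := scale_to_sign zz.
  by exists (c *: z), d; rewrite memvZ //; split=> //; rewrite !BE mulrA -expr2.
move: ok hS; case: sp => [a|a b|a|a b] ok' hS'.
- have Sa := hS'; case: eP_or => eE.
    have [z [d [zU zz]]] := unit_vector eE.
    have gr : gram ((sg d)%:M : 'M_1) (fun=> z).
      by move=> i j; rewrite (ord1 i) (ord1 j) mxE eqxx.
    exists 1%N; case: muP_or => muE.
      exists a%:M, (sg d)%:M, (fun=> z); rewrite eE muE; split=> //.
        exact: nf5_real.
      by split=> //; apply: frame1.
    have a0 : a = 0 by move: ok'; rewrite /= muE => -[].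
    exists 0, (sg d)%:M, (fun=> z); rewrite eE muE; split=> //.
      exact: nf6_zero.
    by split=> //; rewrite -[0](scale0r 1%:M) scalemx1; apply: frame1; rewrite Sa a0.
  pose w := (B w0 y0)^-1 *: w0.
  have wy : B w y0 = 1 by rewrite !BE mulVf.
  have yw : B y0 w = - 1 by rewrite skew0 // wy.
  have gr : gram (mxJ R) (pairv y0 w).
    by apply: gram_pair; rewrite ?alt0.
  have inU i : pairv y0 w i \in U.
    by move: i; apply: ord2P; rewrite /pairv //= memvZ.
  exists 2%N; case: muP_or => muE; rewrite eE muE.
    exists (a *: 1%:M), (mxJ R), (pairv y0 w); split=> //; first exact: nf7_real.
    by split=> //; rewrite scalar22 mx22Z; apply: frame_pair; rewrite Sa; vring.
  have a0 : a = 0 by move: ok'; rewrite /= muE => -[].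
  exists (mx22 0 0 0 (- 0)), (mxJ R), (pairv y0 w); split=> //; first exact: nf8_real.
  by split=> //; apply: frame_pair; rewrite Sa a0; vring.
- case: ok' => b0 hmu; have [J [JE JJ SE]] := complex_unit b0 hS'.
  have bn : b != 0 by rewrite gt_eqF.
  have JU : invariant J U.
    move=> x xU; rewrite JE !(scale_lfunE, add_lfunE, id_lfunE).
    by rewrite memvZ // memvD ?SU // memvZ.
  have BJ := semilinear_adjoint bn JE hmu.
  have SJ x : S (J x) = (- b) *: x + a *: J x by rewrite SE JJ; vring.
  have Jframe z : frame S (mxA a b) (pairv z (J z)).
    by rewrite mxAE; apply: frame_pair; rewrite ?SE ?JJ //; vring.
  have JinU z : z \in U -> forall i, pairv z (J z) i \in U.
    by move=> zU; apply: ord2P => //; apply: JU.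
  case: muP_or => muE; case: eP_or => eE; rewrite muE eE /=.
  + have BJ' x y : B (J x) y = B x (J y) by rewrite BJ muE mul1r.
    have [||z zU zz] := @exists_anisotropic \1%VF.
    * by move=> x y; rewrite !id_lfunE sym0.
    * by exists w0, y0; rewrite id_lfunE.
    rewrite id_lfunE in zz; pose p := B z z; pose q := B z (J z).
    have r0 : p ^+ 2 + q ^+ 2 != 0.
      by rewrite gt_eqF // ltr_pwDl ?sqr_ge0 // lt0r sqr_ge0 sqrf_eq0 zz.
    (* The complex bilinear form [B x y - i B x (J y)] has the nonzero value [p - i q] at [z].
       Complex numbers have square roots, so it can be scaled to [1] and no sign remains. *)
    have [c [d [cd1 cd2]]] := complex_square_root (p / (p ^+ 2 + q ^+ 2))
      (q / (p ^+ 2 + q ^+ 2)).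
    pose v := c *: z + d *: J z.
    have Jv : J v = c *: J z - d *: z by rewrite !BE JJ scalerN.
    have vv : B v v = 1.
      transitivity ((c ^+ 2 - d ^+ 2) * p + 2 * c * d * q).
        by rewrite !BE !BJ' !JJ !BE -/p -/q; ring.
      by rewrite cd1 cd2; field.
    have vJv : B v (J v) = 0.
      transitivity ((c ^+ 2 - d ^+ 2) * q - 2 * c * d * p).
        by rewrite Jv !BE !BJ' !JJ !BE -/p -/q; ring.
      by rewrite cd1 cd2; field.
    have vU : v \in U by rewrite memvD ?memvZ ?JU.
    clearbody v; exists 2%N, (mxA a b), (mxR R), (pairv v (J v)); split=> //.
    * exact: nf5_complex.
    * exact: JinU.
    by split=> //; apply: gram_pair; rewrite ?BJ' ?JJ ?vJv // !BE vv.
  + have BJ' x y : B (J x) y = B x (J y) by rewrite BJ muE mul1r.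
    (* The complex bilinear form is alternating together with [B], so each complex line is isotropic
       and a second one is needed. *)
    have zJz z : B z (J z) = 0.
      have /eqP := skew0 eE (J z) z; rewrite BJ' -addr_eq0 -mulr2n mulrn_eq0.
      by move/eqP.
    have Sw w : S w = sg mu *: (a *: w + b *: J w) by rewrite muE scale1r.
    have SJw w : S (J w) = sg mu *: (a *: J w - b *: w).
      by rewrite SJ muE scale1r; vring.
    have [bas [basU fS gr]] := hyperbolic_frame JJ BJ' (alt0 eE y0) (zJz y0)
      (alt0 eE w0) (zJz w0) w0y0 (SE y0) (SJ y0) (Sw w0) (SJw w0) JU y0U w0U.
    exists (2 + 2)%N, (diag2 (mxA a b) (mxA a b)^T), (mxK R Minus), bas; split=> //.
    * exact: nf7_complex.
    by rewrite -eE; split=> //; move: fS; rewrite muE scale1r.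
  + have BJ' x y : B (J x) y = - B x (J y) by rewrite BJ muE mulN1r.
    have a0 : a = 0 by move: hmu; rewrite muE => -[].
    (* Here [B (J x) (J y) = B x y], as for a Hermitian form: a complex factor changes [B z z] by a
       positive number, so its sign survives. *)
    have [z [d [zU zz]]] := unit_vector eE.
    have zJz : B z (J z) = 0.
      have /eqP := sym0 eE (J z) z; rewrite BJ' eq_sym -addr_eq0 -mulr2n mulrn_eq0.
      by move/eqP.
    exists 2%N, (b *: mxJ R), (sg d *: 1%:M), (pairv z (J z)); split=> //.
    * exact: nf6_imaginary.
    * exact: JinU.
    split; first by have := Jframe z; rewrite /mxA a0 scale0r add0r.
    rewrite scalar22 mx22Z; apply: gram_pair; rewrite ?BJ' ?JJ ?zJz ?zz ?mulr1 ?mulr0 ?oppr0 //.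
    by rewrite !BE zz opprK.
  have BJ' x y : B (J x) y = - B x (J y) by rewrite BJ muE mulN1r.
  have a0 : a = 0 by move: hmu; rewrite muE => -[].
  (* [B] is alternating, but [B x (J y)] is symmetric and nonzero, and it supplies the sign. *)
  have [||z zU zz] := @exists_anisotropic J.
  + by move=> x y; rewrite skew0 // BJ' opprK.
  + exists w0, (- J y0); rewrite memvN JU //; split=> //.
    by rewrite lfunN JJ opprK.
  have [c [d cd]] := scale_to_sign zz.
  pose v := c *: z.
  have vJv : B v (J v) = sg d by rewrite !BE mulrA -expr2.
  (* The entry of [mxJ] at [(0, 1)] is [-1], so [B v (J v) = sg d] belongs to the opposite sign of
     [J]. *)
  have sgN : sg (if d is Plus then Minus else Plus) = - sg d :> R.
    by case: (d); rewrite //= opprK.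
  exists 2%N, (b *: mxJ R), (sg (if d is Plus then Minus else Plus) *: mxJ R), (pairv v (J v)).
  split=> //.
  + exact: nf8_imaginary.
  + by apply: JinU; rewrite memvZ.
  split; first by have := Jframe v; rewrite /mxA a0 scale0r add0r.
  rewrite sgN /mxJ mx22Z; apply: gram_pair; rewrite ?alt0 // ?mulr0 //.
    by rewrite mulrN1 opprK.
  by rewrite BJ' vJv mulr1.
- case: ok' => a0 muE; have [E [EE E2 SE]] := pair_unit a0 hS'.
  have BE' x y : B (E x) y = - B x (E y).
    by rewrite EE !scale_lfunE !BE BS muE /=; ring.
  have EU : invariant E U by move=> x xU; rewrite EE scale_lfunE memvZ ?SU.
  have [z [w [zU wU Ez Ew wz]]] := lagrangian_pair E2 BE' EU.
  pose v := (B w z)^-1 *: w.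
  have vz : B v z = 1 by rewrite !BE mulVf.
  have zv : B z v = sg e by rewrite Bsym vz mulr1.
  have Ev : E v = - v by rewrite !BE Ew scalerN.
  have zz : B z z = 0 by apply: (isotropic_eigenspace BE' (mulr1 1)); rewrite scale1r.
  have vv : B v v = 0.
    by apply: (isotropic_eigenspace BE' (sgK R Minus)); rewrite scaleN1r.
  have vU : v \in U by rewrite memvZ.
  have fS : frame S (mx22 a 0 0 (- a)) (pairv z v).
    by apply: frame_pair; rewrite SE ?Ez ?Ev; vring.
  have inU i : pairv z v i \in U by move: i; apply: ord2P.
  exists 2%N, (mx22 a 0 0 (- a)); case: eP_or => eE; rewrite eE muE.
    exists (mxT R), (pairv z v); split=> //; first exact: nf6_real.
    by split=> //; apply: gram_pair; rewrite ?zv ?eE.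
  exists (mxJ R), (pairv z v); split=> //; first by apply: nf8_real; apply: ltW.
  by split=> //; apply: gram_pair; rewrite ?zv ?eE.
case: ok' => a0 b0 muE.
have [E [J [F [gJ [gF EF] JJ [E2 EJ] SE]]]] := quad_units a0 b0 hS'.
have even T : generated (S \o S)%VF T -> forall x y, B (T x) y = B x (T y).
  apply: generated_selfadjoint => x y; rewrite !comp_lfunE !BS muE /=; ring.
have BJ := even J gJ.
have BE' x y : B (E x) y = - B x (E y).
  have gF' := generated_trans (generated_square S) gF.
  by rewrite EF !comp_lfunE BS muE mulN1r even // (generated_commute2 gF' (gen_self S)).
have S2U : invariant (S \o S)%VF U by move=> x xU; rewrite comp_lfunE !SU.
have JU := generated_stable S2U gJ.
have EU : invariant E U.
  by move=> x xU; rewrite EF comp_lfunE SU // (generated_stable S2U gF).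
have [z [w [zU wU Ez Ew wz]]] := lagrangian_pair E2 BE' EU.
have isop x y : E x = x -> E y = y -> B x y = 0.
  by move=> Ex Ey; apply: (isotropic_eigenspace BE' (mulr1 1)); rewrite scale1r.
have ison x y : E x = - x -> E y = - y -> B x y = 0.
  by move=> Ex Ey; apply: (isotropic_eigenspace BE' (sgK R Minus)); rewrite scaleN1r.
have EJz : E (J z) = J z by rewrite EJ Ez.
have EJw : E (J w) = - J w by rewrite EJ Ew lfunN.
have Sz : S z = a *: z + b *: J z by rewrite SE !BE EJz Ez.
have SJz : S (J z) = (- b) *: z + a *: J z.
  by rewrite SE !BE EJz JJ !BE Ez; vring.
have Sw : S w = sg mu *: (a *: w + b *: J w).
  by rewrite SE !BE EJw Ew muE /=; vring.
have SJw : S (J w) = sg mu *: (a *: J w - b *: w).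
  by rewrite SE !BE EJw JJ !BE Ew muE /=; vring.
have [bas [basU fS gr]] := hyperbolic_frame JJ BJ (isop _ _ Ez Ez) (isop _ _ Ez EJz)
  (ison _ _ Ew Ew) (ison _ _ Ew EJw) wz Sz SJz Sw SJw JU zU wU.
exists (2 + 2)%N, (diag2 (mxA a b) (- (mxA a b)^T)), (mxK R e), bas.
rewrite muE scaleN1r in fS.
have nf : normal_form Antiaut e mu (diag2 (mxA a b) (- (mxA a b)^T)) (mxK R e).
  by rewrite muE; case: eP_or => ->; [apply: nf6_complex|apply: nf8_complex].
by split.
Qed.

End ClassificationAntiaut.

(** * Equivalences read off from bases *)

Section Families.
Variables (R : realType) (V : vectType R) (n : nat) (b : 'I_n -> V) (Y : {vspace V}).
Hypothesis YP : forall v, v \in Y <-> exists c : 'I_n -> R, v = \sum_i c i *: b i.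

Lemma frame_sum f (M : 'M[R]_n) (c : 'I_n -> R) : frame f M b ->
  f (\sum_i c i *: b i) = \sum_i (\sum_j M i j * c j) *: b i.
Proof.
move=> fM; rewrite lfun_sum.
under eq_bigr do rewrite lfunZ fM scaler_sumr.
rewrite exchange_big; apply: eq_bigr => i _; rewrite scaler_suml.
by apply: eq_bigr => j _; rewrite scalerA mulrC.
Qed.

Lemma frame_invariant f (M : 'M[R]_n) : frame f M b -> invariant f Y.
Proof.
move=> fM x /YP[c ->]; apply/YP; exists (fun i => \sum_j M i j * c j).
exact: frame_sum.
Qed.

Lemma family_mem i : b i \in Y.
Proof.
apply/YP; exists (fun j => (j == i)%:R).
rewrite (bigD1 i) //= eqxx scale1r big1 ?addr0 // => j /negPf ->.
by rewrite scale0r.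
Qed.

Hypothesis b_indep : independent b.

Lemma coordinates : exists g : 'Hom(V, 'cV[R]_n),
  forall c : 'I_n -> R, g (\sum_i c i *: b i) = \col_i c i.
Proof.
pose X := [tuple b i | i < n].
have Xb (i : 'I_n) : X`_i = b i by rewrite nth_mktuple.
have Xfree : free X.
  apply/freeP => c h; apply: b_indep; rewrite -[RHS]h.
  by apply: eq_bigr => i _; rewrite Xb.
pose h (v : V) : 'cV[R]_n := \col_i coord X i v.
have h_lin : linear h by move=> a u v; apply/colP => i; rewrite !mxE linearP.
pose h' : {linear V -> 'cV[R]_n} :=
  HB.pack h (GRing.isLinear.Build R V 'cV[R]_n _ h h_lin).
exists (linfun h') => c; rewrite lfunE /=; apply/colP => i; rewrite !mxE.
rewrite -[RHS](coord_sum_free c i Xfree); congr (coord _ _ _).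
by apply: eq_bigr => j _; rewrite Xb.
Qed.

Lemma equivalent_of_frame k (dot : V -> V -> R) (S t : 'End(V)) (S0 t0 : 'M[R]_n) :
  frame S S0 b ->
  match k with
  | Aut => frame t t0 b
  | Antiaut => forall c d : 'I_n -> R,
      dot (\sum_i c i *: b i) (t (\sum_i d i *: b i)) =
        \sum_i c i * (\sum_j t0 i j * d j)
  end ->
  equivalent k dot (@std_dot R n) Y {:'cV[R]_n}%VS S t (mxfun S0) (mxfun t0).
Proof.
move=> fS ft; have [g gE] := coordinates.
have gM f M : frame f M b -> {in Y, forall x, g (f x) = mxfun M (g x)}.
  move=> fM x /YP[c ->]; rewrite (frame_sum _ fM) !gE lfunE.
  by apply/colP => i; rewrite !mxE; apply: eq_bigr => j _; rewrite mxE.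
exists g; split=> //.
- apply/eqP; rewrite eqEsubv subvf /=; apply/subvP => x _.
  have -> : x = g (\sum_i x i 0 *: b i) by rewrite gE; apply/colP => i; rewrite mxE.
  by apply: memv_img; apply/YP; exists (fun i => x i 0).
- move=> _ _ /YP[c ->] /YP[d ->]; rewrite !gE => /colP cd.
  by apply: eq_bigr => i _; have := cd i; rewrite !mxE => ->.
- exact: gM.
case: k ft => [ft|gr]; first exact: gM.
move=> _ _ /YP[c ->] /YP[d ->]; rewrite gr !gE lfunE /std_dot mxE.
apply: eq_bigr => i _; rewrite !mxE; congr (_ * _).
by apply: eq_bigr => j _; rewrite mxE.
Qed.

End Families.

Lemma mem_family_span (R : realType) (V : vectType R) n (b : 'I_n -> V) v :
  v \in (\sum_i <[b i]>)%VS <-> exists c : 'I_n -> R, v = \sum_i c i *: b i.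
Proof.
split=> [/memv_sumP[u uP ->]|[c ->]]; last first.
  by apply: memv_sumr => i _; rewrite memvZ // memv_line.
have /choice[c cP] (i : 'I_n) : exists c, u i = c *: b i.
  by have /vlineP[c] := uP i isT; exists c.
by exists c; apply: eq_bigr.
Qed.

Section InvariantSubspaces.
Variables (R : realType) (V : vectType R).
Implicit Types (S : 'End(V)) (U W Y : {vspace V}).

Lemma irreducible_exists S Y : invariant S Y -> Y != 0%VS ->
  exists W, [/\ (W <= Y)%VS, invariant S W, W != 0%VS
    & forall U, (U <= W)%VS -> invariant S U -> U = 0%VS \/ U = W].
Proof.
have [d] := ubnP (\dim Y); elim: d Y => // d IH Y dY SY Y0.
have [irr|/existsNP[U]] := pselect (forall U, (U <= Y)%VS -> invariant S U ->
  U = 0%VS \/ U = Y); first by exists Y.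
move=> /not_implyP[UY /not_implyP[SU /not_orP[/eqP U0 /eqP UnY]]].
have [|W [WU SW W0 Wirr]] := IH U _ SU U0.
  rewrite -ltnS; apply: leq_trans dY; rewrite ltnS ltnNge; apply: contra UnY => YU.
  by rewrite eqEdim UY.
by exists W; split=> //; apply: subv_trans WU UY.
Qed.

Lemma irreducible_indecomposable S W : invariant S W -> W != 0%VS ->
  (forall U, (U <= W)%VS -> invariant S U -> U = 0%VS \/ U = W) ->
  indecomposable [:: S] W.
Proof.
move=> SW W0 irr; split=> //; first exact/stable1P.
move=> [U1 [U2 [U10 U20 [U12 U12W] /stable1P S1 /stable1P S2]]].
have [|U1z|U1W] := irr U1 _ S1; rewrite -?U12W ?addvSl //.
  by rewrite U1z eqxx in U10.
have [|U2z|U2W] := irr U2 _ S2; rewrite -?U12W ?addvSr //.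
  by rewrite U2z eqxx in U20.
by move: W0; rewrite -U12 U1W U2W capvv eqxx.
Qed.

End InvariantSubspaces.

Lemma form_dim_gt0 (R : realType) k e mu (sp : spectrum R) :
  (0 < form_dim k e mu sp)%N.
Proof. by case: sp k e mu => [?|??|?|??] [] [] []. Qed.

Lemma independent_neq0 (R : realType) (V : vectType R) n (b : 'I_n -> V) i :
  independent b -> b i != 0.
Proof.
move=> bi; apply/eqP => bi0; have := bi (fun j => (j == i)%:R) _ i.
rewrite eqxx (bigD1 i) //= bi0 scaler0 add0r big1 => [/(_ erefl)/eqP|j /negPf ->].
  by rewrite oner_eq0.
by rewrite scale0r.
Qed.

Section GramFamilies.
Variables (R : realType) (V : vectType R) (dot : {dot V for @idfun R}).
Variables (f : 'End(V)) (n : nat) (b : 'I_n -> V) (t0 : 'M[R]_n) (e : sign).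
Hypothesis gr : gram dot f t0 b.
Hypothesis t0_sq : t0 *m t0 = sg e *: 1%:M.

Lemma gram_sum (c d : 'I_n -> R) :
  dot (\sum_i c i *: b i) (f (\sum_i d i *: b i)) =
    \sum_i c i * (\sum_j t0 i j * d j).
Proof.
rewrite dot_suml; apply: eq_bigr => i _; rewrite dotZl lfun_sum dot_sumr.
by congr (_ * _); apply: eq_bigr => j _; rewrite lfunZ dotZr gr mulrC.
Qed.

Lemma gram_coordinates (d : 'I_n -> R) :
  (forall i, dot (b i) (f (\sum_j d j *: b j)) = 0) -> forall i, d i = 0.
Proof.
move=> h; suff d0 : \col_i d i = 0 :> 'cV_n.
  by move=> i; move/colP/(_ i): d0; rewrite !mxE.
have t0d : t0 *m \col_i d i = 0.
  apply/colP => i; rewrite !mxE -[RHS](h i) lfun_sum dot_sumr.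
  by apply: eq_bigr => j _; rewrite mxE lfunZ dotZr gr mulrC.
have := congr1 (mulmx t0) t0d; rewrite mulmxA t0_sq mulmx0 -scalemxAl mul1mx.
by move/eqP; rewrite scaler_eq0 (negPf (sg_neq0 R e)) => /eqP.
Qed.

Lemma gram_independent : independent b.
Proof.
move=> c c0; apply: gram_coordinates => i.
by rewrite c0 lfun0 dot0r.
Qed.

End GramFamilies.

(** * The reduced space as generated by one irreducible subspace, and its normal form *)

Section ReducedForm.
Variables (R : realType) (V : vectType R) (dot : {dot V for @idfun R}).
Variables (k : kind) (e mu : sign) (s L S N : 'End(V)) (m : nat) (sp : spectrum R).
Hypothesis hs : structure_map dot e s.
Hypothesis LSN : L = S + N.
Hypothesis SN : forall x, S (N x) = N (S x).
Hypothesis cS : compatible dot k mu s S.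
Hypothesis cN : compatible dot k mu s N.
Hypothesis ind : indec dot k s L.
Hypothesis Nm : forall x, iter m.+1 N x = 0.
Hypothesis Nm_neq0 : exists x, iter m N x != 0.
Hypothesis ok : spectrum_ok mu sp.
Hypothesis hsp : has_spectrum S sp.
Variables (Y : {vspace V}) (t : 'End(V)).
Hypothesis SY : invariant S Y.
Hypothesis nY : nondegenerate dot k s N m Y.
Hypothesis Y0 : Y != 0%VS.
Hypothesis tY : reduced_structure_map dot k s N m.+1 Y t.

Let minimal (Z : {vspace V}) : invariant S Z -> nondegenerate dot k s N m Z -> Z != 0%VS ->
  (Z <= Y)%VS -> Z = Y.
Proof.
move=> SZ nZ Z0 ZY.
exact: (nondegenerate_eq hs LSN SN cS cN ind Nm ok hsp SZ nZ Z0 SY nY Y0 ZY).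
Qed.

Let stable_t : invariant t Y.
Proof. by case: tY => /stable1P. Qed.

(** Moving [N ^ m] across the form costs the factor [mu ^ m]; for [mu = Minus] the symmetry of [t]
    thus depends on the height of [N]. *)
Lemma reduced_symmetry : k = Antiaut -> exists eps : sign,
  [/\ sg eps = sg e * sg mu ^+ m :> R,
      forall x y, dot x (s (iter m N y)) = sg eps * dot y (s (iter m N x))
    & has_symmetry dot eps Y t].
Proof.
move=> kA; have [eps epsE] : exists eps : sign, sg eps = sg e * sg mu ^+ m :> R.
  elim: (m) => [|j [eps IH]]; first by exists e; rewrite expr0 mulr1.
  rewrite exprSr mulrA -IH; case: (mu); first by exists eps; rewrite mulr1.
  by exists (if eps is Plus then Minus else Plus); case: (eps); rewrite /= ?mulrN1 ?opprK.
have sym x y : dot x (s (iter m N y)) = sg eps * dot y (s (iter m N x)).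
  rewrite epsE (structure_form_sym hs) -mulrA; congr (_ * _).
  by move: cN; rewrite kA => hN; rewrite (compatible_exp (k := Antiaut) m hN).
exists eps; split=> // x y xY yY; move: tY; rewrite kA => -[_ tE].
by rewrite dotC -!tE // sym.
Qed.

(** For automorphisms [W + s W] is nondegenerate, hence equal to [Y]. For anti-automorphisms [t]
    carries [W] to a subspace invariant under the adjoint of [S] on [Y], not necessarily under [S],
    so minimality does not apply to [W + t W]. Instead, either [W] is nondegenerate, or it is
    isotropic and [\dim Y] is at most [2 * \dim W]. *)
Lemma reduced_generator : exists W : {vspace V},
  [/\ (W <= Y)%VS, indecomposable [:: S] W & Y = (W + t @: W)%VS].
Proof.
have [W [WY SW W0 Wirr]] := irreducible_exists SY Y0.
exists W; split=> //; first exact: irreducible_indecomposable.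
have WYx x : x \in W -> x \in Y by apply: (subvP WY).
have tWY : (t @: W <= Y)%VS.
  by apply/subvP => _ /memv_imgP[x xW ->]; apply/stable_t/WYx.
have sumY : (W + t @: W <= Y)%VS by rewrite subv_add WY.
case: (k) tY nY cS minimal reduced_symmetry => [[_ tE]|[_ tE]].
  move=> [sY inj] hS min _.
  have tW : (t @: W = s @: W)%VS by apply: eq_in_limg => x /WYx /tE.
  rewrite tW in sumY *; apply/esym/min => //.
  - move=> _ /memv_addP[u uW [_ /memv_imgP[v vW ->] ->]].
    by rewrite lfunD hS memv_add ?SW // memvZ // memv_img ?SW.
  - split=> [_ /memv_addP[u uW [_ /memv_imgP[v vW ->] ->]]|y yZ].
      by rewrite lfunD hs.1 addrC memv_add ?memvZ // memv_img.
    by apply: inj; apply: (subvP sumY).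
  by apply: contraNneq W0 => Z0; rewrite -subv0 -Z0 addvSl.
move=> nd hS min /(_ erefl)[eps [_ sym _]].
have tau x y : x \in Y -> y \in Y -> dot x (t y) = dot x (s (iter m N y)).
  by move=> xY yY; rewrite tE.
have tauS x y : dot (S x) (s (iter m N y)) = sg mu * dot x (s (iter m N (S y))).
  by rewrite hS (iter_commute SN).
pose f : 'End(V) := (s \o lpow N m)%VF.
have fE x : f x = s (iter m N x) by rewrite comp_lfunE lpowE.
have [K [KP dK]] := perp_exists dot f W.
have {}KP v : v \in K <-> forall u, u \in W -> dot u (s (iter m N v)) = 0.
  by rewrite -fE; apply: KP.
have SK : invariant S K.
  move=> v /KP vK; apply/KP => u uW.
  by apply: (mulfI (sg_neq0 R mu)); rewrite -tauS mulr0 vK ?SW.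
have [||WK0|WK] := Wirr (W :&: K)%VS; first exact: capvSl.
- by move=> x /memv_capP[xW xK]; rewrite memv_cap SW ?SK.
- suff WE : W = Y.
    by apply/eqP; rewrite eqEsubv sumY andbT -{1}WE addvSl.
  apply: min => // y yW hy; apply: (capv_eq0 WK0) => //.
  exact/KP.
have WKs : (W <= K)%VS by apply/capv_idPl.
have WKx x : x \in W -> x \in K by apply: (subvP WKs).
have iso x y : x \in W -> y \in W -> dot x (s (iter m N y)) = 0.
  by move=> xW /WKx/KP; apply.
have t_inj y : y \in Y -> t y = 0 -> y = 0.
  move=> yY ty; apply: nd => // x xY; by rewrite -tau // ty dot0r.
have dimT : \dim (t @: W) = \dim W.
  apply: limg_dim_eq; apply: capv_eq0P => x xW; rewrite memv_ker => /eqP.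
  by apply: t_inj; apply: WYx.
(* [t W] is orthogonal to the isotropic [W] in the inner product. *)
have WT : (W :&: t @: W)%VS = 0%VS.
  apply: capv_eq0P => z zW /memv_imgP[x xW xE].
  apply: (dot_eq0 (dot := dot)); rewrite {2}xE tau ?WYx //.
  exact: iso.
have SKY : invariant S (K :&: Y)%VS.
  by move=> x /memv_capP[xK xY]; rewrite memv_cap SK ?SY.
have [C [KC KCf SC]] := invariant_complement ok hsp SKY.
have Ydec y : y \in Y -> exists u v, [/\ u \in K, u \in Y, v \in C, v \in Y & y = u + v].
  move=> yY; have [u [v [/memv_capP[uK uY] vC yE]]] := full_decompose KCf y.
  exists u, v; split=> //; have -> : v = y - u by rewrite yE addrC addKr.
  exact: memvB.
(* Within [Y], the subspace [C :&: Y] complements the orthogonal space of [W], so no nonzero vector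
   of it is orthogonal to [W]. This makes [Z] nondegenerate and at most twice as large as [W]. *)
pose Z := (W + (C :&: Y))%VS.
have ZY : (Z <= Y)%VS by rewrite subv_add WY capvSr.
have ZE : Z = Y.
  apply: min => //.
  - move=> _ /memv_addP[u uW [v /memv_capP[vC vY] ->]].
    by rewrite lfunD memv_add ?SW // memv_cap SC ?SY.
  - move=> _ /memv_addP[u uW [v /memv_capP[vC vY] ->]] hz.
    have v0 : v = 0.
      apply: (capv_eq0 KC) => //; rewrite memv_cap vY andbT; apply/KP => x xW.
      have := hz x; rewrite iter_lfunD lfunD dotDr iso // add0r; apply.
      by rewrite -[x]addr0 memv_add ?mem0v.
    rewrite v0 addr0 in hz *; apply: nd; first exact: WYx.
    move=> _ /Ydec[p [q [pK pY qC qY ->]]]; rewrite dotDl.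
    rewrite [dot p _]sym; move/KP: (pK) => -> //; rewrite mulr0 add0r; apply: hz.
    by rewrite -[q]add0r memv_add ?mem0v // memv_cap qC.
  by apply: contraNneq W0 => Z0; rewrite -subv0 -Z0 addvSl.
have dC : (\dim (C :&: Y) <= \dim W)%N.
  have dKC : (\dim (K :&: Y) + \dim C = \dim {:V})%N.
    by rewrite -dimv_disjoint_sum // KCf.
  have h1 := dimv_sum_cap K Y; have h2 := dimvS (subvf (K + Y)%VS).
  have h3 : (\dim (C :&: Y) + \dim (K :&: Y) <= \dim Y)%N.
    rewrite -dimv_disjoint_sum ?dimvS ?subv_add ?capvSr //.
    apply: capv_eq0P => x /memv_capP[xC _] xKY; exact: (capv_eq0 KC).
  lia.
apply/eqP; rewrite eq_sym eqEdim sumY /= dimv_disjoint_sum // dimT -{1}ZE.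
apply: leq_trans (dimv_add_leqif _ _) _.
by rewrite leq_add2l.
Qed.

(** The basis found in [Y] spans an invariant nondegenerate subspace, which is [Y] by minimality. *)
Lemma reduced_normal_form : exists (eps : sign) (n : nat) (S0 t0 : 'M[R]_n),
  [/\ has_symmetry dot eps Y t, normal_form k eps mu S0 t0
    & equivalent k dot (@std_dot R n) Y {:'cV[R]_n}%VS S t (mxfun S0) (mxfun t0)].
Proof.
have spanY n (b : 'I_n -> V) : (forall i, b i \in Y) -> (\sum_i <[b i]> <= Y)%VS.
  by move=> bY; apply/subv_sumP => i _; rewrite -memvE.
have span_neq0 n (b : 'I_n -> V) : (0 < n)%N -> independent b ->
    (\sum_i <[b i]>)%VS != 0%VS.
  move=> n0 bi; apply/eqP => Z0; have /negP := independent_neq0 (Ordinal n0) bi.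
  by apply; rewrite -memv0 -Z0; apply: family_mem; apply: mem_family_span.
case: (k) tY nY cS minimal reduced_symmetry => [[_ tE]|[_ tE]].
  move=> [sY inj] hS min _.
  have [n [S0 [t0 [b [nE nf bY [fS fs bi]]]]]] :=
    normal_form_aut ok hsp hs.1 hS SY sY Y0.
  have memZ := mem_family_span b.
  have ZY : (\sum_i <[b i]>)%VS = Y.
    apply: min; last exact: spanY.
    - exact: (frame_invariant memZ fS).
    - split; first exact: (frame_invariant memZ fs).
      by move=> y /(subvP (spanY _ _ bY)); apply: inj.
    by apply: span_neq0; rewrite // nE form_dim_gt0.
  rewrite ZY in memZ; exists e, n, S0, t0; split=> //.
    by move=> x y xY yY; rewrite !tE // hs.2.
  by apply: (equivalent_of_frame memZ bi (k := Aut)) => // j; rewrite tE // fs.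
move=> nd hS min /(_ erefl)[eps [_ sym symt]].
pose f : 'End(V) := (s \o lpow N m)%VF.
have fE x : f x = s (iter m N x) by rewrite comp_lfunE lpowE.
have fsym x y : dot x (f y) = sg eps * dot y (f x) by rewrite !fE.
have fS x y : dot (S x) (f y) = sg mu * dot x (f (S y)).
  by rewrite !fE hS (iter_commute SN).
have fnd y : y \in Y -> (forall x, x \in Y -> dot x (f y) = 0) -> y = 0.
  by move=> yY hy; apply: nd => // x xY; rewrite -fE hy.
have [n [S0 [t0 [b [nE nf bY [frS gr]]]]]] :=
  normal_form_antiaut ok hsp fsym fS SY fnd Y0.
have [_ t0_sq] := normal_form_structure nf.
have bi := gram_independent gr t0_sq.
have memZ := mem_family_span b.
have ZY : (\sum_i <[b i]>)%VS = Y.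
  apply: min; last exact: spanY.
  - exact: (frame_invariant memZ frS).
  - move=> _ /memZ[d ->] hy; rewrite big1 // => i _.
    rewrite (gram_coordinates gr t0_sq) ?scale0r // => j.
    by rewrite fE hy //; apply: family_mem.
  by apply: span_neq0; rewrite // nE form_dim_gt0.
rewrite ZY in memZ; exists eps, n, S0, t0; split=> //.
apply: (equivalent_of_frame memZ bi (k := Antiaut)) => // c d.
have inY (u : 'I_n -> R) : \sum_i u i *: b i \in Y by apply/memZ; exists u.
by rewrite -tE // -fE (gram_sum gr).
Qed.

End ReducedForm.

(** * Normal forms of indecomposable systems *)

Section IndecomposableSystems.
Variables (R : realType) (V : vectType R) (dot : {dot V for @idfun R}).
Implicit Types (k : kind) (e mu : sign) (s t L S N : 'End(V)) (Y : {vspace V}).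

Lemma nilpotent_height N n : (exists v : V, v != 0) -> (forall x, iter n N x = 0) ->
  exists m, (forall x, iter m.+1 N x = 0) /\ exists x, iter m N x != 0.
Proof.
move=> [v v0]; elim: n => [/(_ v)/= v00|n IH Nn]; first by rewrite v00 eqxx in v0.
have [/IH //|/existsNP[x /eqP xn]] := pselect (forall x, iter n N x = 0).
by exists n; split=> //; exists x.
Qed.

Lemma system_data k mu s L S N :
  indecomposable_system k mu dot s L -> jordan_chevalley L S N ->
  exists e m sp,
  [/\ structure_map dot e s /\ L = S + N, forall x, S (N x) = N (S x),
      compatible dot k mu s S /\ compatible dot k mu s N, indec dot k s L
    & [/\ forall x, iter m.+1 N x = 0, exists x, iter m N x != 0,
          spectrum_ok mu sp & has_spectrum S sp]].
Proof.
move=> [/order_two_structure[e hs] gL hp] JC.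
have [LSN ssS [n Nn] SNE] := JC.
have [hind V0] := indec_of_pair hs hp.
have [cS cN] := jordan_compatible JC (gamma_compatible hs gL).
have SN x : S (N x) = N (S x) by move/lfunP/(_ x): SNE; rewrite !comp_lfunE.
have [v _ v0] := neq0_vspace V0.
have [m [Nm Nm0]] : exists m, (forall x, iter m.+1 N x = 0) /\ exists x, iter m N x != 0.
  by apply: nilpotent_height Nn; exists v.
have [sp [ok hsp]] := system_spectrum LSN SN cS hind ssS V0.
by exists e, m, sp.
Qed.

Lemma reduction_determines k mu s s' L L' S S' N N' Y Y' t t' :
  indecomposable_system k mu dot s L -> jordan_chevalley L S N ->
  indecomposable_system k mu dot s' L' -> jordan_chevalley L' S' N' ->
  reduction dot k s S N Y t -> reduction dot k s' S' N' Y' t' ->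
  equivalent k dot dot Y Y' S t S' t' ->
  equivalent k dot dot {:V}%VS {:V}%VS L s L' s'.
Proof.
move=> hL JC hL' JC' [n [hn rY tY]] [n' [hn' rY' tY']] [g [gY g_inj gS gt]].
have [e [m [sp [[hs LSN] SN [cS cN] ind [Nm Nm0 ok hsp]]]]] := system_data hL JC.
have [e' [m' [sp' [[hs' LSN'] SN' [cS' cN'] ind' [Nm' Nm0' ok' hsp']]]]] :=
  system_data hL' JC'.
have [SY nY Y0] := reduced_nondegenerate hs LSN SN cS cN ind Nm ok hsp Nm0 hn rY.
have [SY' nY' Y0'] :=
  reduced_nondegenerate hs' LSN' SN' cS' cN' ind' Nm' ok' hsp' Nm0' hn' rY'.
have [full _ d] := jordan_span_full hs LSN SN cS cN ind Nm ok hsp SY nY Y0.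
have [_ _ d'] := jordan_span_full hs' LSN' SN' cS' cN' ind' Nm' ok' hsp' SY' nY' Y0'.
have dY : \dim Y' = \dim Y.
  rewrite -gY; apply: limg_dim_eq; apply: capv_eq0P => x xY.
  by rewrite memv_ker => /eqP gx; apply: g_inj; rewrite ?mem0v // lfun0.
(* Equal heights follow from [(m + 1) * \dim Y = \dim {:V} = (m' + 1) * \dim Y'], as [g] makes the
   two reduced spaces equidimensional. *)
have mm : m' = m.
  move: d'; rewrite d dY => /eqP; rewrite eqn_pmul2r ?lt0n ?dimv_eq0 //.
  by move=> /eqP [].
move: Nm' nY' hn hn' tY tY'; rewrite mm => Nm' nY' hn hn' tY tY'.
have kerN := ker_limg hs LSN SN cS cN ind Nm ok hsp Nm0.
have nE := height_succ Nm Nm0 hn.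
have n'E : n' = m.+1 by rewrite -mm; apply: height_succ hn' => //; rewrite mm.
rewrite nE in tY; rewrite n'E in tY'; rewrite LSN LSN'.
have kE : k = Aut \/ k = Antiaut by case: (k); [left|right].
have gYY y : y \in Y -> g y \in Y' by move=> yY; rewrite -gY memv_img.
case: kE => kA; rewrite kA.
  apply: (lift_aut SN SN' cN cN' Nm Nm' SY nY nY' full kA gY g_inj gS).
  move: gt tY tY'; rewrite kA => gt [_ tE] [_ tE'] y yY.
  by rewrite -tE // gt // tE' ?gYY.
apply: (lift_antiaut hs hs' SN SN' cS cN cS' cN' Nm Nm' kerN SY nY nY' Y0 full
  kA gY g_inj gS).
move: gt tY tY'; rewrite kA => gt [_ tE] [_ tE'] x y xY yY.
by rewrite tE' ?gYY // gt // tE.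
Qed.

Lemma system_normal_form k mu s L S N Y t :
  indecomposable_system k mu dot s L -> jordan_chevalley L S N ->
  reduction dot k s S N Y t ->
  (exists W : {vspace V},
     [/\ (W <= Y)%VS, indecomposable [:: S] W & Y = (W + t @: W)%VS]) /\
  (exists (eps : sign) (n : nat) (S0 t0 : 'M[R]_n),
     [/\ has_symmetry dot eps Y t, normal_form k eps mu S0 t0
       & equivalent k dot (@std_dot R n) Y {:'cV[R]_n}%VS
           S t (mxfun S0) (mxfun t0)]).
Proof.
move=> hL JC [n [hn rY tY]].
have [e [m [sp [[hs LSN] SN [cS cN] ind [Nm Nm0 ok hsp]]]]] := system_data hL JC.
have [SY nY Y0] := reduced_nondegenerate hs LSN SN cS cN ind Nm ok hsp Nm0 hn rY.
rewrite (height_succ Nm Nm0 hn) in tY.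
split; first exact: (reduced_generator hs LSN SN cS cN ind Nm ok hsp SY nY Y0 tY).
exact: (reduced_normal_form hs LSN SN cS cN ind Nm ok hsp SY nY Y0 tY).
Qed.

Lemma system_reduction k mu s L S N :
  indecomposable_system k mu dot s L -> jordan_chevalley L S N ->
  exists (Y : {vspace V}) (t : 'End(V)), reduction dot k s S N Y t.
Proof.
move=> hL JC.
have [e [m [sp [[hs LSN] SN [cS cN] ind [Nm Nm0 ok hsp]]]]] := system_data hL JC.
exact: (reduction_exists hs LSN SN cS cN ind Nm ok hsp Nm0).
Qed.

End IndecomposableSystems.

(** * The listed pairs are indecomposable *)

Section Diagonalizability.
Variables (R : realType) (V : vectType R).
Implicit Types (S : 'End(V)).
Local Notation e := (vbasis {:V}).
Local Notation mx f := (mxof e e f).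
Local Notation toC := (real_complex R).
Let e_basis : basis_of {:V} e := vbasisP {:V}.

(** The minimal polynomial of the complex matrix divides a product of distinct linear factors. The
    coefficients are kept real so that the annihilation can be verified in [V]. *)
Lemma semisimple_of_poly S m (c : nat -> R) rs : uniq rs ->
  \sum_(i < m) (toC (c i))%:P * 'X^i = \prod_(r <- rs) ('X - r%:P) ->
  (forall x, \sum_(i < m) c i *: iter i S x = 0) -> semisimple S.
Proof.
move=> urs pE pS; rewrite /semisimple.
have pM : \sum_(i < m) c i *: (mx S) ^+ i = 0.
  apply/row_matrixP => i; rewrite row0 rowE mulmx_sumr.
  rewrite -[RHS](linear0 (rVof e)) -(pS (vecof e (delta_mx 0 i))) linear_sum.
  apply: eq_bigr => j _; rewrite -scalemxAr linearZ /=; congr (_ *: _).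
  elim: (nat_of_ord j) => [|l IH]; first by rewrite expr0 mulmx1 /= vecofK.
  by rewrite exprSr mulmxA IH iterS (rVof_app _ e_basis).
have {}pM : \sum_(i < m) toC (c i) *: (map_mx toC (mx S)) ^+ i = 0.
  rewrite -[RHS](map_mx0 toC) -pM map_mx_sum.
  by apply: eq_bigr => i _; rewrite map_mxZ map_mx_exp.
move: (map_mx toC (mx S)) pM; case: (\dim _) => [|n] M pM.
  by rewrite [M]flatmx0; apply: diagonalizable0.
apply/diagonalizableP; exists rs => //; apply: mxminpoly_min.
rewrite -pE rmorph_sum -[RHS]pM; apply: eq_bigr => i _.
by rewrite rmorphM rmorphXn /= horner_mx_X horner_mx_C -mul_scalar_mx.
Qed.

Lemma spectrum_semisimple mu S sp :
  spectrum_ok mu sp -> has_spectrum S sp -> semisimple S.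
Proof.
have i2 : ('i%C)%:P * ('i%C)%:P = -1 :> {poly R[i]}.
  by rewrite -polyCM -expr2 sqr_i polyCN.
have neq (x y : R[i]) : complex.Re x != complex.Re y \/ complex.Im x != complex.Im y ->
    x != y.
  by case=> h; apply: contra_neq h => ->.
case: sp => [a|a b|a|a b] ok hS.
- apply: (@semisimple_of_poly S 2 (nth 0 [:: - a; 1]) [:: toC a]) => //.
    by rewrite !big_ord_recl big_ord0 big_seq1 /= !rmorphN !rmorph1 ?polyC1 ?polyCN; ring.
  by move=> x; rewrite !big_ord_recl big_ord0 /= hS; vring.
- case: ok => b0 _.
  apply: (@semisimple_of_poly S 3 (nth 0 [:: a ^+ 2 + b ^+ 2; - (2 * a); 1])
    [:: (a +i* b)%C; (a -i* b)%C]).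
  + rewrite /= inE andbT; apply: neq; right => /=.
    by apply/eqP => h; clear i2; lra.
  + rewrite !big_ord_recl big_ord0 big_cons big_seq1 /= /bump /=.
    rewrite [(a +i* b)%C]complexE [(a -i* b)%C]complexE /= !(polyCD, polyCM, polyCN, rmorphD, rmorphN,
      rmorphXn, rmorphM, rmorph0, rmorph1, rmorph_nat) /=.
    by ring: i2.
  by move=> x; rewrite !big_ord_recl big_ord0 /= hS; vring.
- case: ok => a0 _.
  apply: (@semisimple_of_poly S 3 (nth 0 [:: - a ^+ 2; 0; 1]) [:: toC a; - toC a]).
  + rewrite /= inE andbT; apply: neq; left => /=.
    by apply/eqP => h; clear i2; lra.
  + rewrite !big_ord_recl big_ord0 big_cons big_seq1 /= /bump /= !(polyCD, polyCM, polyCN, rmorphD, rmorphN,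
      rmorphXn, rmorphM, rmorph0, rmorph1, rmorph_nat) /=.
    by ring.
  by move=> x; rewrite !big_ord_recl big_ord0 /= hS; vring.
case: ok => a0 b0 _.
apply: (@semisimple_of_poly S 5
  (nth 0 [:: (a ^+ 2 + b ^+ 2) ^+ 2; 0; - (2 * (a ^+ 2 - b ^+ 2)); 0; 1])
  [:: (a +i* b)%C; (a -i* b)%C; (- a +i* b)%C; (- a -i* b)%C]).
+ clear i2; rewrite /= !inE !negb_or !andbT -!andbA; apply/and5P; split; last apply/andP;
    repeat split; apply: neq => /=;
    solve [left; apply/eqP => h; lra | right; apply/eqP => h; lra].
+ rewrite !big_ord_recl big_ord0 !big_cons big_nil /= /bump /=.
  rewrite [(a +i* b)%C]complexE [(a -i* b)%C]complexE.
  rewrite [(- a +i* b)%C]complexE [(- a -i* b)%C]complexE /= !(polyCD, polyCM, polyCN, rmorphD, rmorphN,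
      rmorphXn, rmorphM, rmorph0, rmorph1, rmorph_nat) /=.
  by ring: i2.
by move=> x; rewrite !big_ord_recl big_ord0 /= hS; vring.
Qed.

End Diagonalizability.

Section IndecomposablePairs.
Variables (R : realType) (V : vectType R) (dot : {dot V for @idfun R}).
Implicit Types (U : {vspace V}).

Lemma independent_dim n (b : 'I_n -> V) U : independent b -> (forall i, b i \in U) ->
  (n <= \dim U)%N.
Proof.
move=> bi bU; pose X := [tuple b i | i < n].
have Xb (i : 'I_n) : X`_i = b i by rewrite nth_mktuple.
have Xfree : free X.
  apply/freeP => c h; apply: bi; rewrite -[RHS]h.
  by apply: eq_bigr => i _; rewrite Xb.
have <- : \dim <<X>> = n by move/eqP: Xfree; rewrite size_tuple.
apply/dimvS/span_subvP => x /tnthP[i ->].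
by rewrite tnth_mktuple.
Qed.

Variables (k : kind) (e mu : sign) (s S : 'End(V)) (sp : spectrum R).
Hypothesis hs : structure_map dot e s.
Hypothesis cS : compatible dot k mu s S.
Hypothesis ok : spectrum_ok mu sp.
Hypothesis hsp : has_spectrum S sp.

(** The classification, applied inside [U], exhibits [form_dim] independent vectors. A space of
    dimension [form_dim] thus has no room for two summands. *)
Lemma form_dim_le U : U != 0%VS -> invariant S U ->
  match k with
  | Aut => invariant s U
  | Antiaut => forall y, y \in U -> (forall x, x \in U -> dot x (s y) = 0) -> y = 0
  end -> (form_dim k e mu sp <= \dim U)%N.
Proof.
move=> U0 SU; case: (k) cS => hS hU.
  have [n [S0 [t0 [b [<- _ bU [_ _ bi]]]]]] := normal_form_aut ok hsp hs.1 hS SU hU U0.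
  exact: independent_dim bi bU.
have [n [S0 [t0 [b [<- nf bU [_ gr]]]]]] :=
  normal_form_antiaut ok hsp (structure_form_sym hs) hS SU hU U0.
have [_ t0_sq] := normal_form_structure nf.
exact: independent_dim (gram_independent gr t0_sq) bU.
Qed.

(* Along the orbit of an anti-automorphism, a subspace invariant under the
   structure map of an equivalent pair is nondegenerate for the form. *)
Lemma indecomposable_pair_of_dim : form_dim k e mu sp = \dim {:V} ->
  indecomposable_pair k dot S s.
Proof.
move=> dimE S' s' [g [gV g_inj gS gs]].
have V0 : {:V}%VS != 0%VS by rewrite -dimv_eq0 -dimE -lt0n form_dim_gt0.
split=> //; first by apply/stable2P; split=> x _; apply: memvf.
move=> [U1 [U2 [U10 U20 [U12 U12f] /stable2P[SU1 sU1] /stable2P[SU2 sU2]]]].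
have g0 : lker g == 0%VS.
  rewrite -subv0; apply/subvP => x; rewrite memv_ker memv0 => /eqP gx; apply/eqP.
  by apply: g_inj; rewrite ?memvf // lfun0.
have gVK := lker0_lfunVK g0.
have le U : U != 0%VS -> invariant S' U -> invariant s' U ->
    (\dim {:V} <= \dim U)%N.
  move=> U0 SU sU; pose W := (g @^-1: U)%VS.
  have WP x : (x \in W) = (g x \in U) by rewrite memv_preim.
  have gW : (g @: W)%VS = U by rewrite lpreimK // gV subvf.
  rewrite -gW limg_dim_eq ?(eqP g0) ?capv0 // -dimE; apply: form_dim_le.
  - by apply: contraNneq U0 => W0; rewrite -gW W0 limg0.
  - by move=> x; rewrite !WP gS ?memvf //; apply: SU.
  case: (k) gs => gs; first by move=> x; rewrite !WP gs ?memvf //; apply: sU.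
  move=> y; rewrite WP => yU hy; apply: (structure_form_nondeg hs) => x.
  (* [s' (g y)] lies in [U] and is orthogonal to [U], hence to itself. *)
  have sy : s' (g y) = 0.
    apply: (dot_eq0 (dot := dot)); rewrite -{1}(gVK (s' (g y))) gs ?memvf //.
    by apply: hy; rewrite WP gVK sU.
  by rewrite -gs ?memvf // sy dot0r.
have h1 := le _ U10 SU1 sU1; have h2 := le _ U20 SU2 sU2.
have h3 := dimv_disjoint_sum U12; rewrite U12f in h3.
by move: V0; rewrite -dimv_eq0; lia.
Qed.

End IndecomposablePairs.

(** * The standard inner product *)

Section StandardDot.
Variables (R : realType) (n : nat).
Local Notation sdot := (@std_dot R n).

Lemma std_dot_bilinear : bilinear_for (GRing.Scale.Law.clone _ _ ( *%R ) _)
  (GRing.Scale.Law.clone _ _ (idfun \; *%R ) _) sdot.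
Proof.
split=> [y|x] a u v; rewrite /std_dot.
  by rewrite linearP /= mulmxDl -scalemxAl !mxE.
by rewrite mulmxDr -scalemxAr !mxE.
Qed.

Lemma std_dot_sym x y : sdot x y = (-1) ^+ false * idfun (sdot y x).
Proof. by rewrite expr0 mul1r /= /std_dot -[in LHS](trmxK y) -trmx_mul mxE. Qed.

Lemma std_dot_sum (x y : 'cV[R]_n) : sdot x y = \sum_i x i 0 * y i 0.
Proof. by rewrite /std_dot mxE; apply: eq_bigr => i _; rewrite mxE. Qed.

Lemma std_dot_pos x : x != 0 -> 0 < sdot x x.
Proof.
move=> x0; rewrite std_dot_sum lt0r sumr_ge0 ?andbT => [|i _]; last exact: sqr_ge0.
apply: contra x0; rewrite psumr_eq0 => [/allP h|i _]; last exact: sqr_ge0.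
apply/eqP/colP => i; rewrite mxE; apply/eqP.
by have := h i (mem_index_enum i); rewrite mulf_eq0 orbb.
Qed.

HB.instance Definition _ := bilinear_isBilinear.Build R _ _ _
  (GRing.Scale.Law.clone _ _ ( *%R ) _) (GRing.Scale.Law.clone _ _ (idfun \; *%R ) _)
  sdot std_dot_bilinear.
HB.instance Definition _ :=
  isHermitianSesquilinear.Build R 'cV[R]_n false idfun sdot std_dot_sym.
HB.instance Definition _ := isDotProduct.Build R 'cV[R]_n sdot std_dot_pos.

Definition std_inner : {dot 'cV[R]_n for @idfun R} := sdot.

End StandardDot.

(** * Spectrum and compatibility of the listed matrices *)

Section NormalForms.
Variable R : realType.

Lemma mxfunE n (M : 'M[R]_n) x : mxfun M x = M *m x.
Proof. by rewrite lfunE. Qed.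

Lemma diag2M (A B C D : 'M[R]_2) : diag2 A B *m diag2 C D = diag2 (A *m C) (B *m D).
Proof. by rewrite /diag2 mulmx_block !mulmx0 !mul0mx !addr0 !add0r. Qed.

Lemma diag2Z c (A B : 'M[R]_2) : c *: diag2 A B = diag2 (c *: A) (c *: B).
Proof. by rewrite /diag2 scale_block_mx !scaler0. Qed.

Lemma diag2D (A B C D : 'M[R]_2) : diag2 A B + diag2 C D = diag2 (A + C) (B + D).
Proof. by rewrite /diag2 add_block_mx !addr0. Qed.

Lemma diag2T (A B : 'M[R]_2) : (diag2 A B)^T = diag2 A^T B^T.
Proof. by rewrite /diag2 tr_block_mx !trmx0. Qed.

Lemma diag2_1 : 1%:M = diag2 1%:M 1%:M :> 'M[R]_(2 + 2).
Proof. exact: scalar_mx_block. Qed.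

Lemma diag2K (A B : 'M[R]_2) e : diag2 A B *m mxK R e = block_mx 0 (sg e *: A) B 0.
Proof.
by rewrite /diag2 mulmx_block !mulmx0 !mul0mx !addr0 !add0r -scalemxAr !mulmx1.
Qed.

Lemma Kdiag2 (A B : 'M[R]_2) e : mxK R e *m diag2 A B = block_mx 0 (sg e *: B) A 0.
Proof.
by rewrite /diag2 mulmx_block !mulmx0 !mul0mx !addr0 !add0r -scalemxAl !mul1mx.
Qed.

Let opp_block (A B C D : 'M[R]_2) :
  - (block_mx A B C D : 'M[R]_4) = block_mx (- A) (- B) (- C) (- D).
Proof. exact: (@opp_block_mx R 2 2 2 2). Qed.

Lemma normal_form_compatible k e mu n (S0 t0 : 'M[R]_n) : normal_form k e mu S0 t0 ->
  (if k is Aut then S0 else S0^T) *m t0 = sg mu *: (t0 *m S0).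
Proof.
case=> {k e mu n S0 t0} /=; intros;
  rewrite ?diag2T ?trmxK ?linearN /= ?trmxK ?diag2K ?Kdiag2 ?scale_block_mx ?scaler0
    ?scale1r ?scaleN1r ?scalerN ?opprK //;
  rewrite ?tr_scalar_mx -?scalar_mxM ?mul0mx ?mulmx0 ?trmx0 ?mul0mx ?oppr0 //;
  rewrite ?opp_block ?oppr0 /mxJ /mxR /mxT ?mxAE ?scalar22 ?mx22Z ?mx22T ?mx22M ?mx22N;
  first [ by rewrite mulrC
        | by congr mx22; ring
        | by rewrite !opprK
        | by congr mx22; case: (e) => /=; ring ].
Qed.

Lemma has_spectrum_scalar n (a : R) : has_spectrum (mxfun (a%:M : 'M_n)) (Sreal a).
Proof. by move=> x; rewrite mxfunE mul_scalar_mx. Qed.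

Lemma mxfun_square n (M : 'M[R]_n) c d : M *m M = c *: M - d *: 1%:M ->
  forall x, mxfun M (mxfun M x) = c *: mxfun M x - d *: x.
Proof.
move=> h x; rewrite !mxfunE mulmxA h mulmxBl -!scalemxAl mul1mx.
by [].
Qed.

Lemma has_spectrum_complex n (M : 'M[R]_n) (a b : R) :
  M *m M = (2 * a) *: M - (a ^+ 2 + b ^+ 2) *: 1%:M ->
  has_spectrum (mxfun M) (Scomplex a b).
Proof. exact: mxfun_square. Qed.

Lemma has_spectrum_pair (a : R) : has_spectrum (mxfun (mx22 a 0 0 (- a))) (Spair a).
Proof.
move=> x; rewrite !mxfunE mulmxA mx22M.
have -> : mx22 (a * a + 0 * 0) (a * 0 + 0 * - a) (0 * a + - a * 0) (0 * 0 + - a * - a)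
  = (a ^+ 2)%:M by rewrite scalar22; congr mx22; ring.
by rewrite mul_scalar_mx.
Qed.

Lemma has_spectrum_quad n (M : 'M[R]_n) (a b : R) :
  M *m M *m (M *m M) =
    (2 * (a ^+ 2 - b ^+ 2)) *: (M *m M) - ((a ^+ 2 + b ^+ 2) ^+ 2) *: 1%:M ->
  has_spectrum (mxfun M) (Squad a b).
Proof. by move=> h x; have := mxfun_square h x; rewrite !mxfunE !mulmxA. Qed.

Lemma mxA_square (a b : R) :
  mxA a b *m mxA a b = (2 * a) *: mxA a b - (a ^+ 2 + b ^+ 2) *: 1%:M.
Proof. by rewrite !mxAE scalar22 mx22M !mx22Z mx22N mx22D; congr mx22; ring. Qed.

Lemma mxA_square_tr (a b : R) :
  (mxA a b)^T *m (mxA a b)^T = (2 * a) *: (mxA a b)^T - (a ^+ 2 + b ^+ 2) *: 1%:M.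
Proof. by rewrite !mxAE mx22T scalar22 mx22M !mx22Z mx22N mx22D; congr mx22; ring. Qed.

Lemma mxA_quad (a b : R) : mxA a b *m mxA a b *m (mxA a b *m mxA a b) =
  (2 * (a ^+ 2 - b ^+ 2)) *: (mxA a b *m mxA a b) - ((a ^+ 2 + b ^+ 2) ^+ 2) *: 1%:M.
Proof. by rewrite !mxAE scalar22 !mx22M !mx22Z mx22N mx22D; congr mx22; ring. Qed.

Lemma diag2_quad (a b : R) (B : 'M[R]_2) : B *m B = mxA a b *m mxA a b \/
    B *m B = (mxA a b)^T *m (mxA a b)^T ->
  has_spectrum (mxfun (diag2 (mxA a b) B)) (Squad a b).
Proof.
move=> hB; apply: has_spectrum_quad; rewrite !diag2M diag2_1 !diag2Z.
rewrite -[X in _ + X]scaleN1r diag2Z diag2D !scaleN1r -mxA_quad; congr diag2.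
case: hB => ->; first by rewrite mxA_quad.
by rewrite -!trmx_mul -mulmxA mulmxA mxA_quad !linearB !linearZ /= trmx1.
Qed.

Lemma mxA_real (a : R) : mxA a 0 = a%:M.
Proof. by rewrite /mxA scale0r addr0 scalemx1. Qed.

Lemma mxA_imaginary (b : R) : b *: mxJ R = mxA 0 b.
Proof. by rewrite /mxA scale0r add0r. Qed.

(** An entry with a weak inequality falls under another spectrum at the boundary value, with the
    same dimension: [+-a] becomes [0], [+-a +- i b] becomes [+-i b], and [a +- i b] becomes [a]. *)
Lemma normal_form_spectrum k e mu n (S0 t0 : 'M[R]_n) : normal_form k e mu S0 t0 ->
  exists sp, [/\ spectrum_ok mu sp, has_spectrum (mxfun S0) sp
               & form_dim k e mu sp = n].
Proof.
have scal0 : mx22 0 0 0 (- 0) = 0%:M :> 'M[R]_2 by rewrite oppr0 scalar22.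
have negA (a b : R) : (- mxA a b) *m (- mxA a b) = mxA a b *m mxA a b.
  by rewrite mulNmx mulmxN opprK.
have negAT (a b : R) : (- (mxA a b)^T) *m (- (mxA a b)^T) = (mxA a b)^T *m (mxA a b)^T.
  by rewrite mulNmx mulmxN opprK.
case=> {k e mu n S0 t0}.
- by move=> e a; exists (Sreal a); split=> //; [left|apply: has_spectrum_scalar].
- move=> e a b b0; exists (Scomplex a b); split=> //; first by split; [|left].
  exact/has_spectrum_complex/mxA_square.
- move=> e; exists (Sreal 0); split=> //; first by right.
  by rewrite -[0](scale0r 1%:M) scalemx1; apply: has_spectrum_scalar.
- by move=> a a0; exists (Spair a); split=> //; apply: has_spectrum_pair.
- move=> b b0; rewrite mxA_imaginary; exists (Scomplex 0 b); split=> //.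
    by split; [|right].
  exact/has_spectrum_complex/mxA_square.
- move=> a b a0 b0; exists (Squad a b); split=> //.
  by apply: diag2_quad; left; apply: negA.
- move=> e a b b0 _; move: b0; rewrite le_eqVlt => /orP[/eqP<-|b0].
    rewrite mxA_real; exists (Sreal a); split=> //; first by left.
    exact: has_spectrum_scalar.
  exists (Scomplex a b); split=> //; first by split; [|left].
  exact/has_spectrum_complex/mxA_square.
- move=> a; rewrite le_eqVlt => /orP[/eqP<-|a0].
    rewrite scal0; exists (Sreal 0); split=> //; first by right.
    exact: has_spectrum_scalar.
  by exists (Spair a); split=> //; apply: has_spectrum_pair.
- move=> a b; rewrite le_eqVlt => /orP[/eqP<-|a0] b0; last first.
    by exists (Squad a b); split=> //; apply: diag2_quad; left; apply: negA.
  exists (Scomplex 0 b); split=> //; first by split; [|right].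
  apply: has_spectrum_complex; rewrite diag2M negA mxA_square diag2_1 mulr0 !scale0r.
  by rewrite -!scaleNr diag2Z !add0r.
- by move=> e a; exists (Sreal a); split=> //; [left|apply: has_spectrum_scalar].
- move=> a b b0; exists (Scomplex a b); split=> //; first by split; [|left].
  exact/has_spectrum_complex/mxA_square.
- move=> e; exists (Sreal 0); split=> //; first by right.
  by rewrite -[0](scale0r 1%:M) scalemx1; apply: has_spectrum_scalar.
- by move=> a a0; exists (Spair a); split=> //; apply: has_spectrum_pair.
- move=> e b b0; rewrite mxA_imaginary; exists (Scomplex 0 b); split=> //.
    by split; [|right].
  exact/has_spectrum_complex/mxA_square.
- move=> a b a0 b0; exists (Squad a b); split=> //.
  by apply: diag2_quad; right; apply: negAT.
- move=> a; rewrite scalemx1; exists (Sreal a); split=> //; first by left.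
  exact: has_spectrum_scalar.
- move=> a b b0; exists (Scomplex a b); split=> //; first by split; [|left].
  apply: has_spectrum_complex; rewrite diag2M mxA_square mxA_square_tr.
  by rewrite -!scaleNr diag2_1 !diag2Z diag2D.
- move=> a; rewrite le_eqVlt => /orP[/eqP<-|a0].
    rewrite scal0; exists (Sreal 0); split=> //; first by right.
    exact: has_spectrum_scalar.
  by exists (Spair a); split=> //; apply: has_spectrum_pair.
- move=> e b b0; rewrite mxA_imaginary; exists (Scomplex 0 b); split=> //.
    by split; [|right].
  exact/has_spectrum_complex/mxA_square.
move=> a b a0 b0; exists (Squad a b); split=> //.
by apply: diag2_quad; right; apply: negAT.
Qed.

Lemma normal_form_system k e mu n (S0 t0 : 'M[R]_n) : normal_form k e mu S0 t0 ->
  [/\ indecomposable_system k mu (@std_dot R n) (mxfun t0) (mxfun S0),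
      has_symmetry (@std_dot R n) e {:'cV[R]_n}%VS (mxfun t0)
    & semisimple (mxfun S0)].
Proof.
move=> nf; have [t0T t0_sq] := normal_form_structure nf.
have [sp [ok hsp dimE]] := normal_form_spectrum nf.
have compat := normal_form_compatible nf.
pose dot := std_inner R n.
have dotM (M : 'M[R]_n) x y : dot (mxfun M x) y = dot x (mxfun M^T y).
  by rewrite /dot /= /std_dot !mxfunE trmx_mul mulmxA.
have ss x : mxfun t0 (mxfun t0 x) = sg e *: x.
  by rewrite !mxfunE mulmxA t0_sq -scalemxAl mul1mx.
have sym x y : dot (mxfun t0 x) y = sg e * dot x (mxfun t0 y).
  by rewrite dotM t0T mxfunE -scalemxAl dotZr mxfunE.
have hs : structure_map dot e (mxfun t0) by [].
have cS : compatible dot k mu (mxfun t0) (mxfun S0).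
  case: (k) compat => /= hc x.
    by rewrite !mxfunE !mulmxA hc -scalemxAl.
  by move=> y; rewrite dotM !mxfunE !mulmxA hc -scalemxAl dotZr.
split.
- split.
  + split=> [x y|]; first by rewrite -/(dot _ _) sym ss dotZr mulrA sgK mul1r.
    by exists e; apply/lfunP => x; rewrite comp_lfunE scale_lfunE id_lfunE ss.
  + apply/lfunP => x; rewrite /gamma !comp_lfunE scale_lfunE.
    have s0 := lker_structure_map hs.
    suff -> : (if k is Aut then mxfun S0 else adjoint (@std_dot R n) (mxfun S0))
        (mxfun t0 x) = mxfun t0 (sg mu *: mxfun S0 x) by rewrite lker0_lfunK.
    rewrite lfunZ; case: (k) cS => /= h; first exact: h.
    apply/eqP; rewrite -subr_eq0; apply/eqP.
    apply: (dot_nondegenerate (dot := dot)) => y.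
    by rewrite dotDr dotNr dotZr -h -adjointE subrr.
  apply: (indecomposable_pair_of_dim hs cS ok hsp).
  by rewrite dimE dimvf dim_matrix; lia.
- by move=> x y _ _; apply: sym.
exact: spectrum_semisimple ok hsp.
Qed.

End NormalForms.

(** * Distinct normal forms are inequivalent *)

Section Inequivalence.
Variable R : realType.

Lemma equivalent_mxP k n (S0 t0 S1 t1 : 'M[R]_n) : equivalent_mx k S0 t0 S1 t1 ->
  exists G : 'M[R]_n, [/\ G \in unitmx, G *m S0 = S1 *m G
    & match k with Aut => G *m t0 = t1 *m G | Antiaut => G^T *m t1 *m G = t0 end].
Proof.
move=> [g [gV g_inj gS gt]].
pose G : 'M[R]_n := \matrix_(i, j) g (delta_mx j 0) i 0.
have GE x : g x = G *m x.
  rewrite [x in g x](_ : x = \sum_j x j 0 *: delta_mx j 0).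
    rewrite lfun_sum; apply/colP => i; rewrite summxE mxE.
    by apply: eq_bigr => j _; rewrite lfunZ !mxE mulrC.
  apply/colP => i; rewrite summxE (bigD1 i) //= big1 => [|j ji].
    by rewrite !mxE !eqxx mulr1 addr0.
  by rewrite !mxE eq_sym (negPf ji) mulr0.
have ext (A B : 'M[R]_n) : (forall x : 'cV_n, A *m x = B *m x) -> A = B.
  move=> AB; apply/matrixP => i j; have := AB (delta_mx j 0).
  by rewrite -!colE => /colP/(_ i); rewrite !mxE.
exists G; split.
- rewrite -unitmx_tr -row_free_unit; apply/inj_row_free => v vG.
  have : G *m v^T = 0 by rewrite -[G]trmxK -trmx_mul vG trmx0.
  rewrite -GE => gv; suff v0 : v^T = 0 by rewrite -[v]trmxK v0 trmx0.
  by apply: g_inj; rewrite ?memvf // gv lfun0.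
- by apply: ext => x; have := gS x (memvf x); rewrite !mxfunE !GE !mulmxA.
case: k gt => gt.
  by apply: ext => x; have := gt x (memvf x); rewrite !mxfunE !GE !mulmxA.
apply/matrixP => i j.
have dE (M : 'M[R]_n) : (delta_mx 0 i *m M *m delta_mx j 0 : 'M_1) 0 0 = M i j.
  by rewrite -rowE -colE !mxE.
have := gt (delta_mx i 0) (delta_mx j 0) (memvf _) (memvf _).
by rewrite /std_dot !mxfunE !GE trmx_mul trmx_delta -(dE (G^T *m t1 *m G)) -(dE t0) !mulmxA.
Qed.

Lemma similar_invariants n (G A B : 'M[R]_n) : G \in unitmx -> G *m A = B *m G ->
  [/\ \tr A = \tr B, \tr (A *m A) = \tr (B *m B) & \det A = \det B].
Proof.
move=> Gu GA; have AE : A = invmx G *m (B *m G).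
  by rewrite -GA mulmxA mulVmx // mul1mx.
have trE (M : 'M[R]_n) : \tr (invmx G *m (M *m G)) = \tr M.
  by rewrite mxtrace_mulC -mulmxA mulmxV // mulmx1.
split; first by rewrite AE trE.
  rewrite -[RHS]trE [in LHS]AE; congr mxtrace.
  by rewrite !mulmxA mulmxK // -!mulmxA.
by rewrite AE !det_mulmx mulrCA -det_mulmx mulVmx // det1 mulr1.
Qed.

Lemma sg_inj (d d' : sign) : sg d = sg d' :> R -> d = d'.
Proof.
by case: d d' => [] [] //= h; exfalso; lra.
Qed.

Lemma gram_sign n (G : 'M[R]_n) (d d' : sign) : (0 < n)%N ->
  sg d' *: (G^T *m G) = sg d *: 1%:M -> d = d'.
Proof.
case: n G => // n G _ /matrixP/(_ 0 0); rewrite !mxE eqxx mulr1.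
under eq_bigr do rewrite mxE.
set r := \sum_i _; have r0 : 0 <= r by apply: sumr_ge0 => i _; apply: sqr_ge0.
by case: d d' => [] [] //= h; exfalso; lra.
Qed.

(** [J] is a polynomial in [mxA a b]. This reduces the entries with [t = +-J] to the case of a
    matrix [G] that commutes with [t]. *)
Lemma commute_mxJ (G : 'M[R]_2) a b : b != 0 -> G *m mxA a b = mxA a b *m G ->
  G *m mxJ R = mxJ R *m G.
Proof.
move=> b0; rewrite /mxA mulmxDr mulmxDl -!scalemxAr -!scalemxAl mulmx1 mul1mx.
by move/addrI/(scalerI b0).
Qed.

Lemma quad_parameters (a b a' b' : R) : 0 <= b -> 0 <= b' ->
  a ^+ 2 - b ^+ 2 = a' ^+ 2 - b' ^+ 2 ->
  (a ^+ 2 + b ^+ 2) ^+ 2 = (a' ^+ 2 + b' ^+ 2) ^+ 2 -> a ^+ 2 = a' ^+ 2 /\ b = b'.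
Proof.
move=> b0 b'0 h1 /eqP; rewrite eqrXn2 ?addr_ge0 ?sqr_ge0 // => /eqP h2.
split; first by lra.
by apply/eqP; rewrite -(eqrXn2 (n := 2)) //; apply/eqP; lra.
Qed.

Lemma nonneg_square_eq (a a' : R) : 0 <= a -> 0 <= a' -> a ^+ 2 = a' ^+ 2 -> a = a'.
Proof. by move=> a0 a'0 h; apply/eqP; rewrite -(eqrXn2 (n := 2)) // h. Qed.

Lemma diag2_trace (A B : 'M[R]_2) : \tr (diag2 A B) = \tr A + \tr B.
Proof. exact: mxtrace_block. Qed.

Lemma diag2_det (A B : 'M[R]_2) : \det (diag2 A B) = \det A * \det B.
Proof. exact: det_ublock. Qed.

(** For [mu = Minus] the trace itself vanishes, so the trace of the square takes its place. *)
Lemma diag2_invariants (a b : R) B : B *m B = mxA a b *m mxA a b \/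
    B *m B = (mxA a b)^T *m (mxA a b)^T -> \det B = a ^+ 2 + b ^+ 2 ->
  \tr (diag2 (mxA a b) B *m diag2 (mxA a b) B) = 4 * (a ^+ 2 - b ^+ 2) /\
  \det (diag2 (mxA a b) B) = (a ^+ 2 + b ^+ 2) ^+ 2.
Proof.
move=> hB dB; rewrite diag2M diag2_trace diag2_det dB.
have -> : \tr (B *m B) = \tr (mxA a b *m mxA a b).
  by case: hB => ->; rewrite // -trmx_mul mxtrace_tr.
by rewrite mxAE mx22M tr22 det22; split; ring.
Qed.

(* Case analysis on [n] replaces the dependent inversion of [normal_form]. In
   dimension 4 weak inequalities are enough to distinguish the forms. *)
Definition forms (k : kind) (e mu : sign) (n : nat) : 'M[R]_n -> 'M[R]_n -> Prop :=
  match k, e, mu, n return 'M[R]_n -> 'M[R]_n -> Prop with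
  | _, Plus, Plus, 1%N => fun S t => exists d a, S = a%:M /\ t = (sg d)%:M
  | Aut, Plus, Plus, 2%N => fun S t => exists d a b,
      [/\ 0 < b, S = mxA a b & t = sg d *: 1%:M]
  | _, Plus, Minus, 1%N => fun S t => exists d, S = 0 /\ t = (sg d)%:M
  | Aut, Plus, Minus, 2%N => fun S t =>
      (exists a, [/\ 0 < a, S = mx22 a 0 0 (- a) & t = mxT R]) \/
      (exists b, [/\ 0 < b, S = b *: mxJ R & t = mxR R])
  | Aut, e, Minus, 4%N => fun S t => exists a b,
      [/\ 0 <= a, 0 <= b, S = diag2 (mxA a b) (- mxA a b) & t = mxK R e]
  | Aut, Minus, Plus, 2%N => fun S t => exists d a b,
      [/\ 0 <= b, b = 0 -> d = Plus, S = mxA a b & t = sg d *: mxJ R]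
  | Aut, Minus, Minus, 2%N => fun S t => exists a,
      [/\ 0 <= a, S = mx22 a 0 0 (- a) & t = mxJ R]
  | Antiaut, Plus, Plus, 2%N => fun S t => exists a b,
      [/\ 0 < b, S = mxA a b & t = mxR R]
  | Antiaut, Plus, Minus, 2%N => fun S t =>
      (exists a, [/\ 0 < a, S = mx22 a 0 0 (- a) & t = mxT R]) \/
      (exists d b, [/\ 0 < b, S = b *: mxJ R & t = sg d *: 1%:M])
  | Antiaut, e, Minus, 4%N => fun S t => exists a b,
      [/\ 0 <= a, 0 <= b, S = diag2 (mxA a b) (- (mxA a b)^T) & t = mxK R e]
  | Antiaut, Minus, Plus, 2%N => fun S t => exists a, S = a *: 1%:M /\ t = mxJ R
  | Antiaut, Minus, Plus, 4%N => fun S t => exists a b,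
      [/\ 0 <= b, S = diag2 (mxA a b) (mxA a b)^T & t = mxK R Minus]
  | Antiaut, Minus, Minus, 2%N => fun S t =>
      (exists a, [/\ 0 <= a, S = mx22 a 0 0 (- a) & t = mxJ R]) \/
      (exists d b, [/\ 0 < b, S = b *: mxJ R & t = sg d *: mxJ R])
  | _, _, _, _ => fun _ _ => False
  end.

Lemma normal_form_forms k e mu n (S0 t0 : 'M[R]_n) :
  normal_form k e mu S0 t0 -> forms k e mu S0 t0.
Proof.
case=> {k e mu n S0 t0} /=.
- by move=> e a; exists e, a.
- by move=> e a b b0; exists e, a, b.
- by move=> e; exists e.
- by move=> a a0; left; exists a.
- by move=> b b0; right; exists b.
- by move=> a b a0 b0; exists a, b; rewrite !ltW.
- by move=> e a b b0 he; exists e, a, b.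
- by move=> a a0; exists a.
- by move=> a b a0 b0; exists a, b; rewrite (ltW b0).
- by move=> e a; exists e, a.
- by move=> a b b0; exists a, b.
- by move=> e; exists e.
- by move=> a a0; left; exists a.
- by move=> e b b0; right; exists e, b.
- by move=> a b a0 b0; exists a, b; rewrite !ltW.
- by move=> a; exists a.
- by move=> a b b0; exists a, b; rewrite ltW.
- by move=> a a0; left; exists a.
- by move=> e b b0; right; exists e, b.
by move=> a b a0 b0; exists a, b; rewrite !ltW.
Qed.

Lemma mxA_inj_invariants (a b a' b' : R) : 0 <= b -> 0 <= b' ->
  \tr (mxA a b) = \tr (mxA a' b') -> \det (mxA a b) = \det (mxA a' b') ->
  a = a' /\ b = b'.
Proof.
move=> b0 b'0; rewrite !mxAE !tr22 !det22 => h1 h2.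
have aa : a = a' by lra.
by split=> //; apply: nonneg_square_eq => //; rewrite aa in h2; lra.
Qed.

Lemma pair_inj_det (a a' : R) : 0 <= a -> 0 <= a' ->
  \det (mx22 a 0 0 (- a)) = \det (mx22 a' 0 0 (- a')) -> a = a'.
Proof.
by move=> a0 a'0; rewrite !det22 => h; apply: nonneg_square_eq => //; lra.
Qed.

Lemma det_mxJ (b : R) : \det (b *: mxJ R) = b ^+ 2.
Proof. by rewrite /mxJ mx22Z det22; ring. Qed.

Lemma mxJ_inj_det (b b' : R) : 0 < b -> 0 < b' ->
  \det (b *: mxJ R) = \det (b' *: mxJ R) -> b = b'.
Proof.
by move=> /ltW b0 /ltW b'0; rewrite !det_mxJ; apply: nonneg_square_eq.
Qed.

Lemma pair_mxJ_det (a b : R) : 0 < b ->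
  \det (mx22 a 0 0 (- a)) = \det (b *: mxJ R) -> False.
Proof.
move=> b0; rewrite det_mxJ det22 => h.
have b2 : 0 < b ^+ 2 by rewrite exprn_gt0.
by have a2 := sqr_ge0 a; lra.
Qed.

Lemma mxJ_unit : mxJ R \in unitmx.
Proof. by rewrite unitmxE -[mxJ R]scale1r det_mxJ expr1n unitr1. Qed.

Lemma diag2_neg_invariants (a b a' b' : R) :
  0 <= a -> 0 <= a' -> 0 <= b -> 0 <= b' ->
  4 * (a ^+ 2 - b ^+ 2) = 4 * (a' ^+ 2 - b' ^+ 2) ->
  (a ^+ 2 + b ^+ 2) ^+ 2 = (a' ^+ 2 + b' ^+ 2) ^+ 2 -> a = a' /\ b = b'.
Proof.
move=> a0 a'0 b0 b'0 h1; case/(quad_parameters b0 b'0); first by lra.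
by move=> aa ->; split=> //; apply: nonneg_square_eq.
Qed.

Lemma diag2_opp_invariants (a b : R) :
  \tr (diag2 (mxA a b) (- mxA a b) *m diag2 (mxA a b) (- mxA a b)) =
    4 * (a ^+ 2 - b ^+ 2) /\
  \det (diag2 (mxA a b) (- mxA a b)) = (a ^+ 2 + b ^+ 2) ^+ 2.
Proof.
apply: diag2_invariants; first by left; rewrite mulNmx mulmxN opprK.
by rewrite mxAE mx22N det22; ring.
Qed.

Lemma diag2_oppT_invariants (a b : R) :
  \tr (diag2 (mxA a b) (- (mxA a b)^T) *m diag2 (mxA a b) (- (mxA a b)^T)) =
    4 * (a ^+ 2 - b ^+ 2) /\
  \det (diag2 (mxA a b) (- (mxA a b)^T)) = (a ^+ 2 + b ^+ 2) ^+ 2.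
Proof.
apply: diag2_invariants; first by right; rewrite mulNmx mulmxN opprK.
by rewrite mxAE mx22T mx22N det22; ring.
Qed.

Lemma diag2_opp_inj (a b a' b' : R) :
    0 <= a -> 0 <= a' -> 0 <= b -> 0 <= b' ->
    let D x y := diag2 (mxA x y) (- mxA x y) in
    \tr (D a b *m D a b) = \tr (D a' b' *m D a' b') ->
  \det (D a b) = \det (D a' b') -> a = a' /\ b = b'.
Proof.
move=> a0 a'0 b0 b'0 D; rewrite /D.
have [-> ->] := diag2_opp_invariants a b; have [-> ->] := diag2_opp_invariants a' b'.
exact: diag2_neg_invariants.
Qed.

Lemma diag2_oppT_inj (a b a' b' : R) :
    0 <= a -> 0 <= a' -> 0 <= b -> 0 <= b' ->
    let D x y := diag2 (mxA x y) (- (mxA x y)^T) in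
    \tr (D a b *m D a b) = \tr (D a' b' *m D a' b') ->
  \det (D a b) = \det (D a' b') -> a = a' /\ b = b'.
Proof.
move=> a0 a'0 b0 b'0 D; rewrite /D.
have [-> ->] := diag2_oppT_invariants a b; have [-> ->] := diag2_oppT_invariants a' b'.
exact: diag2_neg_invariants.
Qed.

Lemma diag2_tr_invariants (a b : R) :
  \tr (diag2 (mxA a b) (mxA a b)^T *m diag2 (mxA a b) (mxA a b)^T) =
    4 * (a ^+ 2 - b ^+ 2) /\
  \det (diag2 (mxA a b) (mxA a b)^T) = (a ^+ 2 + b ^+ 2) ^+ 2.
Proof.
apply: diag2_invariants; first by right.
by rewrite mxAE mx22T det22; ring.
Qed.

Lemma diag2_tr_trace (a b a' b' : R) :
  \tr (diag2 (mxA a b) (mxA a b)^T) = \tr (diag2 (mxA a' b') (mxA a' b')^T) ->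
  a = a'.
Proof. by rewrite !diag2_trace !mxtrace_tr !mxAE !tr22 => h; lra. Qed.

(** Both sides are multiples of the invertible matrix [G *m M]. *)
Lemma commuting_sign n (G M : 'M[R]_n) d d' : (0 < n)%N -> G \in unitmx ->
  M \in unitmx -> G *m M = M *m G ->
  G *m (sg d *: M) = (sg d' *: M) *m G -> d = d'.
Proof.
case: n G M => // n G M _ Gu Mu GM.
rewrite -scalemxAr -scalemxAl -GM => /eqP.
rewrite -subr_eq0 -scalerBl scaler_eq0 subr_eq0 => /orP[/eqP/sg_inj //|/eqP GM0].
have : G *m M \in unitmx by rewrite unitmx_mul Gu.
by rewrite GM0 unitmxE det0 unitr0.
Qed.

(* Cancelling [M] leaves [G^T *m G] proportional to the identity, and a Gram
   matrix has nonnegative diagonal entries. *)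
Lemma congruence_sign n (G M : 'M[R]_n) d d' : (0 < n)%N ->
  M \in unitmx -> G *m M = M *m G ->
  G^T *m (sg d' *: M) *m G = sg d *: M -> d = d'.
Proof.
move=> n0 Mu GM; rewrite -scalemxAr -scalemxAl -mulmxA -GM mulmxA => h.
apply: (gram_sign n0 (G := G)).
have := congr1 (mulmx^~ (invmx M)) h.
by rewrite -!scalemxAl mulmxK // mulmxV.
Qed.

Lemma normal_form_inequivalent k e mu n (S0 t0 S1 t1 : 'M[R]_n) :
  normal_form k e mu S0 t0 -> normal_form k e mu S1 t1 ->
  equivalent_mx k S0 t0 S1 t1 -> S0 = S1 /\ t0 = t1.
Proof.
move=> /normal_form_forms f0 /normal_form_forms f1 /equivalent_mxP[G [Gu GS Gt]].
have [trE trE2 detE] := similar_invariants Gu GS.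
have scalar1 a : a%:M = a *: 1%:M :> 'M[R]_n by rewrite scalemx1.
have G1 : G *m 1%:M = 1%:M *m G by rewrite mulmx1 mul1mx.
have jb (b : R) : b *: mxJ R = mxA 0 b by rewrite /mxA scale0r add0r.
have jb0 (b : R) : 0 < b -> b != 0 by move/lt0r_neq0.
(* [forms] is empty outside the dimensions [1], [2] and [4], so splitting [n] leaves only the listed
   entries. *)
case: k e mu n => [] [] [] [|[|[|[|[|n]]]]] //= in S0 t0 S1 t1 f0 f1 G Gu GS Gt trE trE2 detE scalar1 G1 *.
- case: f0 f1 => [d [a [S0E t0E]]] [d' [a' [S1E t1E]]]; subst.
  have aa : a = a' by move: trE; rewrite !mxtrace_scalar !mulr1n.
  subst a'.
  rewrite !(scalar1 (sg _)) in Gt *.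
  by rewrite (commuting_sign _ Gu (unitmx1 _ _) G1 Gt).
- case: f0 f1 => [d [a [b [b0 S0E t0E]]]] [d' [a' [b' [b'0 S1E t1E]]]]; subst.
  have [-> ->] := mxA_inj_invariants (ltW b0) (ltW b'0) trE detE.
  by rewrite (commuting_sign _ Gu (unitmx1 _ _) G1 Gt).
- case: f0 f1 => [d [S0E t0E]] [d' [S1E t1E]]; subst.
  rewrite !(scalar1 (sg _)) in Gt *.
  by rewrite (commuting_sign _ Gu (unitmx1 _ _) G1 Gt).
- case: f0 f1 => [[a [a0 S0E t0E]]|[b [b0 S0E t0E]]] [[a' [a'0 S1E t1E]]|[b' [b'0 S1E t1E]]]; subst.
  + by rewrite (pair_inj_det (ltW a0) (ltW a'0) detE).
  + by case: (pair_mxJ_det b'0 detE).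
  + by case: (pair_mxJ_det b0 (esym detE)).
  by rewrite (mxJ_inj_det b0 b'0 detE).
- case: f0 f1 => [a [b [a0 b0 S0E t0E]]] [a' [b' [a'0 b'0 S1E t1E]]]; subst.
  by have [-> ->] := diag2_opp_inj a0 a'0 b0 b'0 trE2 detE.
- case: f0 f1 => [d [a [b [b0 hd S0E t0E]]]] [d' [a' [b' [b'0 hd' S1E t1E]]]]; subst.
  have [aa bb] := mxA_inj_invariants b0 b'0 trE detE; subst.
  (* At [b' = 0] the matrix [S] is scalar and does not determine [J]; there the table fixes the
     sign. *)
  have [bE|bN] := eqVneq b' 0; first by rewrite hd ?hd'.
  by rewrite (commuting_sign _ Gu mxJ_unit (commute_mxJ bN GS) Gt).
- case: f0 f1 => [a [a0 S0E t0E]] [a' [a'0 S1E t1E]]; subst.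
  by rewrite (pair_inj_det a0 a'0 detE).
- case: f0 f1 => [a [b [a0 b0 S0E t0E]]] [a' [b' [a'0 b'0 S1E t1E]]]; subst.
  by have [-> ->] := diag2_opp_inj a0 a'0 b0 b'0 trE2 detE.
- case: f0 f1 => [d [a [S0E t0E]]] [d' [a' [S1E t1E]]];
    rewrite t0E t1E in Gt *; rewrite S0E S1E in GS trE trE2 detE *.
  have aa : a = a' by move: trE; rewrite !mxtrace_scalar !mulr1n.
  subst a'.
  rewrite !(scalar1 (sg _)) in Gt *.
  by rewrite (congruence_sign _ (unitmx1 _ _) G1 Gt).
- case: f0 f1 => [a [b [b0 S0E t0E]]] [a' [b' [b'0 S1E t1E]]];
    rewrite t0E t1E in Gt *; rewrite S0E S1E in GS trE trE2 detE *.
  by have [-> ->] := mxA_inj_invariants (ltW b0) (ltW b'0) trE detE.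
- case: f0 f1 => [d [S0E t0E]] [d' [S1E t1E]];
    rewrite t0E t1E in Gt *; rewrite S0E S1E in GS trE trE2 detE *.
  rewrite !(scalar1 (sg _)) in Gt *.
  by rewrite (congruence_sign _ (unitmx1 _ _) G1 Gt).
- case: f0 f1 => [[a [a0 S0E t0E]]|[d [b [b0 S0E t0E]]]]
    [[a' [a'0 S1E t1E]]|[d' [b' [b'0 S1E t1E]]]];
    rewrite t0E t1E in Gt *; rewrite S0E S1E in GS trE trE2 detE *.
  + by rewrite (pair_inj_det (ltW a0) (ltW a'0) detE).
  + by case: (pair_mxJ_det b'0 detE).
  + by case: (pair_mxJ_det b0 (esym detE)).
  rewrite (mxJ_inj_det b0 b'0 detE).
  by rewrite (congruence_sign _ (unitmx1 _ _) G1 Gt).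
- case: f0 f1 => [a [b [a0 b0 S0E t0E]]] [a' [b' [a'0 b'0 S1E t1E]]];
    rewrite t0E t1E in Gt *; rewrite S0E S1E in GS trE trE2 detE *.
  by have [-> ->] := diag2_oppT_inj a0 a'0 b0 b'0 trE2 detE.
- case: f0 f1 => [a [S0E t0E]] [a' [S1E t1E]];
    rewrite t0E t1E in Gt *; rewrite S0E S1E in GS trE trE2 detE *.
  have -> // : a = a'.
  by move: trE; rewrite !mxtraceZ mxtrace1; apply: mulIf; rewrite pnatr_eq0.
- case: f0 f1 => [a [b [b0 S0E t0E]]] [a' [b' [b'0 S1E t1E]]];
    rewrite t0E t1E in Gt *; rewrite S0E S1E in GS trE trE2 detE *.
  have [h1 h2] := diag2_tr_invariants a b.
  have [h3 h4] := diag2_tr_invariants a' b'.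
  have h5 := etrans (esym h1) (etrans trE2 h3).
  have h6 := etrans (esym h2) (etrans detE h4).
  (* Here [a] may be negative, and the trace yields its sign, which the squares leave open. *)
  have aa := diag2_tr_trace trE.
  have [] := quad_parameters b0 b'0 _ h6; last by rewrite aa => _ ->.
  by apply: (mulfI _ h5); rewrite pnatr_eq0.
- case: f0 f1 => [[a [a0 S0E t0E]]|[d [b [b0 S0E t0E]]]]
    [[a' [a'0 S1E t1E]]|[d' [b' [b'0 S1E t1E]]]];
    rewrite t0E t1E in Gt *; rewrite S0E S1E in GS trE trE2 detE *.
  + by rewrite (pair_inj_det a0 a'0 detE).
  + by case: (pair_mxJ_det b'0 detE).
  + by case: (pair_mxJ_det b0 (esym detE)).
  have bb := mxJ_inj_det b0 b'0 detE; rewrite bb !jb in GS *.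
  by rewrite (congruence_sign _ mxJ_unit (commute_mxJ (jb0 _ b'0) GS) Gt).
case: f0 f1 => [a [b [a0 b0 S0E t0E]]] [a' [b' [a'0 b'0 S1E t1E]]];
    rewrite t0E t1E in Gt *; rewrite S0E S1E in GS trE trE2 detE *.
by have [-> ->] := diag2_oppT_inj a0 a'0 b0 b'0 trE2 detE.
Qed.

End Inequivalence.

Theorem theorem4p1 (R : realType) :
  (forall (V : vectType R) (dot : {dot V for @idfun R}) (k : kind) (mu : sign)
          (s L S N : 'End(V)),
     indecomposable_system k mu dot s L ->
     jordan_chevalley L S N ->
     [/\ (* a reduced space and a reduced structure map exist *)
         exists (Y : {vspace V}) (t : 'End(V)), reduction dot k s S N Y t,
         (* the normal form of S on Y determines that of L on X *)
         forall (s' L' S' N' : 'End(V)),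
           indecomposable_system k mu dot s' L' ->
           jordan_chevalley L' S' N' ->
           forall (Y Y' : {vspace V}) (t t' : 'End(V)),
             reduction dot k s S N Y t ->
             reduction dot k s' S' N' Y' t' ->
             equivalent k dot dot Y Y' S t S' t' ->
             equivalent k dot dot {:V}%VS {:V}%VS L s L' s'
       & (* Y is of the form Y_lambda, and (S, t) has one of the listed
            normal forms on Y *)
         forall (Y : {vspace V}) (t : 'End(V)),
           reduction dot k s S N Y t ->
           (exists W : {vspace V},
              [/\ (W <= Y)%VS, indecomposable [:: S] W
                & Y = (W + t @: W)%VS]) /\
           (exists (eps : sign) (n : nat) (S0 t0 : 'M[R]_n),
              [/\ has_symmetry dot eps Y t, normal_form k eps mu S0 t0
                & equivalent k dot (@std_dot R n) Y {:'cV[R]_n}%VS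
                    S t (mxfun S0) (mxfun t0)])]) /\
  (* each listed pair is an indecomposable pair of its type *)
  (forall (k : kind) (eps mu : sign) (n : nat) (S0 t0 : 'M[R]_n),
     normal_form k eps mu S0 t0 ->
     [/\ indecomposable_system k mu (@std_dot R n) (mxfun t0) (mxfun S0),
         has_symmetry (@std_dot R n) eps {:'cV[R]_n}%VS (mxfun t0)
       & semisimple (mxfun S0)]) /\
  (* distinct listed pairs of one type, in particular those that differ in the
     sign of t0 only, are inequivalent *)
  (forall (k : kind) (eps mu : sign) (n : nat) (S0 t0 S1 t1 : 'M[R]_n),
     normal_form k eps mu S0 t0 -> normal_form k eps mu S1 t1 ->
     equivalent_mx k S0 t0 S1 t1 -> S0 = S1 /\ t0 = t1).
Proof.
split=> [V dot k mu s L S N hL JC|]; last first.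
  by split; [exact: normal_form_system | exact: normal_form_inequivalent].
split; first exact: system_reduction hL JC.
  by move=> s' L' S' N' hL' JC' Y Y' t t'; exact: reduction_determines hL JC hL' JC'.
by move=> Y t; exact: system_normal_form hL JC.
Qed.
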